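(* Let $\Omega$ be the set of band-dominated operators on $\ell^2(\mathbb Z)=\ell^2(\mathbb Z,\mathbb C)$. For $A\in\Omega$ and $n\in\mathbb N$, $\Gamma^n_{\mathrm{fin}}(A)$ can be computed in finitely many arithmetic operations, given $\eta_n:=\mathcal D_2(A,n)$, $K_n:=\mathcal A_n(A_n,n)$, where $A_n:=\mathcal D_1(A,n)$, $(\alpha_{\max},\beta_{\max},\gamma_{\max}):=\mathcal B_n(A_n)$, and, for $k\in K_n$, $((A_n)^+_{n,k},((A_n)^* )^+_{n,k}):=\mathcal C_n(A_n,k,n)$. Further, $d_H(\Gamma^n_{\mathrm{fin}}(A),\mathrm{Spec}\,A)\to0$ as $n\to\infty$, and also, where $$\widehat\Gamma^n_{\mathrm{fin}}(A):=\Gamma^n_{\mathrm{fin}}(A)+\tfrac2n\overline{\mathbb D},$$ $d_H(\widehat\Gamma^n_{\mathrm{fin}}(A),\mathrm{Spec}\,A)\to0$ as $n\to\infty$, with $\mathrm{Spec}\,A\subset\widehat\Gamma^n_{\mathrm{fin}}(A)$ for each $n\in\mathbb N$.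
   Context: An operator on $\ell^2(\mathbb Z,X)$ with matrix $[a_{i,j}]$ is banded with band-width $w$ if $a_{i,j}=0$ for $|i-j|>w$; band-dominated operators are operator norm limits of banded operators. For $p\in\mathbb N$, $\Omega^p_T$ is the set of bounded tridiagonal operators $B$ on $\ell^2(\mathbb Z,\mathbb C^p)$ ($\mathbb C^p$ Euclidean), with $p\times p$ matrix entries $\alpha_j=b_{j+1,j}$, $\beta_j=b_{j,j}$, $\gamma_j=b_{j-1,j}$, zeros elsewhere; $B^*$ has matrix $[b_{j,i}^T]$; $\|\alpha\|_\infty:=\sup_j\|\alpha_j\|$, etc. $B^+_{n,k}$ is the $(n+2)\times n$ submatrix with rows $k,\dots,k+n+1$ and columns $k+1,\dots,k+n$ (entries in $\mathbb C^{p\times p}$); $I^+_n$ is the $n\times n$ identity (with $p\times p$ identity blocks) with one zero row added on top and one at the bottom. Norms are operator norms induced by Euclidean norms; $\nu(C):=\inf_{\|x\|=1}\|Cx\|$. Input maps (any fixed maps with these properties), for $p\in\mathbb N$: (1) $\mathcal A_p:\Omega^p_T\times\mathbb N\to P(\mathbb Z)$, $(B,n)\mapsto K_n$ finite such that for all $k\in\mathbb Z$ there is $j\in K_n$ with $\|B^+_{n,k}-B^+_{n,j}\|\le1/n$ and $\|(B^* )^+_{n,k}-(B^* )^+_{n,j}\|\le1/n$; (2) $\mathcal B_p:\Omega^p_T\to\mathbb R^3$, $B\mapsto(\alpha_{\max},\beta_{\max},\gamma_{\max})$ with $\alpha_{\max}\ge\|\alpha\|_\infty$, $\beta_{\max}\ge\|\beta\|_\infty$,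 $\gamma_{\max}\ge\|\gamma\|_\infty$; (3) $\mathcal C_p:(B,k,n)\mapsto(B^+_{n,k},(B^* )^+_{n,k})$; (4) $\mathcal D=(\mathcal D_1,\mathcal D_2)$, $(A,n)\mapsto(A_n,\eta_n)\in\Omega^n_T\times\mathbb R$ for $A\in\Omega$, where $A_n:=\mathcal I_nA^{(n)}\mathcal I_n^{-1}$; $A^{(n)}$ has entries $a^{(n)}_{i,j}:=(1-\frac{|i-j|}{n+1})a_{i,j}$ for $|i-j|\le n$ and $0$ otherwise; $\mathcal I_n:\ell^2(\mathbb Z)\to\ell^2(\mathbb Z,\mathbb C^n)$ maps $(x_i)$ to $(\xi_i)$ with $\xi_i=(x_{ni+1},\dots,x_{n(i+1)})$; and $\eta_n\ge\|A-A^{(n)}\|$ with $\eta_n\to0$ as $n\to\infty$. With $(A_n,\eta_n):=\mathcal D(A,n)$, $K_n:=\mathcal A_n(A_n,n)$, $(\alpha_{\max},\beta_{\max},\gamma_{\max}):=\mathcal B_n(A_n)$ (depending on $n$), put $R_n:=\alpha_{\max}+\beta_{\max}+\gamma_{\max}+\eta_n$, $\varepsilon^*_n(A_n):=(\alpha_{\max}+\gamma_{\max})\frac{22}{7(n+1)}$, $$\Gamma^{n,\mathrm{fin}}_\varepsilon(A_n):=\Big\{\lambda\in\mathbb C:\min_{k\in K_n}\min\big(\nu((A_n)^+_{n,k}-\lambda I^+_n),\nu(((A_n)^* )^+_{n,k}-\lambda I^+_n)\big)\le\varepsilon\Big\},$$ and $$\Gamma^n_{\mathrm{fin}}(A):=\Gamma^{n,\mathrm{fin}}_{\varepsilon^*_n(A_n)+3/n+\eta_n}(A_n)\cap\mathrm{Grid}(n,R_n),\qquad\mathrm{Grid}(n,r):=\tfrac1n(\mathbb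 Z+\mathrm i\mathbb Z)\cap r\mathbb D,$$ with $\mathbb D$ the open unit disc and $r\mathbb D=\{rz:z\in\mathbb D\}$. ''Arithmetic operations'' means real arithmetic operations and comparisons. $d_H(S,T):=\max(\sup_{s\in S}\mathrm{dist}(s,T),\sup_{t\in T}\mathrm{dist}(t,S))$ for bounded non-empty $S,T\subset\mathbb C$.
   Formalization: The two d_H convergence claims are proved under the added assumption ε*_n(A_n)→0, without which they fail, since the maps B_p may return bounds growing with p=n (e.g. A=0 with bounds n+1 gives ε*_n=44/7). *)

(* Defs.v *)
From HB Require Import structures.
From mathcomp Require Import all_boot all_order all_algebra finmap complex.
From mathcomp Require Import all_classical all_reals.
From mathcomp Require Import ereal topology normedtype sequences esum.
From mathcomp Require Import ring lra.

Set Implicit Arguments.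
Unset Strict Implicit.
Unset Printing Implicit Defensive.

Import Order.TTheory GRing.Theory Num.Theory numFieldNormedType.Exports.
Import Normc.

Local Open Scope classical_set_scope.
Local Open Scope ring_scope.
Local Open Scope complex_scope.

Section Euclidean.
Context {R : realType}.

Definition sqnorm m (v : 'cV[R[i]]_m) : R := \sum_(r < m) normc (v r 0) ^+ 2.

Definition enorm m (v : 'cV[R[i]]_m) : R := Num.sqrt (sqnorm v).

Lemma normc_ge0 (a : R[i]) : 0 <= normc a.
Proof. by case: a => x y; exact: sqrtr_ge0. Qed.

Lemma sqnorm_ge0 m (v : 'cV[R[i]]_m) : 0 <= sqnorm v.
Proof. by apply: sumr_ge0 => r _; exact: sqr_ge0. Qed.

Lemma sqnorm0 m : sqnorm (0 : 'cV[R[i]]_m) = 0.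
Proof. by apply: big1 => r _; rewrite mxE normc0 expr0n. Qed.

Lemma sqnormZ m (a : R[i]) (v : 'cV[R[i]]_m) :
  sqnorm (a *: v) = normc a ^+ 2 * sqnorm v.
Proof.
by rewrite /sqnorm mulr_sumr; apply: eq_bigr => r _; rewrite mxE normcM exprMn.
Qed.

Lemma sqnormD m (v w : 'cV[R[i]]_m) :
  sqnorm (v + w) <= 2 * sqnorm v + 2 * sqnorm w.
Proof.
rewrite /sqnorm !mulr_sumr -big_split /=; apply: ler_sum => r _.
rewrite mxE; move: (v r 0) (w r 0) => a b.
have le_ab : normc (a + b) ^+ 2 <= (normc a + normc b) ^+ 2.
  by rewrite ler_sqr ?nnegrE ?addr_ge0 ?normc_ge0//; exact: le_normcD.
have := sqr_ge0 (normc a - normc b).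
by move: le_ab; rewrite sqrrB sqrrD; lra.
Qed.

End Euclidean.

Section SquareSummable.
Context {R : realType}.
Local Open Scope ereal_scope.

Definition sqsum p (x : int -> 'cV[R[i]]_p) : \bar R :=
  \esum_(i in [set: int]) (sqnorm (x i))%:E.

Definition sqsummable p : {pred int -> 'cV[R[i]]_p} :=
  fun x => sqsum x < +oo.

Lemma esum_lty_mul (f g : int -> R) (c : R) :
  (forall i, (0 <= f i <= c * g i)%R) -> (forall i, (0 <= g i)%R) -> (0 <= c)%R ->
  \esum_(i in [set: int]) (g i)%:E < +oo ->
  \esum_(i in [set: int]) (f i)%:E < +oo.
Proof.
move=> fg g0 c0 goo.
have [m cm] : exists m : nat, (c <= m%:R)%R.
  by exists (Num.truncn c).+1; rewrite ltW// truncnS_gt.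
have : \esum_(i in [set: int]) (m%:R * g i)%:E < +oo.
  elim: m {cm} => [|m IHm].
    by rewrite esum1 ?ltry// => i _; rewrite mul0r.
  under eq_esum do rewrite -natr1 mulrDl mul1r EFinD.
  rewrite esumD; first exact: lte_add_pinfty.
    by move=> i _; rewrite lee_fin mulr_ge0.
  by move=> i _; rewrite lee_fin.
apply: le_lt_trans; apply: le_esum => i _; rewrite lee_fin.
by have /andP[_ /le_trans] := fg i; apply; rewrite ler_wpM2r.
Qed.

Lemma sqsummable_closed p : GRing.subsemimod_closed (@sqsummable p).
Proof.
split; first split.
- rewrite /sqsummable unfold_in /sqsum esum1 ?ltry// => i _.
  by rewrite sqnorm0.
- move=> x y; rewrite /sqsummable !unfold_in /sqsum => xoo yoo.
  apply: (@esum_lty_mul _ (fun i => sqnorm (x i) + sqnorm (y i))%R 2%R) => //.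
  + move=> i; rewrite sqnorm_ge0 mulrDr; exact: sqnormD.
  + by move=> i; rewrite addr_ge0 ?sqnorm_ge0.
  + under eq_esum do rewrite EFinD.
    rewrite esumD; first exact: lte_add_pinfty.
      by move=> i _; rewrite lee_fin sqnorm_ge0.
    by move=> i _; rewrite lee_fin sqnorm_ge0.
- move=> a x; rewrite /sqsummable !unfold_in /sqsum => xoo.
  apply: (@esum_lty_mul _ (fun i => sqnorm (x i)) (normc a ^+ 2)%R) => //.
  + by move=> i; rewrite sqnorm_ge0 sqnormZ /=.
  + by move=> i; exact: sqnorm_ge0.
  + exact: sqr_ge0.
Qed.

End SquareSummable.

HB.instance Definition _ (R : realType) p :=
  GRing.isSubmodClosed.Build R[i] (int -> 'cV[R[i]]_p) (@sqsummable R p)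
    (@sqsummable_closed R p).

(* l2 R p is the space $\ell^2(\mathbb Z, \mathbb C^p)$. *)
Record l2 (R : realType) (p : nat) := L2 {
  l2val :> int -> 'cV[R[i]]_p;
  l2valP : l2val \in @sqsummable R p
}.
HB.instance Definition _ R p := [isSub for @l2val R p].
HB.instance Definition _ R p := [Choice of l2 R p by <:].
HB.instance Definition _ R p := [SubChoice_isSubLmodule of l2 R p by <:].

Section l2.
Context {R : realType}.

Definition l2norm p (x : l2 R p) : R := Num.sqrt (fine (sqsum x)).

Lemma l2_delta_subproof p (j : int) (v : 'cV[R[i]]_p) :
  (fun i => if i == j then v else 0) \in @sqsummable R p.
Proof.
rewrite unfold_in /sqsummable /sqsum.
have -> : (\esum_(i in [set: int]) (sqnorm (if i == j then v else 0))%:E =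
    \esum_(i in [set j]) (sqnorm v)%:E)%E.
  rewrite esum_mkcond [RHS]esum_mkcond; apply: eq_esum => i _.
  rewrite in_setT; case: eqVneq => [->|ij]; first by rewrite mem_set.
  by rewrite memNset ?sqnorm0//; exact/eqP.
by rewrite esum_set1 ?ltry// lee_fin sqnorm_ge0.
Qed.

Definition l2_delta p (j : int) (v : 'cV[R[i]]_p) : l2 R p :=
  L2 (l2_delta_subproof j v).

End l2.

Notation op R p := {linear l2 R p -> l2 R p}.

Section Norms.
Context {R : realType}.
Local Open Scope ereal_scope.

Definition opnorm p (T : l2 R p -> l2 R p) : \bar R :=
  ereal_sup [set (l2norm (T x))%:E | x in [set x | (l2norm x <= 1)%R]].

Definition bounded_op p (T : op R p) : Prop := opnorm T < +oo.

Definition mxnorm m n (C : 'M[R[i]]_(m, n)) : \bar R :=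
  ereal_sup [set (enorm (C *m x))%:E | x in [set x | (enorm x <= 1)%R]].

(* The lower norm $\nu$; real valued as soon as 0 < n. *)
Definition nu m n (C : 'M[R[i]]_(m, n)) : \bar R :=
  ereal_inf [set (enorm (C *m x))%:E | x in [set x | enorm x = 1%R]].

End Norms.

Section Matrices.
Context {R : realType}.

(* Bi-infinite matrices with p x p blocks *)
Definition bimx (p : nat) : Type := int -> int -> 'M[R[i]]_p.

Definition mx_of p (T : l2 R p -> l2 R p) : bimx p :=
  fun i j => \matrix_(r, c) T (l2_delta j (delta_mx c 0)) i r 0.

(* The matrix of $B^*$ for an operator $B$ with matrix M: it is the transpose,
   without complex conjugation. *)
Definition bitr p (M : bimx p) : bimx p := fun i j => (M j i)^T.

Definition banded p (T : op R p) (w : nat) : Prop :=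
  forall i j : int, (w < `|i - j|)%N -> mx_of T i j = 0.

Definition tridiagonal p (B : op R p) : Prop := bounded_op B /\ banded B 1.

Definition band_dominated p (A : op R p) : Prop :=
  bounded_op A /\
  exists T : nat -> op R p,
    [/\ forall m, bounded_op (T m),
        forall m, exists w, banded (T m) w &
        opnorm (A \- T m) @[m --> \oo] --> 0%E].

(* The bounded operator with matrix M. A bounded operator is determined by its
   matrix, so this is well defined as soon as such an operator exists; the value
   is 0 otherwise. *)
Definition op_of p (M : bimx p) : op R p :=
  match pselect (exists T : op R p, bounded_op T /\ mx_of T = M) with
  | left h => projT1 (cid h)
  | right _ => \0
  end.

(* $B^+_{n,k}$ for an operator $B$ with matrix M *)
Definition subcol p (M : bimx p) (n : nat) (k : int) :=
  \mxblock_(i < n.+2, j < n) M (k + i%:Z) (k + 1 + j%:Z).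

(* $I^+_n$ *)
Definition Iplus p (n : nat) :=
  \mxblock_(i < n.+2, j < n) (if i == j.+1 :> nat then 1%:M else 0 : 'M[R[i]]_p).

End Matrices.

Section Grouping.
Context {R : realType}.

Lemma sqsum_index (f : int -> R) (h : int -> int) : injective h ->
  (forall i, 0 <= f i) ->
  (\esum_(i in [set: int]) (f (h i))%:E <= \esum_(m in [set: int]) (f m)%:E)%E.
Proof.
move=> hi f0.
rewrite -(@esum_image _ _ _ [set: int] h (fun m => (f m)%:E)); last first.
  by move=> x y _ _; exact: hi.
rewrite esum_mkcond; apply: le_esum => i _.
by case: ifP; rewrite lee_fin.
Qed.

Lemma group_inj p (r : 'I_p) : injective (fun i : int => p%:Z * i + r%:Z + 1).
Proof.
move=> x y /addIr/addIr; apply: mulfI.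
by have := leq_ltn_trans (leq0n r) (ltn_ord r); rewrite lt0n.
Qed.

Lemma group_index p (r : 'I_p) (i : int) :
  (((p%:Z * i + r%:Z + 1 - 1) %/ p%:Z)%Z = i) *
  (((p%:Z * i + r%:Z + 1 - 1) %% p%:Z)%Z = r%:Z).
Proof.
have p0 : p%:Z != 0.
  by have := leq_ltn_trans (leq0n r) (ltn_ord r); rewrite lt0n.
have rp : (0 <= r%:Z < `|p%:Z|) by rewrite /= ltz_nat ltn_ord.
rewrite addrK mulrC; split; first by rewrite divzMDl// divz_small// addr0.
by rewrite modzMDl modz_small.
Qed.

Lemma group_subproof p (x : l2 R 1) :
  (fun i : int => \col_(r < p) (x : int -> _) (p%:Z * i + r%:Z + 1) 0 0)
    \in @sqsummable R p.
Proof.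
rewrite unfold_in /sqsummable /sqsum /sqnorm.
under eq_esum do rewrite -sumEFin.
rewrite esum_sum; last by move=> i r _ _; rewrite lee_fin sqr_ge0.
apply: lte_sum_pinfty => r _.
apply: le_lt_trans (l2valP x).
under eq_esum do rewrite mxE.
have := @sqsum_index (fun m => normc (x m 0 0) ^+ 2) _ (@group_inj p r)
  (fun _ => sqr_ge0 _).
move/le_trans; apply; apply: le_esum => m _.
by rewrite lee_fin /sqnorm big_ord_recl big_ord0 addr0 (ord1 ord0).
Qed.

(* $\mathcal I_p : \ell^2(\mathbb Z) \to \ell^2(\mathbb Z, \mathbb C^p)$ *)
Definition group p (x : l2 R 1) : l2 R p := L2 (group_subproof p x).

Definition ungroup_fun p (y : int -> 'cV[R[i]]_p) (m : int) : 'cV[R[i]]_1 :=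
  \col_(_ < 1) if insub `|((m - 1) %% p%:Z)%Z|%N is Some r
               then y ((m - 1) %/ p%:Z)%Z r 0 else 0.

Lemma ungroup_subproof p (y : l2 R p) : ungroup_fun y \in @sqsummable R 1.
Proof.
pose F (r : 'I_p) (m : int) : R :=
  if `|((m - 1) %% p%:Z)%Z|%N == r then normc (y ((m - 1) %/ p%:Z)%Z r 0) ^+ 2
  else 0.
have F0 r m : 0 <= F r m by rewrite /F; case: ifP => // _; exact: sqr_ge0.
have FE m : sqnorm (ungroup_fun y m) = \sum_(r < p) F r m.
  rewrite /sqnorm big_ord_recl big_ord0 addr0 mxE /F.
  case: insubP => [s _ sE|ps].
    rewrite (bigD1 s)//= sE eqxx big1 ?addr0// => r rs.
    by case: eqP => // rE; move: rs; rewrite -val_eqE /= sE rE eqxx.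
  rewrite normc0 expr0n big1// => r _; case: eqP => // rE.
  by move: ps; rewrite rE ltn_ord.
rewrite unfold_in /sqsummable /sqsum.
under eq_esum do rewrite FE -sumEFin.
rewrite esum_sum; last by move=> i r _ _; rewrite lee_fin.
apply: lte_sum_pinfty => r _.
have -> : (\esum_(m in [set: int]) (F r m)%:E =
    \esum_(m in (fun i : int => (p%:Z * i + r%:Z + 1)%R) @` [set: int])
      (F r m)%:E)%E.
  rewrite esum_mkcond [RHS]esum_mkcond; apply: eq_esum => m _.
  rewrite in_setT; case: ifPn => // /negP mr; rewrite /F.
  case: eqP => // rE; exfalso; apply: mr; rewrite inE.
  exists ((m - 1) %/ p%:Z)%Z => //.
  have p0 : p%:Z != 0.
    by have := leq_ltn_trans (leq0n r) (ltn_ord r); rewrite lt0n.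
  by rewrite -rE gez0_abs ?modz_ge0// mulrC -divz_eq subrK.
rewrite esum_image; last by move=> x z _ _; exact: group_inj.
apply: le_lt_trans (l2valP y); apply: le_esum => i _.
rewrite lee_fin /F !group_index eqxx /sqnorm (bigD1 r)//= lerDl.
by apply: sumr_ge0 => s _; exact: sqr_ge0.
Qed.

(* $\mathcal I_p^{-1}$, for 0 < p *)
Definition ungroup p (y : l2 R p) : l2 R 1 := L2 (ungroup_subproof y).

Lemma group_is_linear p : linear (@group p).
Proof.
move=> a x y; apply: val_inj; apply/funext => i.
by apply/matrixP => r c; rewrite !mxE.
Qed.
HB.instance Definition _ p :=
  GRing.isLinear.Build R[i] (l2 R 1) (l2 R p) _ (@group p) (@group_is_linear p).

Lemma ungroup_is_linear p : linear (@ungroup p).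
Proof.
move=> a x y; apply: val_inj; apply/funext => i.
apply/matrixP => r c; rewrite !mxE /= /ungroup_fun.
by case: insub => [s|]; rewrite ?mxE// mulr0 addr0.
Qed.
HB.instance Definition _ p :=
  GRing.isLinear.Build R[i] (l2 R p) (l2 R 1) _ (@ungroup p) (@ungroup_is_linear p).

Lemma groupK p : (0 < p)%N -> cancel (@group p) (@ungroup p).
Proof.
move=> p0 x; apply: val_inj; apply/funext => m; apply/matrixP => r c.
have pn0 : p%:Z != 0 by case: (p) p0.
rewrite !mxE; case: insubP => [s _ sE|].
  by rewrite mxE sE gez0_abs ?modz_ge0// mulrC -divz_eq subrK !ord1.
by rewrite -ltz_nat gez0_abs ?modz_ge0// ltz_pmod.
Qed.

Lemma ungroupK p : (0 < p)%N -> cancel (@ungroup p) (@group p).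
Proof.
move=> p0 y; apply: val_inj; apply/funext => i; apply/matrixP => r c.
rewrite !mxE !group_index /=; case: insubP => [s _ sE|]; last by rewrite ltn_ord.
by rewrite (_ : s = r) ?ord1//; exact: val_inj.
Qed.

End Grouping.

Section Spectrum.
Context {R : realType}.

Definition Spec p (A : op R p) : set R[i] :=
  [set lambda | ~ exists S : op R p, [/\ bounded_op S,
     forall x, S (A x - lambda *: x) = x &
     forall x, A (S x) - lambda *: S x = x]].

Local Open Scope ereal_scope.

Definition dist (z : R[i]) (T : set R[i]) : \bar R :=
  ereal_inf [set (normc (z - t)%R)%:E | t in T].

(* The extended real value makes $d_H$ infinite if exactly one set is empty. *)
Definition hausdorff (S T : set R[i]) : \bar R :=
  maxe (ereal_sup [set dist s T | s in S]) (ereal_sup [set dist t S | t in T]).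

End Spectrum.

Section Fejer.
Context {R : realType}.

(* The matrix of $A^{(n)}$ *)
Definition fejer_mx (n : nat) (M : @bimx R 1) : @bimx R 1 := fun i j =>
  if (`|i - j| <= n)%N then (1 - `|i - j|%N%:R / n.+1%:R) *: M i j else 0.

Definition fejer (A : op R 1) (n : nat) : op R 1 := op_of (fejer_mx n (mx_of A)).

(* $A_n = \mathcal I_n A^{(n)} \mathcal I_n^{-1}$ *)
Definition D1 (A : op R 1) (n : nat) : op R n :=
  (@group R n) \o (fejer A n) \o (@ungroup R n).

End Fejer.

Section Inputs.
Context {R : realType}.
Local Open Scope ereal_scope.

Definition input_A (mA : forall p, op R p -> nat -> {fset int}) : Prop :=
  forall (p : nat) (B : op R p) (n : nat),
    (0 < p)%N -> tridiagonal B -> (0 < n)%N ->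
  forall k : int, exists2 j, j \in mA p B n &
    mxnorm (subcol (mx_of B) n k - subcol (mx_of B) n j)%R <= (n%:R^-1)%:E /\
    mxnorm (subcol (bitr (mx_of B)) n k - subcol (bitr (mx_of B)) n j)%R
      <= (n%:R^-1)%:E.

(* The triple is $(\alpha_{\max}, \beta_{\max}, \gamma_{\max})$. *)
Definition input_B (mB : forall p, op R p -> R * R * R) : Prop :=
  forall (p : nat) (B : op R p), (0 < p)%N -> tridiagonal B ->
  [/\ ereal_sup (range (fun j : int => mxnorm (mx_of B (j + 1)%R j)))
        <= (mB p B).1.1%:E,
      ereal_sup (range (fun j : int => mxnorm (mx_of B j j)))
        <= (mB p B).1.2%:E &
      ereal_sup (range (fun j : int => mxnorm (mx_of B (j - 1)%R j)))
        <= (mB p B).2%:E].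

Definition input_D2 (eta : op R 1 -> nat -> R) : Prop :=
  forall A : op R 1, band_dominated A ->
    (forall n, (0 < n)%N -> opnorm (A \- fejer A n)%R <= (eta A n)%:E) /\
    eta A n @[n --> \oo] --> 0%R.

End Inputs.

Section Gamma.
Context {R : realType}.

Definition Gamma_eps p (B : op R p) (n : nat) (K : {fset int}) (eps : R) :
    set R[i] :=
  [set lambda |
    (\big[mine/+oo]_(k <- K)
       mine (nu (subcol (mx_of B) n k - lambda *: Iplus p n))
            (nu (subcol (bitr (mx_of B)) n k - lambda *: Iplus p n))
     <= eps%:E)%E].

Definition Grid (n : nat) (r : R) : set R[i] :=
  [set z | exists a b : int, z = (a%:~R / n%:R) +i* (b%:~R / n%:R)]
  `&` [set r%:C * z | z in [set z | normc z < 1]].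

Definition eps_star (n : nat) (abc : R * R * R) : R :=
  (abc.1.1 + abc.2) * (22 / (7 * n.+1%:R)).

(* $\Gamma^n_{\mathrm{fin}}(A)$ in terms of $A_n$, $K_n$,
   $(\alpha_{\max}, \beta_{\max}, \gamma_{\max})$ and $\eta_n$ *)
Definition Gamma_fin (n : nat) (An : op R n) (K : {fset int}) (abc : R * R * R)
    (eta : R) : set R[i] :=
  Gamma_eps An n K (eps_star n abc + 3 / n%:R + eta)
  `&` Grid n (abc.1.1 + abc.1.2 + abc.2 + eta).

(* $S + \delta \overline{\mathbb D}$ *)
Definition fatten (S : set R[i]) (delta : R) : set R[i] :=
  [set s + delta%:C * z | s in S & z in [set z | normc z <= 1]].

End Gamma.

(* Arithmetic programs over real data indexed by V: a program compares the values
   of arithmetic expressions (with division by 0 returning 0) and branches, until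
   it returns a finite list of complex numbers, given by expressions for the real
   and imaginary parts. A program may be an infinite tree, but [runs] is inductive,
   so that [runs rho c s] means that c returns s on data rho after finitely many
   arithmetic operations and comparisons. *)
Inductive expr (V : Type) : Type :=
| Datum of V
| Const of rat
| Add of expr V & expr V
| Sub of expr V & expr V
| Mul of expr V & expr V
| Div of expr V & expr V.

CoInductive prog (V : Type) : Type :=
| Return of seq (expr V * expr V)
| IfLe of expr V & expr V & prog V & prog V.

Section Semantics.
Context {R : realType} {V : Type} (rho : V -> R).

Fixpoint eval (e : expr V) : R :=
  match e with
  | Datum v => rho v
  | Const q => ratr q
  | Add e1 e2 => eval e1 + eval e2
  | Sub e1 e2 => eval e1 - eval e2
  | Mul e1 e2 => eval e1 * eval e2
  | Div e1 e2 => eval e1 / eval e2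
  end.

Inductive runs : prog V -> seq R[i] -> Prop :=
| runs_Return s : runs (Return s) [seq eval e.1 +i* eval e.2 | e <- s]
| runs_IfLe e1 e2 c1 c2 s :
    runs (if eval e1 <= eval e2 then c1 else c2) s -> runs (IfLe e1 e2 c1 c2) s.

End Semantics.

(* The real data from which $\Gamma^n_{\mathrm{fin}}(A)$ is computed, besides the
   discrete data n and $K_n$: [Dentry adj k i j im] is the real part, or the
   imaginary part if im, of the entry (i, j) of $B^+_{n,k}$, where $B$ is
   $A_n$, or the transpose of $A_n$ if adj. *)
Inductive datum (n : nat) (K : {fset int}) : Type :=
| Deta
| Dalpha
| Dbeta
| Dgamma
| Dentry (adj : bool) (k : K) (i : 'I_(\sum_(r < n.+2) n))
    (j : 'I_(\sum_(r < n) n)) (im : bool).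

Definition datum_val (R : realType) (n : nat) (An : op R n) (K : {fset int})
    (abc : R * R * R) (eta : R) (d : datum n K) : R :=
  match d with
  | Deta => eta
  | Dalpha => abc.1.1
  | Dbeta => abc.1.2
  | Dgamma => abc.2
  | Dentry adj k i j im =>
      let M := if adj then bitr (mx_of An) else mx_of An in
      let z := subcol M n (val k) i j in
      if im then complex.Im z else complex.Re z
  end.

(* Main.v *)
Require Import Defs.
From HB Require Import structures.
From mathcomp Require Import all_boot all_order all_algebra finmap complex.
From mathcomp Require Import all_classical all_reals.
From mathcomp Require Import ereal topology normedtype sequences esum.
From mathcomp Require Import ring lra zify.

(* Inclusion. If lambda is in Spec A, then A - lambda or its transpose is not
   bounded below, so for B = A_n or its transpose there is y <> 0 with
   |(B - lambda) y| <= (eta_n + delta) |y|. Cut y by weights w_0, ..., w_(n+1)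
   (with w_0 = w_(n+1) = 0) moved to position k: commuting B with the weights costs
   the differences of neighbouring weights, so, summing the squares over all k, some
   window loses at most (alpha + gamma) |w'| / |w|, where |w'| / |w| is the ratio of
   the l2 norms of the differences and of the weights. The optimal weights
   sin (pi j / (n + 1)) give 2 sin (pi / (2 (n + 1))); the quartic weights used here
   give at most (22 / 7) / (n + 1). The surplus in 3 / n pays for passing from k to
   K_n and from lambda to a grid point. No property of the Fejer means enters except
   that A^(n) has band-width n, since eta_n bounds |A - A^(n)|.

   Convergence. A point z of Gamma^n_fin yields an approximate eigenvector of A or of
   its transpose, with an error that tends to 0, and on the set of z at distance at
   least e from Spec A both operators A - z and (A - z)^T are uniformly bounded below,
   by compactness. The Hausdorff distance also needs Spec A to be nonempty.

   Computation. nu(D) <= eps holds iff D^* D - eps^2 is not positive definite, which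
   is decided by Schur complements. *)

Set Implicit Arguments.
Unset Strict Implicit.
Unset Printing Implicit Defensive.

Import Order.TTheory GRing.Theory Num.Theory numFieldNormedType.Exports.
Import Normc.

Local Open Scope classical_set_scope.
Local Open Scope ring_scope.
Local Open Scope complex_scope.

(** * Absolutely convergent sums over the integers *)

(** The data of the algorithm involve transposes, whereas Hilbert space arguments produce adjoints.
    They are linked by [conjop]: an adjoint conjugated on both sides has the transposed matrix, and
    its residuals at [lambda] are those of the adjoint at [conjc lambda]. Invertibility of
    [A - lambda] is handled through [below], a common lower bound for [A - lambda] and its adjoint.
    This condition is quantitative and stable under small changes of [lambda] and of the operator,
    which is what both compactness and the comparison of [A] with [A_n] require.

    Infima over unit vectors need not be attained in l2, so small parameters [d] and [e] replace
    minimizers; part of the surplus [3 / n] is spent on them.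

    Two details of the grid shape the rest. The spectrum is only known to lie in the closed disc of
    radius [R_n], while [Grid] uses the open disc, so rounding has to go strictly towards 0. And the
    number of candidate points depends on the real number [n R_n], which no expression in [n] and
    [K] bounds; hence the program is an infinite tree of which every run visits a finite part. *)

Section SignedSums.
Context {R : realType}.
Implicit Types f g h : int -> R.

Definition esumz f : \bar R := (\esum_(i in [set: int]) (f i)%:E)%E.

Definition abs_summable f : Prop := (esumz (fun i => `|f i|%R) < +oo)%E.

(* Meaningful for [abs_summable f] only. *)
Definition asum f : R :=
  fine (esumz (fun i => Num.max (f i) 0)) -
  fine (esumz (fun i => Num.max (- f i) 0)).

Lemma esumz_ge0 f : (forall i, 0 <= f i) -> (0 <= esumz f)%E.
Proof. by move=> f0; apply: esum_ge0 => i _; rewrite lee_fin. Qed.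

Lemma le_esumz f g : (forall i, f i <= g i) -> (esumz f <= esumz g)%E.
Proof. by move=> fg; apply: le_esum => i _; rewrite lee_fin. Qed.

Lemma esumzD f g : (forall i, 0 <= f i) -> (forall i, 0 <= g i) ->
  esumz (fun i => f i + g i) = (esumz f + esumz g)%E.
Proof.
move=> f0 g0; rewrite /esumz -esumD.
- by [].
- by move=> i _; rewrite lee_fin.
- by move=> i _; rewrite lee_fin.
Qed.

Lemma le_sm f g : (forall i, `|f i| <= `|g i|) -> abs_summable g -> abs_summable f.
Proof. by move=> fg; apply: le_lt_trans; exact: le_esumz. Qed.

Lemma smD f g : abs_summable f -> abs_summable g -> abs_summable (fun i => f i + g i).
Proof.
move=> sf sg; have : (esumz (fun i => `|f i| + `|g i|)%R < +oo)%E.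
  by rewrite esumzD//; exact: lte_add_pinfty.
by apply: le_lt_trans; apply: le_esumz => i; exact: ler_normD.
Qed.

Lemma smN f : abs_summable f -> abs_summable (fun i => - f i).
Proof. by apply: le_sm => i; rewrite normrN. Qed.

Lemma smZ c f : abs_summable f -> abs_summable (fun i => c * f i).
Proof.
move=> sf; apply: (@esum_lty_mul _ (fun i => `|c * f i|) (fun i => `|f i|) `|c|) => //.
by move=> i; rewrite normr_ge0 normrM lexx.
Qed.

Lemma sm0 : abs_summable (fun=> 0).
Proof. by rewrite /abs_summable /esumz esum1 ?ltry// => i _; rewrite normr0. Qed.

Lemma sm_sum (I : Type) (r : seq I) (F : I -> int -> R) :
  (forall k, abs_summable (F k)) -> abs_summable (fun i => \sum_(k <- r) F k i).
Proof.
move=> sF; elim: r => [|a r IH].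
  by have := sm0; congr abs_summable; apply/funext => i; rewrite big_nil.
have := smD (sF a) IH; congr abs_summable; apply/funext => i; by rewrite big_cons.
Qed.

Lemma esumz_fin f : (forall i, 0 <= f i) -> abs_summable f -> esumz f \is a fin_num.
Proof.
move=> f0 sf; rewrite ge0_fin_numE; last exact: esumz_ge0.
by move: sf; rewrite /abs_summable; under [X in esumz X]eq_fun do rewrite ger0_norm//.
Qed.

(** Pointwise [max (f, 0) + h = max (- f, 0) + g], so every splitting of [f] into nonnegative
    summable parts gives the same value. Additivity of [asum] thus reduces to that of [esumz]. *)
Lemma asum_sub f g h : abs_summable g -> abs_summable h -> (forall i, 0 <= g i) ->
  (forall i, 0 <= h i) -> (forall i, f i = g i - h i) ->
  asum f = fine (esumz g) - fine (esumz h).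
Proof.
move=> sg sh g0 h0 fE.
have p0 (k : R) : 0 <= Num.max k 0 by rewrite le_max lexx orbT.
have sp : abs_summable (fun i => Num.max (f i) 0).
  apply: le_sm sg => i; rewrite !ger0_norm// ge_max g0 andbT fE.
  by have := h0 i; lra.
have sn : abs_summable (fun i => Num.max (- f i) 0).
  apply: le_sm sh => i; rewrite !ger0_norm// ge_max h0 andbT fE.
  by have := g0 i; lra.
rewrite /asum; apply/eqP; rewrite subr_eq addrAC eq_sym subr_eq eq_sym; apply/eqP.
rewrite -!fineD ?esumz_fin// -!esumzD//; congr (fine (esumz _)).
apply/funext => i; rewrite fE.
by have := h0 i; case: (lerP (g i - h i) 0) => ?; case: (lerP (-(g i - h i)) 0) => ?; lra.
Qed.

Lemma asum_ge0E f : abs_summable f -> (forall i, 0 <= f i) -> asum f = fine (esumz f).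
Proof.
move=> sf f0; have e0 : esumz (fun=> 0 : R) = 0%E by apply: esum1.
rewrite (@asum_sub f f (fun=> 0)) ?e0 ?subr0//; first exact: sm0.
by move=> i; rewrite subr0.
Qed.

Lemma asumEfin f : abs_summable f -> (forall i, 0 <= f i) -> esumz f = (asum f)%:E.
Proof. by move=> sf f0; rewrite asum_ge0E// fineK// esumz_fin. Qed.

Lemma sm_norm f : abs_summable f -> abs_summable (fun i => `|f i|).
Proof. by apply: le_sm => i; rewrite normr_id. Qed.

Lemma asumD f g : abs_summable f -> abs_summable g -> asum (fun i => f i + g i) = asum f + asum g.
Proof.
move=> sf sg.
have fa h i : 0 <= `|h i| - h i by rewrite subr_ge0 ler_norm.
have sa h : abs_summable h -> abs_summable (fun i => `|h i| - h i).
  by move=> sh; apply: smD; [exact: sm_norm|exact: smN].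
rewrite (@asum_sub f _ _ (sm_norm sf) (sa _ sf))//; last first.
  by move=> i; rewrite opprB addrCA subrr addr0.
rewrite (@asum_sub g _ _ (sm_norm sg) (sa _ sg))//; last first.
  by move=> i; rewrite opprB addrCA subrr addr0.
rewrite (@asum_sub _ _ _ (smD (sm_norm sf) (sm_norm sg)) (smD (sa _ sf) (sa _ sg)));
  try by move=> i; first [apply: addr_ge0|lra].
rewrite (@esumzD (fun i => `|f i|) (fun i => `|g i|))//.
rewrite (@esumzD (fun i => `|f i| - f i) (fun i => `|g i| - g i))//.
have nf h : abs_summable h -> esumz (fun i => `|h i|) \is a fin_num.
  by move=> sh; apply: esumz_fin => //; exact: sm_norm.
have mf h : abs_summable h -> esumz (fun i => `|h i| - h i) \is a fin_num.
  by move=> sh; apply: esumz_fin => //; exact: sa.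
rewrite fineD ?nf// fineD ?mf// opprD addrACA; congr (_ + _).
Qed.

Lemma asumN f : asum (fun i => - f i) = - asum f.
Proof.
rewrite /asum opprB; congr (_ - fine (esumz _)).
by apply/funext => i; rewrite opprK.
Qed.

Lemma asumB f g : abs_summable f -> abs_summable g -> asum (fun i => f i - g i) = asum f - asum g.
Proof. by move=> sf sg; rewrite asumD ?asumN//; exact: smN. Qed.

Lemma asum_ge0 f : (forall i, 0 <= f i) -> 0 <= asum f.
Proof.
move=> f0; rewrite /asum (_ : (fun i => Num.max (- f i) 0) = fun=> 0).
  rewrite /esumz [X in _ - fine X]esum1//= subr0.
  by apply: fine_ge0; apply: esumz_ge0 => i; rewrite le_max lexx orbT.
by apply/funext => i; rewrite max_r// oppr_le0.
Qed.

Lemma le_asum f g : abs_summable f -> abs_summable g -> (forall i, f i <= g i) -> asum f <= asum g.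
Proof.
move=> sf sg fg; rewrite -subr_ge0 -asumB//; apply: asum_ge0 => i.
by rewrite subr_ge0.
Qed.

Lemma asum0 : asum (fun=> 0) = 0.
Proof.
have := asumN (fun=> 0); rewrite oppr0 => /eqP.
by rewrite -addr_eq0 -mulr2n mulrn_eq0 => /eqP.
Qed.

Lemma asum_sum (I : Type) (r : seq I) (F : I -> int -> R) :
  (forall k, abs_summable (F k)) ->
  asum (fun i => \sum_(k <- r) F k i) = \sum_(k <- r) asum (F k).
Proof.
move=> sF; elim: r => [|a r IH].
  rewrite big_nil -[RHS]asum0; congr asum; apply/funext => i; by rewrite big_nil.
rewrite big_cons -IH -asumD//; last exact: sm_sum.
by congr asum; apply/funext => i; rewrite big_cons.
Qed.

Lemma le_sum_asum f (r : seq int) : abs_summable f -> (forall i, 0 <= f i) -> uniq r ->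
  \sum_(i <- r) f i <= asum f.
Proof.
move=> sf f0 ur; rewrite -lee_fin -asumEfin//.
apply: esum_ge; exists [set` r]; first by split => //; exact: finite_seq.
by rewrite -sumEFin fsbig_seq.
Qed.

(** Limits in l2 and adjoints are shown to be square-summable in this way, from bounds on finite
    sums. *)
Lemma asum_ub f (M : R) : (forall i, 0 <= f i) ->
  (forall r : seq int, uniq r -> \sum_(i <- r) f i <= M) -> abs_summable f /\ asum f <= M.
Proof.
move=> f0 fM.
have le : (esumz f <= M%:E)%E.
  apply: ge_ereal_sup => _ [X [finX _] <-].
  rewrite fsbig_finite//= sumEFin lee_fin; apply: fM; exact: fset_uniq.
have sf : abs_summable f.
  rewrite /abs_summable; under [X in esumz X]eq_fun do rewrite ger0_norm//.
  exact: le_lt_trans le (ltry _).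
by split => //; rewrite -lee_fin -asumEfin.
Qed.

Lemma le_asum1 f i : abs_summable f -> (forall j, 0 <= f j) -> f i <= asum f.
Proof. by move=> sf f0; have := @le_sum_asum f [:: i] sf f0 isT; rewrite big_seq1. Qed.

Lemma asumZ c f : abs_summable f -> asum (fun i => c * f i) = c * asum f.
Proof.
move=> sf.
suff H k g : 0 <= k -> abs_summable g -> (forall i, 0 <= g i) -> asum (fun i => k * g i) = k * asum g.
  have P k : 0 <= k -> asum (fun i => k * f i) = k * asum f.
    move=> k0.
    have sp : abs_summable (fun i => (`|f i| + f i)) by apply: smD => //; exact: sm_norm.
    have p0 i : 0 <= `|f i| + f i by have := ler_norm (- f i); rewrite normrN; lra.
    have fE : f = fun i => (`|f i| + f i) - `|f i| by apply/funext => i; lra.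
    have -> : (fun i => k * f i) = (fun i => k * (`|f i| + f i) - k * `|f i|).
      by apply/funext => i; lra.
    rewrite asumB; try exact: smZ; last by apply: smZ; exact: sm_norm.
    rewrite !H//; last exact: sm_norm.
    by rewrite asumD ?addrK -?mulrBr ?addrK//; [rewrite addrC addKr|exact: sm_norm].
  have [c0|c0] := lerP 0 c; first exact: P.
  have -> : (fun i => c * f i) = (fun i => - (- c * f i)).
    by apply/funext => i; rewrite mulNr opprK.
  by rewrite asumN P ?mulNr ?opprK// oppr_ge0 ltW.
move=> k0 sg g0.
have Q (d : R) : 0 < d -> d * asum g <= asum (fun i => d * g i).
  move=> d0; rewrite mulrC -ler_pdivlMr//; apply: (asum_ub g0 _).2 => r ur.
  rewrite ler_pdivlMr// mulrC mulr_sumr.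
  by apply: le_sum_asum ur; [exact: smZ|move=> i; rewrite mulr_ge0// ltW].
move: k0; rewrite le_eqVlt => /predU1P[<-|k0].
  rewrite mul0r -[RHS]asum0; congr asum; apply/funext => i; by rewrite mul0r.
apply/eqP; rewrite eq_le Q// andbT.
apply: (asum_ub _ _).2 => [i|r ur]; first by rewrite mulr_ge0// ltW.
by rewrite -mulr_sumr ler_pM2l//; exact: le_sum_asum.
Qed.

Lemma sm_shift f k : abs_summable f -> abs_summable (fun i => f (i + k)).
Proof.
apply: le_lt_trans; apply: (@sqsum_index R (fun i => `|f i|) (fun i => i + k)) => //.
exact: addIr.
Qed.

(** [sqsum_index] gives an inequality for an injection; applied to the shift and to its inverse it
    gives equality. *)
Lemma asum_shift f k : abs_summable f -> asum (fun i => f (i + k)) = asum f.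
Proof.
have H g (m : int) : (forall i, 0 <= g i) -> esumz (fun i => g (i + m)) = esumz g.
  move=> g0; apply/eqP; rewrite eq_le; apply/andP; split.
    by apply: (@sqsum_index R g (fun i => i + m)) => //; exact: addIr.
  rewrite [X in (esumz X <= _)%E](_ : g = fun i => (fun j => g (j + m)) (i - m)).
    by apply: (@sqsum_index R (fun i => g (i + m)) (fun i => i - m)) => //; exact: addIr.
  by apply/funext => i; rewrite subrK.
move=> sf; rewrite /asum.
by rewrite (H (fun i => Num.max (f i) 0))// ?(H (fun i => Num.max (- f i) 0))//;
  move=> i; rewrite le_max lexx orbT.
Qed.

Lemma sm_fin f (r : seq int) : (forall i, i \notin r -> f i = 0) -> abs_summable f.
Proof.
move=> f0; apply: le_lt_trans (ltry (\sum_(i <- undup r) `|f i|)).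
apply: ge_ereal_sup => _ [X [finX _] <-].
rewrite fsbig_finite//= sumEFin lee_fin.
rewrite (bigID (mem r))/= [X in _ + X]big1 ?addr0; last first.
  by move=> i /f0 ->; rewrite normr0.
rewrite -big_filter.
rewrite [leRHS](bigID (mem (fset_set X)))/= -[X in _ <= X + _]big_filter.
rewrite (perm_big [seq i <- undup r | i \in fset_set X])/=.
  by rewrite lerDl sumr_ge0.
apply: uniq_perm; rewrite ?filter_uniq ?undup_uniq ?fset_uniq// => i.
by rewrite !mem_filter mem_undup andbC.
Qed.

Lemma asum_fin f (r : seq int) : uniq r -> (forall i, i \notin r -> f i = 0) ->
  asum f = \sum_(i <- r) f i.
Proof.
move=> ur f0.
have H g : (forall i, 0 <= g i) -> (forall i, i \notin r -> g i = 0) -> asum g = \sum_(i <- r) g i.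
  move=> g0 gr; apply/eqP; rewrite eq_le le_sum_asum//; last exact: sm_fin gr.
  rewrite andbT; apply: (asum_ub g0 _).2 => s us.
  rewrite (bigID (mem r))/= [X in _ + X]big1 ?addr0//.
  rewrite -big_filter [leRHS](bigID (mem s))/= -[X in _ <= X + _]big_filter.
  rewrite (perm_big [seq i <- r | i \in s])/=.
    by rewrite lerDl sumr_ge0.
  apply: uniq_perm; rewrite ?filter_uniq// => i.
  by rewrite !mem_filter andbC.
have fE : f = fun i => (`|f i| + f i) - `|f i| by apply/funext => i; lra.
rewrite fE asumB.
- rewrite H//; last by move=> i /f0 ->; rewrite normr0 addr0.
    rewrite H//; last by move=> i /f0 ->; rewrite normr0.
    by rewrite -sumrB.
  by move=> i; have := ler_norm (- f i); rewrite normrN; lra.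
- by apply: (@sm_fin _ r) => i /f0 ->; rewrite normr0 addr0.
- by apply: (@sm_fin _ r) => i /f0 ->; rewrite normr0.
Qed.

End SignedSums.

(** * The inner product of l2 *)

Section InnerProduct.
Context {R : realType}.
Local Notation C := R[i].
Local Notation Re := (@complex.Re R).
Local Notation Im := (@complex.Im R).

Lemma normc_sqr (a : C) : normc a ^+ 2 = Re a ^+ 2 + Im a ^+ 2.
Proof. by case: a => x y /=; rewrite sqr_sqrtr// addr_ge0 ?sqr_ge0. Qed.

Lemma cReD (a b : C) : Re (a + b) = Re a + Re b. Proof. by case: a; case: b. Qed.
Lemma cImD (a b : C) : Im (a + b) = Im a + Im b. Proof. by case: a; case: b. Qed.
Lemma cReM (a b : C) : Re (a * b) = Re a * Re b - Im a * Im b.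
Proof. by case: a; case: b. Qed.
Lemma cImM (a b : C) : Im (a * b) = Re a * Im b + Im a * Re b.
Proof. by case: a; case: b. Qed.

Lemma complex_eq (a b : C) : Re a = Re b -> Im a = Im b -> a = b.
Proof. by case: a => ? ?; case: b => ? ? /= -> ->. Qed.

Lemma normc_real (c : R) : normc c%:C = `|c|.
Proof. by rewrite /= expr0n addr0 sqrtr_sqr. Qed.

Lemma normc_conjc (a : C) : normc (conjc a) = normc a.
Proof. by case: a => x y /=; rewrite sqrrN. Qed.

Definition pdot m (v w : 'cV[C]_m) : R :=
  \sum_(r < m) (Re (v r 0) * Re (w r 0) + Im (v r 0) * Im (w r 0)).

Lemma sqnormE m (v : 'cV[C]_m) : sqnorm v = pdot v v.
Proof. by apply: eq_bigr => r _; rewrite normc_sqr !expr2. Qed.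

Lemma pdotC m (v w : 'cV[C]_m) : pdot v w = pdot w v.
Proof. by apply: eq_bigr => r _; rewrite mulrC [X in _ + X]mulrC. Qed.

Lemma pdotDl m (v v' w : 'cV[C]_m) : pdot (v + v') w = pdot v w + pdot v' w.
Proof. by rewrite -big_split; apply: eq_bigr => r _ /=; rewrite mxE cReD cImD; ring. Qed.

Lemma pdotZl m (a : C) (v w : 'cV[C]_m) : pdot (a *: v) w = pdot v ((conjc a) *: w).
Proof.
apply: eq_bigr => r _; rewrite !mxE !cReM !cImM; case: a => x y /=; ring.
Qed.

Lemma pdotRl m (c : R) (v w : 'cV[C]_m) : pdot (c%:C *: v) w = c * pdot v w.
Proof.
by rewrite mulr_sumr; apply: eq_bigr => r _; rewrite !mxE !cReM !cImM /=; ring.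
Qed.

Lemma pdot0l m (w : 'cV[C]_m) : pdot 0 w = 0.
Proof. by apply: big1 => r _; rewrite mxE/=; ring. Qed.

Lemma pdot_le m (v w : 'cV[C]_m) : `|pdot v w| <= sqnorm v + sqnorm w.
Proof.
rewrite !sqnormE -big_split/=; apply: le_trans (ler_norm_sum _ _ _) _.
apply: ler_sum => r _; move: (Re _) (Im _) (Re _) (Im _) => a b c d.
have := sqr_ge0 (a + c); have := sqr_ge0 (a - c).
have := sqr_ge0 (b + d); have := sqr_ge0 (b - d).
by rewrite !sqrrB !sqrrD !expr2 ler_norml => *; apply/andP; split; lra.
Qed.

Section l2Theory.
Variable p : nat.
Implicit Types x y z : l2 R p.

Lemma l2_ext x y : (forall i, x i = y i) -> x = y.
Proof. by move=> xy; apply: val_inj; apply/funext. Qed.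

Lemma l2DE x y i : (x + y) i = x i + y i. Proof. by []. Qed.
Lemma l2BE x y i : (x - y) i = x i - y i. Proof. by []. Qed.
Lemma l2ZE a x i : (a *: x) i = a *: x i. Proof. by []. Qed.
Lemma l20E i : (0 : l2 R p) i = 0. Proof. by []. Qed.

Lemma sm_sqnorm x : abs_summable (fun i => sqnorm (x i)).
Proof.
rewrite /abs_summable; under [X in esumz X]eq_fun do rewrite ger0_norm ?sqnorm_ge0//.
exact: (l2valP x).
Qed.

Lemma sm_l2 (f : int -> 'cV[C]_p) : abs_summable (fun i => sqnorm (f i)) ->
  f \in @sqsummable R p.
Proof.
rewrite /abs_summable; under [X in esumz X]eq_fun do rewrite ger0_norm ?sqnorm_ge0//.
by [].
Qed.

Lemma sm_pdot x y : abs_summable (fun i => pdot (x i) (y i)).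
Proof.
apply: le_sm (smD (sm_sqnorm x) (sm_sqnorm y)) => i.
by rewrite (le_trans (pdot_le _ _))// ler_norm.
Qed.

(* The real part of the Hermitian inner product. For complex linear operators,
   adjoints with respect to either form are the same. *)
Definition dot x y := asum (fun i => pdot (x i) (y i)).

Lemma dotC x y : dot x y = dot y x.
Proof. by congr asum; apply/funext => i; rewrite pdotC. Qed.

Lemma dotDl x x' y : dot (x + x') y = dot x y + dot x' y.
Proof.
rewrite -asumD; try exact: sm_pdot.
by congr asum; apply/funext => i; rewrite pdotDl.
Qed.

Lemma dotDr x y y' : dot x (y + y') = dot x y + dot x y'.
Proof. by rewrite dotC dotDl !(dotC x). Qed.

Lemma dotZl (a : C) x y : dot (a *: x) y = dot x ((conjc a) *: y).
Proof. by congr asum; apply/funext => i; rewrite pdotZl. Qed.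

Lemma dotRl (c : R) x y : dot (c%:C *: x) y = c * dot x y.
Proof.
rewrite -asumZ; last exact: sm_pdot.
by congr asum; apply/funext => i; rewrite pdotRl.
Qed.

Lemma dotRr (c : R) x y : dot x (c%:C *: y) = c * dot x y.
Proof. by rewrite dotC dotRl dotC. Qed.

Lemma dot0l y : dot 0 y = 0.
Proof. by rewrite -[RHS]asum0; congr asum; apply/funext => i; rewrite pdot0l. Qed.

Lemma dot0r y : dot y 0 = 0. Proof. by rewrite dotC dot0l. Qed.

Lemma dotNl x y : dot (- x) y = - dot x y.
Proof. by apply/eqP; rewrite -addr_eq0 -dotDl addNr dot0l. Qed.

Lemma dotNr x y : dot x (- y) = - dot x y.
Proof. by rewrite dotC dotNl dotC. Qed.

Lemma dotBl x x' y : dot (x - x') y = dot x y - dot x' y.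
Proof. by rewrite dotDl dotNl. Qed.

Lemma dotBr x y y' : dot x (y - y') = dot x y - dot x y'.
Proof. by rewrite dotDr dotNr. Qed.

Lemma dotxx_ge0 x : 0 <= dot x x.
Proof. by apply: asum_ge0 => i; rewrite -sqnormE sqnorm_ge0. Qed.

Lemma dotxxE x : dot x x = asum (fun i => sqnorm (x i)).
Proof. by congr asum; apply/funext => i; rewrite sqnormE. Qed.

Lemma l2normE x : l2norm x = Num.sqrt (dot x x).
Proof.
rewrite dotxxE asum_ge0E//; first exact: sm_sqnorm.
by move=> i; exact: sqnorm_ge0.
Qed.

Lemma l2norm_ge0 x : 0 <= l2norm x. Proof. exact: sqrtr_ge0. Qed.

Lemma l2norm_sqr x : l2norm x ^+ 2 = dot x x.
Proof. by rewrite l2normE sqr_sqrtr// dotxx_ge0. Qed.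

Lemma sqnorm_le_dot x i : sqnorm (x i) <= dot x x.
Proof.
rewrite dotxxE; apply: (@le_asum1 _ (fun i => sqnorm (x i))); first exact: sm_sqnorm.
by move=> j; exact: sqnorm_ge0.
Qed.

Lemma enorm_ge0 m (v : 'cV[C]_m) : 0 <= enorm v. Proof. exact: sqrtr_ge0. Qed.

Lemma enorm_sqr m (v : 'cV[C]_m) : enorm v ^+ 2 = sqnorm v.
Proof. by rewrite sqr_sqrtr// sqnorm_ge0. Qed.

Lemma enorm_le_l2norm x i : enorm (x i) <= l2norm x.
Proof. by rewrite l2normE ler_wsqrtr// sqnorm_le_dot. Qed.

Lemma sqnorm_eq0 m (v : 'cV[C]_m) : sqnorm v = 0 -> v = 0.
Proof.
move=> v0; apply/matrixP => r c; rewrite ord1 mxE; apply: eq0_normc.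
apply/eqP; rewrite -sqrf_eq0; apply/eqP; move: r {c} isT.
apply: (psumr_eq0P _ v0) => r _; exact: sqr_ge0.
Qed.

Lemma l2norm_eq0 x : l2norm x = 0 -> x = 0.
Proof.
move=> x0; apply: l2_ext => i; apply: sqnorm_eq0; apply/eqP.
by rewrite eq_le sqnorm_ge0 andbT (le_trans (sqnorm_le_dot x i))// -l2norm_sqr x0 expr0n.
Qed.

Lemma l2norm0 : l2norm (0 : l2 R p) = 0.
Proof. by rewrite l2normE dot0l sqrtr0. Qed.

Lemma l2norm_gt0 x : (0 < l2norm x) = (x != 0).
Proof.
rewrite lt_def l2norm_ge0 andbT; congr (~~ _).
by apply/eqP/eqP => [/l2norm_eq0//|->]; exact: l2norm0.
Qed.

Lemma l2normZ (a : C) x : l2norm (a *: x) = normc a * l2norm x.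
Proof.
rewrite !l2normE dotZl scalerA.
have -> : (conjc a) * a = (normc a ^+ 2)%:C.
  by rewrite normc_sqr; apply: complex_eq; case: a => u v /=; ring.
by rewrite dotRr sqrtrM ?sqr_ge0// sqrtr_sqr ger0_norm// normc_ge0.
Qed.

Lemma l2normN x : l2norm (- x) = l2norm x.
Proof. by rewrite !l2normE dotNl dotNr opprK. Qed.

Lemma l2normBC x y : l2norm (x - y) = l2norm (y - x).
Proof. by rewrite -l2normN opprB. Qed.

Lemma l2normR (c : R) x : 0 <= c -> l2norm (c%:C *: x) = c * l2norm x.
Proof. by move=> c0; rewrite l2normZ normc_real ger0_norm. Qed.

Lemma cauchy_schwarz x y : dot x y <= l2norm x * l2norm y.
Proof.
have [->|x0] := eqVneq x 0; first by rewrite dot0l mulr_ge0 ?l2norm_ge0.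
have [->|y0] := eqVneq y 0; first by rewrite dot0r mulr_ge0 ?l2norm_ge0.
have nx : 0 < l2norm x by rewrite l2norm_gt0.
have ny : 0 < l2norm y by rewrite l2norm_gt0.
have := dotxx_ge0 ((l2norm y)%:C *: x - (l2norm x)%:C *: y).
rewrite dotBl !dotBr !dotRl !dotRr -!l2norm_sqr (dotC y x).
set a := l2norm x in nx *; set b := l2norm y in ny *; set d := dot x y => h.
have {}h : 0 <= 2 * (a * b) * (a * b - d) by move: h; congr (_ <= _); ring.
by move: h; rewrite pmulr_rge0 ?subr_ge0// !mulr_gt0.
Qed.

Lemma l2normD x y : l2norm (x + y) <= l2norm x + l2norm y.
Proof.
rewrite -ler_sqr ?nnegrE ?addr_ge0 ?l2norm_ge0//.
rewrite sqrrD !l2norm_sqr dotDl !dotDr (dotC y x).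
by have := cauchy_schwarz x y; lra.
Qed.

Lemma l2normB x y : l2norm (x - y) <= l2norm x + l2norm y.
Proof. by rewrite (le_trans (l2normD _ _))// l2normN. Qed.

Lemma l2norm_lipschitz x y : l2norm x <= l2norm y + l2norm (x - y).
Proof. by rewrite (le_trans _ (l2normD _ _))// addrC subrK. Qed.

Lemma dot_eq0 x : (forall y, dot x y = 0) -> x = 0.
Proof. by move=> h; apply: l2norm_eq0; rewrite l2normE h sqrtr0. Qed.

Lemma dot_inj x x' : (forall y, dot x y = dot x' y) -> x = x'.
Proof.
move=> h; apply/eqP; rewrite -subr_eq0; apply/eqP/dot_eq0 => y.
by rewrite dotBl h subrr.
Qed.

End l2Theory.

Lemma dot_delta p (x : l2 R p) j v : dot x (l2_delta j v) = pdot (x j) v.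
Proof.
rewrite /dot (@asum_fin _ _ [:: j])//=; first by rewrite big_seq1 eqxx.
by move=> i; rewrite inE => /negPf ->; rewrite pdotC pdot0l.
Qed.

Lemma l2norm_delta p j (v : 'cV[C]_p) : l2norm (l2_delta j v) = enorm v.
Proof. by rewrite l2normE dot_delta /= eqxx -sqnormE. Qed.

Lemma l2_deltaD p j (v w : 'cV[C]_p) :
  l2_delta j (v + w) = l2_delta j v + l2_delta j w.
Proof. by apply: l2_ext => i; rewrite l2DE /=; case: eqP; rewrite ?addr0. Qed.

Lemma l2_deltaZ p j a (v : 'cV[C]_p) : l2_delta j (a *: v) = a *: l2_delta j v.
Proof. by apply: l2_ext => i; rewrite l2ZE /=; case: eqP; rewrite ?scaler0. Qed.

Lemma l2_delta0 p j : l2_delta j (0 : 'cV[C]_p) = 0.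
Proof. by apply: l2_ext => i; rewrite l20E /=; case: eqP. Qed.

Lemma l2_delta_sum p j (I : Type) (r : seq I) (F : I -> 'cV[C]_p) :
  l2_delta j (\sum_(k <- r) F k) = \sum_(k <- r) l2_delta j (F k).
Proof.
elim: r => [|a r IH]; first by rewrite !big_nil l2_delta0.
by rewrite !big_cons l2_deltaD IH.
Qed.

Lemma l2_sumE p (I : Type) (r : seq I) (F : I -> l2 R p) i :
  (\sum_(k <- r) F k) i = \sum_(k <- r) F k i.
Proof.
elim: r => [|a r IH]; first by rewrite !big_nil.
by rewrite !big_cons l2DE IH.
Qed.

End InnerProduct.

(** * Completeness of l2 and density of the finitely supported vectors *)

Section Operators.
Context {R : realType}.
Local Notation C := R[i].
Local Notation Re := (@complex.Re R).
Local Notation Im := (@complex.Im R).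

Lemma expr_small (q C e : R) : 0 <= q < 1 -> 0 < e -> exists k, C * q ^+ k <= e.
Proof.
move=> /andP[q0 q1] e0.
have cv : (fun k => C * q ^+ k) @ \oo --> (C * 0 : R).
  by apply: cvgMr; apply: cvg_expr; rewrite ger0_norm.
rewrite mulr0 in cv.
have /cvgrPdist_le/(_ _ e0)[k _ /(_ k (leqnn k))] := cv.
by rewrite sub0r normrN => h; exists k; rewrite (le_trans (ler_norm _)).
Qed.

Lemma le_small (a b : R) : (forall e, 0 < e -> a <= b + e) -> a <= b.
Proof. by move=> h; apply/ler_addgt0Pr => e /h. Qed.

(** Every lower bound [a k - B k] lies below every upper bound [a m + B m], so the supremum of the
    lower bounds serves as limit. The modulus [B] survives unchanged in the conclusion. *)
Lemma cauchy_sup (a B : nat -> R) :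
  (forall k l, `|a (k + l)%N - a k| <= B k) -> exists L, forall k, `|L - a k| <= B k.
Proof.
move=> aB; pose S := [set a k - B k | k in [set: nat]].
have B0 k : 0 <= B k by rewrite (le_trans _ (aB k 0%N)).
have H k m : a k - B k <= a m + B m.
  case: (leqP k m) => [/subnKC <-|/ltnW /subnKC <-].
    have := aB k (m - k)%N; have := B0 (k + (m - k))%N.
    by rewrite ler_norml => ? /andP[]; lra.
  have := aB m (k - m)%N; have := B0 (m + (k - m))%N.
  by rewrite ler_norml => ? /andP[]; lra.
have S0 : S !=set0 by exists (a 0%N - B 0%N); exists 0%N.
have Sb : has_ubound S by exists (a 0%N + B 0%N) => _ [k _ <-].
exists (sup S) => k; rewrite ler_norml.
have : a k - B k <= sup S by apply: ub_le_sup => //; exists k.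
have : sup S <= a k + B k by apply: ge_sup => // _ [m _ <-].
by move=> *; apply/andP; split; lra.
Qed.

Section Completeness.
Variable p : nat.
Implicit Types x y z : l2 R p.

Lemma Re_le_normc (a : C) : `|Re a| <= normc a.
Proof. by case: a => u v /=; rewrite -sqrtr_sqr ler_wsqrtr// lerDl sqr_ge0. Qed.

Lemma Im_le_normc (a : C) : `|Im a| <= normc a.
Proof. by case: a => u v /=; rewrite -sqrtr_sqr ler_wsqrtr// lerDr sqr_ge0. Qed.

Lemma normc_le_enorm m (v : 'cV[C]_m) r : normc (v r 0) <= enorm v.
Proof.
rewrite -[normc _]ger0_norm ?normc_ge0// -sqrtr_sqr ler_wsqrtr//.
by rewrite /sqnorm (bigD1 r)//= lerDl sumr_ge0// => s _; exact: sqr_ge0.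
Qed.

(** The limit is taken coordinatewise. On a finite set of indices the error is compared with a later
    term [u (k + m)], where [m] is chosen after the set: the coordinatewise error grows with the
    size of the set, but is then negligible. The factor 2 absorbs the constant of [sqnormD]. *)
Lemma l2_complete (u : nat -> l2 R p) (B : nat -> R) :
  (forall k e, 0 < e -> exists m, B (k + m)%N <= e) ->
  (forall k l, l2norm (u (k + l)%N - u k) <= B k) ->
  exists x, forall k, l2norm (x - u k) <= 2 * B k.
Proof.
move=> Bs uB.
have B0 k : 0 <= B k by rewrite (le_trans _ (uB k 0%N))// l2norm_ge0.
have co k l i r : normc (u (k + l)%N i r 0 - u k i r 0) <= B k.
  rewrite (le_trans _ (uB k l))// (le_trans _ (enorm_le_l2norm _ i))//.
  by have := normc_le_enorm ((u (k + l)%N - u k) i) r; rewrite !mxE.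
have fR i r : exists L, forall k, `|L - Re (u k i r 0)| <= B k.
  apply: cauchy_sup => k l; rewrite (le_trans _ (co k l i r))//.
  by rewrite (le_trans _ (Re_le_normc _))//; case: (u _ _ _ _); case: (u _ _ _ _).
have fI i r : exists L, forall k, `|L - Im (u k i r 0)| <= B k.
  apply: cauchy_sup => k l; rewrite (le_trans _ (co k l i r))//.
  by rewrite (le_trans _ (Im_le_normc _))//; case: (u _ _ _ _); case: (u _ _ _ _).
pose xf (i : int) : 'cV[C]_p := \col_r (projT1 (cid (fR i r)) +i* projT1 (cid (fI i r))).
have xfP k i : sqnorm (xf i - u k i) <= p%:R * (2 * B k ^+ 2).
  rewrite -[p in p%:R]card_ord -sum1_card natr_sum mulr_suml; apply: ler_sum => r _.
  rewrite mul1r !mxE normc_sqr.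
  case: (cid (fR i r)) => L1 /(_ k) /=; case: (cid (fI i r)) => L2 /(_ k) /=.
  case: (u k i r 0) => a b /=.
  have sq (c : R) : `|c| <= B k -> c ^+ 2 <= B k ^+ 2.
    by move=> h; rewrite -[c ^+ 2]real_normK ?num_real// ler_sqr ?nnegrE.
  by move=> /sq h1 /sq h2; lra.
have fin k (r : seq int) : uniq r -> \sum_(i <- r) sqnorm (xf i - u k i) <= 2 * B k ^+ 2.
  move=> ur; apply: le_small => e e0.
  have [m Bm] : exists m, (size r)%:R * p%:R * 4 * B (k + m)%N ^+ 2 <= e.
    pose K : R := (size r)%:R * p%:R * 4 + 1.
    have K0 : 0 < K by rewrite ltr_wpDl// !mulr_ge0.
    have [m Bm] := Bs k (Num.min 1 (e / K)) ltac:(by rewrite lt_min ltr01 divr_gt0).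
    exists m; move: Bm; rewrite le_min => /andP[B1 Be].
    have : B (k + m)%N ^+ 2 <= e / K by rewrite expr2 (le_trans _ Be)// ler_piMr.
    rewrite ler_pdivlMr// => h; have := sqr_ge0 (B (k + m)%N).
    by rewrite (le_trans _ h)// mulrC ler_wpM2l ?sqr_ge0// /K lerDl.
  have ui (j : nat) i : sqnorm (u (k + j)%N i - u k i) = sqnorm ((u (k + j)%N - u k) i) by [].
  apply: (@le_trans _ _ (\sum_(i <- r) (2 * sqnorm (xf i - u (k + m)%N i) +
      2 * sqnorm ((u (k + m)%N - u k) i)))).
    apply: ler_sum => i _; rewrite -ui.
    have -> : xf i - u k i = (xf i - u (k + m)%N i) + (u (k + m)%N i - u k i).
      by rewrite addrA subrK.
    exact: sqnormD.
  rewrite big_split/= addrC; apply: lerD; last first.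
    apply: le_trans Bm.
    apply: (@le_trans _ _ (\sum_(i <- r) 2 * (p%:R * (2 * B (k + m)%N ^+ 2)))).
      by apply: ler_sum => i _; rewrite ler_pM2l.
    rewrite big_const_seq count_predT iter_addr_0 -mulr_natl.
    by rewrite le_eqVlt; apply/orP; left; apply/eqP; ring.
  rewrite -mulr_sumr ler_pM2l//.
  apply: (@le_trans _ _ (asum (fun i => sqnorm ((u (k + m)%N - u k) i)))).
    apply: (@le_sum_asum _ (fun i => sqnorm ((u (k + m)%N - u k) i))) => //.
      exact: sm_sqnorm.
    by move=> i; exact: sqnorm_ge0.
  by rewrite -dotxxE -l2norm_sqr ler_sqr ?nnegrE ?l2norm_ge0.
have dif k : (fun i => xf i - u k i) \in @sqsummable R p.
  by apply: sm_l2; apply: (asum_ub _ (fin k)).1 => i; exact: sqnorm_ge0.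
exists (u 0%N + L2 (dif 0%N)) => k.
have -> : u 0%N + L2 (dif 0%N) - u k = L2 (dif k).
  by apply: l2_ext => i; rewrite l2BE l2DE /= [u 0%N i + _]addrC subrK.
rewrite -ler_sqr ?nnegrE ?l2norm_ge0 ?mulr_ge0// l2norm_sqr dotxxE.
apply: le_trans (asum_ub _ (fin k)).2 _; first by move=> i; exact: sqnorm_ge0.
by have := sqr_ge0 (B k); rewrite exprMn; lra.
Qed.

Lemma dot_trunc x (r : seq int) : uniq r ->
  dot (x - \sum_(i <- r) l2_delta i (x i)) (x - \sum_(i <- r) l2_delta i (x i)) =
  dot x x - \sum_(i <- r) sqnorm (x i).
Proof.
move=> ur; set z := \sum_(i <- r) _.
have zE i : z i = if i \in r then x i else 0.
  rewrite /z l2_sumE; case: ifPn => ir; last first.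
    rewrite big_seq big1// => j jr /=.
    by case: eqP => // ij; move: ir; rewrite ij jr.
  by rewrite (bigD1_seq i)//= eqxx big1 ?addr0// => j; rewrite eq_sym => /negPf ->.
rewrite !dotxxE -[\sum_(i <- r) _](_ : asum (fun i => sqnorm (z i)) = _); last first.
  rewrite (@asum_fin _ _ r)//; last by move=> i /negPf ir; rewrite zE ir sqnorm0.
  by rewrite big_seq [RHS]big_seq; apply: eq_bigr => i ir; rewrite zE ir.
rewrite -asumB; try exact: sm_sqnorm.
congr asum; apply/funext => i; rewrite l2BE zE.
by case: ifP; rewrite ?subrr ?sqnorm0 ?subr0 ?subrr.
Qed.

(** If every finite truncation missed [x] by more than [e], all finite sums of [sqnorm (x i)] would
    stay below [dot x x - e ^+ 2], and so would their supremum [dot x x]. *)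
Lemma trunc_approx x (e : R) : 0 < e -> exists2 r : seq int, uniq r &
  l2norm (x - \sum_(i <- r) l2_delta i (x i)) <= e.
Proof.
move=> e0; apply: contrapT => h.
have : asum (fun i => sqnorm (x i)) <= dot x x - e ^+ 2.
  apply: (asum_ub _ _).2 => [i|r ur]; first exact: sqnorm_ge0.
  rewrite lerBrDr addrC -lerBrDr -dot_trunc// -l2norm_sqr ler_sqr ?nnegrE ?l2norm_ge0 ?ltW//.
  by rewrite ltNge; apply/negP => h'; apply: h; exists r.
by rewrite -dotxxE; have := exprn_gt0 2 e0; lra.
Qed.

(** Identities between bounded maps are reduced to matrix entries here. Additivity stands in for
    linearity because [f] vanishes on [l2_delta i v] for every [v]. *)
Lemma delta_dense (f : l2 R p -> R) (K : R) :
  (forall x y, f (x + y) = f x + f y) -> (forall x, `|f x| <= K * l2norm x) ->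
  (forall i v, f (l2_delta i v) = 0) -> forall x, f x = 0.
Proof.
move=> fD fK f0 x.
have f00 : f 0 = 0 by have := fD 0 0; rewrite addr0; lra.
have fs (r : seq int) : f (\sum_(i <- r) l2_delta i (x i)) = 0.
  by elim: r => [|a r IH]; rewrite ?big_nil// big_cons fD f0 IH addr0.
have K0 : 0 < `|K| + 1 by rewrite ltr_wpDl.
apply/eqP; rewrite -normr_le0; apply: le_small => e e0; rewrite add0r.
have [r _ re] := trunc_approx x (divr_gt0 e0 K0).
rewrite -[x in f x](subrK (\sum_(i <- r) l2_delta i (x i))) fD fs addr0.
apply: le_trans (fK _) _.
apply: (@le_trans _ _ ((`|K| + 1) * l2norm (x - \sum_(i <- r) l2_delta i (x i)))).
  by apply: ler_wpM2r; [exact: l2norm_ge0|have := ler_norm K; lra].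
by rewrite mulrC -ler_pdivlMr.
Qed.

End Completeness.
End Operators.
(** * Adjoints and invertibility *)

Section Adjoints.
Context {R : realType}.
Local Notation C := R[i].
Local Notation Re := (@complex.Re R).
Local Notation Im := (@complex.Im R).
Variable p : nat.
Implicit Types (x y z : l2 R p) (T S : op R p).

Definition linop (f : l2 R p -> l2 R p) (f_lin : linear f) : op R p :=
  HB.pack f (GRing.isLinear.Build _ _ _ _ f f_lin).

Definition opbound (f : l2 R p -> l2 R p) (M : R) :=
  forall x, l2norm (f x) <= M * l2norm x.

Lemma opnorm_le T M : (opnorm T <= M%:E)%E -> opbound T M.
Proof.
move=> TM x; have [->|x0] := eqVneq x 0; first by rewrite linear0 l2norm0 mulr0.
have nx : 0 < l2norm x by rewrite l2norm_gt0.
pose c := (l2norm x)^-1; have c0 : 0 <= c by rewrite invr_ge0 ltW.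
have : (l2norm (T (c%:C *: x)) <= M)%R.
  rewrite -lee_fin; apply: le_trans TM; apply: ereal_sup_ubound.
  by exists (c%:C *: x) => //=; rewrite l2normR// mulVf ?gt_eqF.
by rewrite linearZ l2normR// /c mulrC ler_pdivrMr.
Qed.

Lemma opbound_bounded T M : opbound T M -> bounded_op T.
Proof.
move=> TM; apply: le_lt_trans (ltry (`|M|)).
apply: ge_ereal_sup => _ [x /= x1 <-]; rewrite lee_fin (le_trans (TM x))//.
rewrite (le_trans (ler_norm _))// normrM [X in _ * X]ger0_norm ?l2norm_ge0//.
by rewrite ler_piMr.
Qed.

Lemma bounded_opP T : bounded_op T -> exists2 M, 0 < M & opbound T M.
Proof.
move=> bT; have T0 : (0 <= opnorm T)%E.
  apply: ereal_sup_ubound; exists 0; first by rewrite /= l2norm0.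
  by rewrite linear0 l2norm0.
have fT : opnorm T \is a fin_num by rewrite ge0_fin_numE.
exists (fine (opnorm T) + 1); first by rewrite ltr_wpDl// fine_ge0.
by apply: opnorm_le; rewrite EFinD fineK// leeDl// lee_fin.
Qed.

Lemma opboundB T lambda M : opbound T M ->
  opbound (fun x => T x - lambda *: x) (M + normc lambda).
Proof.
by move=> TM x; rewrite (le_trans (l2normB _ _))// mulrDl lerD// l2normZ.
Qed.

Definition adjoint T S := forall x y, dot (T x) y = dot x (S y).

Lemma adjoint_bound T S M : adjoint T S -> opbound T M -> opbound S M.
Proof.
move=> TS TM y; have [->|y0] := eqVneq (S y) 0.
  have M0 : 0 <= M * l2norm y by rewrite (le_trans _ (TM y))// l2norm_ge0.
  by rewrite l2norm0.
have ny : 0 < l2norm (S y) by rewrite l2norm_gt0.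
rewrite -(ler_pM2l ny) -expr2 l2norm_sqr -TS.
rewrite (le_trans (cauchy_schwarz _ _))//.
rewrite mulrA ler_wpM2r ?l2norm_ge0// [leRHS]mulrC; exact: TM.
Qed.

Lemma pdot_deltal m (a : C) (r : 'I_m) (w : 'cV[C]_m) :
  pdot (a *: delta_mx r 0) w = Re a * Re (w r 0) + Im a * Im (w r 0).
Proof.
rewrite /pdot (bigD1 r)//= !mxE !eqxx mulr1 big1 ?addr0// => s sr.
by rewrite !mxE (negPf sr)/= mulr0 /= !mul0r addr0.
Qed.

Lemma pdot_sum_l m (I : Type) (s : seq I) (F : I -> 'cV[C]_m) w :
  pdot (\sum_(k <- s) F k) w = \sum_(k <- s) pdot (F k) w.
Proof.
elim: s => [|a s IH]; first by rewrite !big_nil pdot0l.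
by rewrite !big_cons pdotDl IH.
Qed.

Lemma col_sum_delta m (v : 'cV[C]_m) : v = \sum_r v r 0 *: delta_mx r 0.
Proof. by rewrite [LHS]matrix_sum_delta; apply: eq_bigr => r _; rewrite big_ord1. Qed.

Lemma pdot_inj m (v v' : 'cV[C]_m) : (forall w, pdot v w = pdot v' w) -> v = v'.
Proof.
move=> h; apply/matrixP => r c; rewrite ord1.
apply: complex_eq.
  by have := h (1 *: delta_mx r 0); rewrite !(pdotC _ (_ *: _)) !pdot_deltal /= !mul1r !mul0r !addr0.
by have := h ((0 +i* 1) *: delta_mx r 0); rewrite !(pdotC _ (_ *: _)) !pdot_deltal /= !mul1r !mul0r !add0r.
Qed.

Lemma complex_split (a : C) : a = (Re a)%:C * 1 + (Im a)%:C * (0 +i* 1).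
Proof. by case: a => u v; apply: complex_eq => /=; ring. Qed.

(** Each value of the adjoint comes from Riesz representation in dimension [p]: [g y i] represents
    [v -> dot (T (l2_delta i v)) y]. A finite part [z] of [g y] satisfies [dot z z = dot (T z) y],
    which bounds [l2norm z] by [M * l2norm y] and makes [g y] square-summable. *)
Lemma adjoint_exists T : bounded_op T -> exists S, adjoint T S.
Proof.
move=> /bounded_opP[M M0 TM].
(* As [dot] is a real part, testing with a basis vector and with [i] times it yields the real and
   the imaginary part of a coordinate. *)
pose g y (i : int) : 'cV[C]_p := \col_r
  (dot (T (l2_delta i (1 *: delta_mx r 0))) y +i*
   dot (T (l2_delta i ((0 +i* 1) *: delta_mx r 0))) y).
have gP y i v : pdot v (g y i) = dot (T (l2_delta i v)) y.
  have dD u w : dot (T (l2_delta i (u + w))) y = dot (T (l2_delta i u)) y + dot (T (l2_delta i w)) y.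
    by rewrite l2_deltaD linearD dotDl.
  have dR (c : R) w : dot (T (l2_delta i (c%:C *: w))) y = c * dot (T (l2_delta i w)) y.
    by rewrite l2_deltaZ linearZ dotRl.
  rewrite (col_sum_delta v) pdot_sum_l l2_delta_sum linear_sum/=.
  have -> (F : 'I_p -> l2 R p) : dot (\sum_r F r) y = \sum_r dot (F r) y.
    by elim/big_rec2: _ => [|r a b _ <-]; rewrite ?dot0l ?dotDl.
  apply: eq_bigr => r _; rewrite pdot_deltal mxE /=.
  have -> : v r 0 *: delta_mx r 0 = (Re (v r 0))%:C *: (1 *: delta_mx r 0 : 'cV[C]_p) +
      (Im (v r 0))%:C *: ((0 +i* 1) *: delta_mx r 0).
    by rewrite !scalerA -scalerDl -complex_split.
  by move: (1 *: delta_mx r 0) ((0 +i* 1) *: delta_mx r 0) => w w'; rewrite dD !dR.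
have gF y (r : seq int) : uniq r -> \sum_(i <- r) sqnorm (g y i) <= (M * l2norm y) ^+ 2.
  move=> ur; pose z := \sum_(i <- r) l2_delta i (g y i).
  have zE : dot z z = \sum_(i <- r) sqnorm (g y i).
    have zi i : z i = if i \in r then g y i else 0.
      rewrite /z l2_sumE; case: ifPn => ir; last first.
        rewrite big_seq big1// => j jr /=.
        by case: eqP => // ij; move: ir; rewrite ij jr.
      by rewrite (bigD1_seq i)//= eqxx big1 ?addr0// => j; rewrite eq_sym => /negPf ->.
    rewrite dotxxE (@asum_fin _ _ r)//; last by move=> i /negPf ir; rewrite zi ir sqnorm0.
    by rewrite big_seq [RHS]big_seq; apply: eq_bigr => i ir; rewrite zi ir.
  have zT : dot z z = dot (T z) y.
    rewrite zE /z linear_sum/=; elim: r {ur z zE} => [|a r IH].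
      by rewrite !big_nil dot0l.
    by rewrite !big_cons dotDl -gP -sqnormE IH.
  have My : 0 <= M * l2norm y by rewrite mulr_ge0 ?l2norm_ge0// ltW.
  rewrite -zE -l2norm_sqr ler_sqr ?nnegrE ?l2norm_ge0//.
  have [->|z0] := eqVneq z 0; first by rewrite l2norm0.
  have nz : 0 < l2norm z by rewrite l2norm_gt0.
  rewrite -(ler_pM2l nz) -expr2 l2norm_sqr zT (le_trans (cauchy_schwarz _ _))//.
  by rewrite mulrA ler_wpM2r ?l2norm_ge0// [leRHS]mulrC.
have g2 y : g y \in @sqsummable R p.
  by apply: sm_l2; apply: (asum_ub _ (gF y)).1 => i; exact: sqnorm_ge0.
pose S0 y : l2 R p := L2 (g2 y).
have S0a x y : dot (T x) y = dot x (S0 y).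
  apply/eqP; rewrite -subr_eq0; apply/eqP; move: x.
  apply: (@delta_dense _ _ _ (M * l2norm y + l2norm (S0 y))).
  - by move=> x x'; rewrite linearD !dotDl; ring.
  - have cs x x' : `|dot x x'| <= l2norm x * l2norm x'.
      rewrite ler_norml cauchy_schwarz andbT lerNl -dotNl.
      by rewrite (le_trans (cauchy_schwarz _ _))// l2normN.
    move=> x; rewrite (le_trans (ler_normB _ _))// mulrDl lerD//.
      by rewrite (le_trans (cs _ _))// mulrAC ler_wpM2r ?l2norm_ge0.
    by rewrite (le_trans (cs _ _))// mulrC.
  - by move=> i v; rewrite -gP [X in _ - X]dotC dot_delta /= pdotC subrr.
have S0lin : linear S0.
  move=> a y y'; apply: dot_inj => x; rewrite dotC -S0a dotDr dotDl dotC dotZl.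
  rewrite ![dot (S0 _) _]dotC -S0a.
  have -> : dot (a *: S0 y) x = dot y ((conjc a) *: T x).
    by rewrite dotZl [LHS]dotC -S0a linearZ [LHS]dotC.
  by rewrite [X in _ + X = _]dotC [X in _ = _ + X]dotC.
by exists (linop S0lin).
Qed.

End Adjoints.

(** * Lower bounds and resolvents *)

Section Invertibility.
Context {R : realType}.
Local Notation C := R[i].
Variable p : nat.
Implicit Types (x y z : l2 R p) (T S A B : op R p).

Definition bounded_below (f : l2 R p -> l2 R p) (c : R) :=
  forall x, c * l2norm x <= l2norm (f x).

(* With $T^*$ bounded below by c, the Landweber iteration
   $u \mapsto u + M^{-2} (y - T T^* u)$ contracts the residual, because
   $\|T T^* r\|^2 \le M^2 \langle T T^* r, r \rangle$. *)
Lemma adjoint_below_surj T S M c : adjoint T S -> 0 < M -> opbound T M ->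
  0 < c -> bounded_below S c -> forall y, exists z, T z = y.
Proof.
move=> TS M0 TM c0 Sc y.
have SM := adjoint_bound TS TM.
pose t : R := (M ^+ 2)^-1.
have M20 : 0 < M ^+ 2 by rewrite exprn_gt0.
have t0 : 0 < t by rewrite invr_gt0.
pose P x := T (S x).
have PM x : dot (P x) (P x) <= M ^+ 2 * dot (S x) (S x).
  have Mx : 0 <= M * l2norm (S x) by rewrite mulr_ge0 ?l2norm_ge0// ltW.
  by rewrite -!l2norm_sqr -exprMn ler_sqr ?nnegrE ?l2norm_ge0//; exact: TM.
have Pd x : dot (P x) x = dot (S x) (S x) by rewrite TS.
(* A nonzero vector forces [c <= M], so the maximum with 0 matters only in the trivial space. *)
pose q2 := Num.max 0 (1 - t * c ^+ 2).
pose q := Num.sqrt q2.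
have q20 : 0 <= q2 by rewrite le_max lexx.
have q21 : q2 < 1 by rewrite gt_max ltr01 gtrBl mulr_gt0// exprn_gt0.
have q01 : 0 <= q < 1.
  by rewrite sqrtr_ge0 -sqrtr1 ltr_sqrt.
have contr x : l2norm (x - t%:C *: P x) <= q * l2norm x.
  rewrite -ler_sqr ?nnegrE ?mulr_ge0 ?l2norm_ge0 ?sqrtr_ge0// exprMn.
  rewrite (sqr_sqrtr q20) !l2norm_sqr dotBl !dotBr !dotRl !dotRr (dotC x) Pd.
  have h1 := PM x; have h2 : c ^+ 2 * dot x x <= dot (S x) (S x).
    have cx : 0 <= c * l2norm x by rewrite mulr_ge0 ?l2norm_ge0// ltW.
    by rewrite -!l2norm_sqr -exprMn ler_sqr ?nnegrE ?l2norm_ge0.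
  have h3 : t * (t * dot (P x) (P x)) <= t * dot (S x) (S x).
    by rewrite ler_pM2l// /t mulrC ler_pdivrMr// mulrC.
  have h4 : t * (c ^+ 2 * dot x x) <= t * dot (S x) (S x) by rewrite ler_pM2l.
  apply: (@le_trans _ _ ((1 - t * c ^+ 2) * dot x x)); first by lra.
  by rewrite ler_wpM2r ?dotxx_ge0// le_max lexx orbT.
pose u := fix u k : l2 R p := if k is k'.+1 then u k' + t%:C *: (y - P (u k')) else 0.
pose rs k := y - P (u k).
have uS k : u k.+1 = u k + t%:C *: rs k by [].
have PD x x' : P (x + x') = P x + P x' by rewrite /P !linearD.
have PR (a : C) x : P (a *: x) = a *: P x by rewrite /P !linearZ.
have PN x : P (- x) = - P x by rewrite /P !linearN.
have rsS k : rs k.+1 = rs k - t%:C *: P (rs k).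
  by rewrite {1}/rs uS PD PR opprD addrA.
have rsq k : l2norm (rs k) <= l2norm y * q ^+ k.
  elim: k => [|k IH]; first by rewrite expr0 mulr1 /rs [P _](_ : _ = 0) ?subr0// /P !linear0.
  rewrite rsS (le_trans (contr _))// exprS mulrCA ler_wpM2l//.
  by rewrite sqrtr_ge0.
have q10 : 0 < 1 - q by rewrite subr_gt0; case/andP: q01.
have q0 : 0 <= q by case/andP: q01.
have q1 : q <= 1 by case/andP: q01 => _ /ltW.
pose D := t * l2norm y / (1 - q).
have D0 : 0 <= D by rewrite /D !mulr_ge0 ?l2norm_ge0 ?invr_ge0 ?ltW.
have uC l k : l2norm (u (k + l)%N - u k) <= D * q ^+ k.
  elim: l k => [|l IH] k.
    by rewrite addn0 subrr l2norm0 mulr_ge0 ?exprn_ge0.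
  rewrite addnS -addSn.
  have -> : u (k.+1 + l)%N - u k = (u (k.+1 + l)%N - u k.+1) + t%:C *: rs k.
    by rewrite uS opprD addrA subrK.
  rewrite (le_trans (l2normD _ _))// (le_trans (lerD (IH _) (lexx _)))//.
  rewrite (l2normR _ (ltW t0)).
  have h : t * l2norm (rs k) <= t * (l2norm y * q ^+ k) by rewrite ler_pM2l.
  apply: (le_trans (lerD (lexx _) h)).
  have -> : t * (l2norm y * q ^+ k) = D * (1 - q) * q ^+ k.
    by rewrite /D divfK ?gt_eqF// mulrA.
  by rewrite exprS le_eqVlt; apply/orP; left; apply/eqP; ring.
move: D D0 uC => D D0 uC.
have [x xu] : exists x, forall k, l2norm (x - u k) <= 2 * (D * q ^+ k).
  apply: l2_complete => // k e e0.
  have [m hm] := expr_small D q01 e0; exists m; rewrite (le_trans _ hm)//.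
  by rewrite ler_wpM2l// exprD ler_piMl ?exprn_ge0// exprn_ile1.
exists (S x); apply/eqP; rewrite eq_sym -subr_eq0; apply/eqP/l2norm_eq0/eqP.
rewrite eq_le l2norm_ge0 andbT; apply: le_small => e e0; rewrite add0r.
have [k hk] := expr_small (l2norm y + M * (M * (2 * D))) q01 e0.
have -> : y - T (S x) = rs k - P (x - u k).
  by rewrite PD PN /rs opprD opprK addrA [_ - P (u k) - _]addrAC subrK.
rewrite (le_trans (l2normB _ _))// (le_trans _ hk)// mulrDl lerD//.
rewrite (le_trans (TM _))// -!mulrA ler_pM2l// (le_trans (SM _))// ler_pM2l//.
Qed.

Lemma below_inj T c : 0 < c -> bounded_below T c -> injective T.
Proof.
move=> c0 Tc x x' xx'; apply/eqP; rewrite -subr_eq0; apply/eqP/l2norm_eq0/eqP.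
rewrite eq_le l2norm_ge0 andbT -(ler_pM2l c0) mulr0 (le_trans (Tc _))//.
by rewrite linearB xx' subrr l2norm0.
Qed.

(* B is meant to be the adjoint of A. *)
Definition below A B (lambda : C) (c : R) :=
  bounded_below (fun x => A x - lambda *: x) c /\
  bounded_below (fun x => B x - (conjc lambda) *: x) c.

Lemma opsub_linear A lambda : linear (fun x => A x - lambda *: x).
Proof.
move=> a x x'; rewrite linearP scalerDr !scalerA opprD addrACA scalerBr.
by rewrite scalerA [a * lambda]mulrC.
Qed.

Lemma adjoint_opsub A B lambda : adjoint A B ->
  adjoint (linop (opsub_linear A lambda)) (linop (opsub_linear B (conjc lambda))).
Proof.
move=> AB x y /=; rewrite dotBl dotBr AB; congr (_ - _).
by rewrite dotZl.
Qed.

Lemma conjc_conjc (a : C) : (conjc (conjc a)) = a.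
Proof. by case: a => u v /=; rewrite opprK. Qed.

(** A bounded left inverse gives a lower bound. For [A - lambda] this is the resolvent [V]; for the
    adjoint it is the adjoint of [V], since a right inverse becomes a left inverse on taking
    adjoints. *)
Lemma resolvent_below A B lambda : bounded_op A -> adjoint A B ->
  ~ Spec A lambda -> exists2 c, 0 < c & below A B lambda c.
Proof.
move=> bA AB /contrapT[V [bV VA AV]].
have [M M0 VM] := bounded_opP bV.
have [W VW] := adjoint_exists bV.
have WM := adjoint_bound VW VM.
have WB x : W (B x - (conjc lambda) *: x) = x.
  apply: dot_inj => y; rewrite dotC -VW dotC.
  have := adjoint_opsub lambda AB (V y) x => /= h.
  by rewrite dotC -h AV dotC.
exists M^-1; first by rewrite invr_gt0.
split => x; rewrite mulrC ler_pdivrMr// mulrC.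
  by rewrite -{1}[x]VA; exact: VM.
by rewrite -{1}[x]WB; exact: WM.
Qed.

(** The lower bound on the adjoint gives surjectivity, the one on [A - lambda] injectivity and the
    norm of the inverse. The explicit norm [c^-1] makes resolvents uniformly bounded in [lambda]
    when [c] is uniform. *)
Lemma below_resolvent A B lambda c : bounded_op A -> adjoint A B -> 0 < c ->
  below A B lambda c -> exists V : op R p, [/\ opbound V c^-1,
     forall x, V (A x - lambda *: x) = x & forall x, A (V x) - lambda *: V x = x].
Proof.
move=> bA AB c0 [Ac Bc].
have [M M0 AM] := bounded_opP bA.
pose T := linop (opsub_linear A lambda).
have TM : opbound T (M + normc lambda) by exact: opboundB.
have TS := adjoint_opsub lambda AB.
have M1 : 0 < M + normc lambda by rewrite ltr_wpDr ?normc_ge0.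
have sur := adjoint_below_surj TS M1 TM c0 Bc.
pose V0 y := projT1 (cid (sur y)).
have V0P y : T (V0 y) = y by rewrite /V0; case: cid.
have Tc : bounded_below T c := Ac.
have Tinj : injective T := below_inj c0 Tc.
have V0lin : linear V0.
  by move=> a x y; apply: Tinj; rewrite linearP !V0P.
exists (linop V0lin); split => [x|x|x] /=; last exact: V0P.
  rewrite mulrC ler_pdivlMr// mulrC (le_trans (Ac _))//.
  by rewrite -[leRHS](congr1 (@l2norm _ _) (V0P x)).
by apply: Tinj; rewrite V0P.
Qed.

Lemma below_notSpec A B lambda c : bounded_op A -> adjoint A B -> 0 < c ->
  below A B lambda c -> ~ Spec A lambda.
Proof.
move=> bA AB c0 lb; have [V [VM VA AV]] := below_resolvent bA AB c0 lb.
by apply; exists V; split => //; exact: opbound_bounded VM.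
Qed.

Lemma half_below (c u v w k : R) :
  k <= c / 2 * w -> u <= v + k -> c * w <= u -> c / 2 * w <= v.
Proof. lra. Qed.

Lemma one_below (M u v w k : R) :
  (M + 1) * w <= k -> k <= u + v -> v <= M * w -> 1 * w <= u.
Proof. lra. Qed.

Lemma below_near A B lambda mu c : below A B lambda c ->
  normc (mu - lambda) <= c / 2 -> below A B mu (c / 2).
Proof.
have H T a b : bounded_below (fun x => T x - a *: x) c -> normc (b - a) <= c / 2 ->
    bounded_below (fun x => T x - b *: x) (c / 2).
  move=> Ta ab x.
  have -> : T x - b *: x = (T x - a *: x) - (b - a) *: x.
    by rewrite scalerBl opprB addrA subrK.
  have := l2norm_lipschitz (T x - a *: x) ((T x - a *: x) - (b - a) *: x).
  rewrite opprB [_ + (_ - _)]addrC subrK l2normZ => h.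
  have h2 : normc (b - a) * l2norm x <= c / 2 * l2norm x.
    by rewrite ler_wpM2r// l2norm_ge0.
  exact: half_below h2 h (Ta x).
move=> [h1 h2] lm; split; first exact: H h1 lm.
apply: H h2 _; have -> : (conjc mu) - (conjc lambda) = (conjc (mu - lambda)).
  by case: (mu) => ? ?; case: (lambda) => ? ?; apply: complex_eq => //=; ring.
by rewrite normc_conjc.
Qed.

Lemma below_far A B lambda M : opbound A M -> adjoint A B -> M + 1 <= normc lambda ->
  below A B lambda 1.
Proof.
move=> AM AB Ml; have BM := adjoint_bound AB AM.
have H T a : opbound T M -> M + 1 <= normc a -> bounded_below (fun x => T x - a *: x) 1.
  move=> TM Ma x; have := l2norm_lipschitz (a *: x) (a *: x - T x).
  rewrite opprB [_ + (_ - _)]addrC subrK l2normZ [l2norm (_ - T x)]l2normBC => h.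
  have h2 : (M + 1) * l2norm x <= normc a * l2norm x.
    by rewrite ler_wpM2r// l2norm_ge0.
  exact: one_below h2 h (TM x).
by split; apply: H; rewrite ?normc_conjc.
Qed.

End Invertibility.

(** * Compactness, and nonemptiness of the spectrum *)

Section SpectrumTopology.
Context {R : realType}.
Local Notation C := R[i].
Local Notation Re := (@complex.Re R).
Local Notation Im := (@complex.Im R).

Lemma normc_le_ReIm (z : C) : normc z <= `|Re z| + `|Im z|.
Proof.
case: z => a b /=; rewrite -ler_sqr ?nnegrE ?sqrtr_ge0 ?addr_ge0//.
rewrite sqr_sqrtr ?addr_ge0 ?sqr_ge0// sqrrD !real_normK ?num_real//.
by have := mulr_ge0 (normr_ge0 a) (normr_ge0 b); lra.
Qed.

(** Constants that work locally have a common positive value on a compact square containing the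
    disc. Letting [c] run through the right neighbourhoods of 0 allows the near-covering form of
    compactness, in place of a minimum over a finite subcover. *)
Lemma disc_uniform (P : R -> C -> Prop) (r : R) :
  (forall c c' z, 0 < c' <= c -> P c z -> P c' z) ->
  (forall z, exists e c, [/\ 0 < e, 0 < c & forall w, normc (w - z) < e -> P c w]) ->
  exists2 c, 0 < c & forall z, normc z <= r -> P c z.
Proof.
move=> Pmono Ploc.
pose K := `[-r, r]%classic `*` `[-r, r]%classic.
have cK : compact K by apply: compact_setX; exact: segment_compact.
have : \forall c \near (0 : R)^'+, K `<=` (fun z => 0 < c /\ P c (z.1 +i* z.2)).
  apply: ((compact_near_coveringP K).1 cK) => -[x y] _.
  have [e [c [e0 c0 Pc]]] := Ploc (x +i* y).
  have e20 : 0 < e / 2 by rewrite divr_gt0.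
  exists (ball x (e / 2) `*` ball y (e / 2), [set c' | 0 < c' <= c]) => /=.
    split; first by exists (ball x (e / 2), ball y (e / 2)) => //=; split; exact: nbhsx_ballx.
    by near=> c'; apply/andP; split; near: c'; [exact: nbhs_right_gt|exact: nbhs_right_le].
  move=> [[x' y'] c'] /= [[xx' yy'] /andP[c'0 cc']]; split => //.
  apply: (@Pmono c); first by rewrite c'0.
  apply: Pc; apply: le_lt_trans (normc_le_ReIm _) _ => /=.
  move: xx' yy'; rewrite /ball /= !(distrC x) !(distrC y) => xx' yy'.
  by rewrite [e in _ < e]splitr ltrD.
move=> h; have [c [Kc c0]] : exists c : R, K `<=` (fun z => 0 < c /\ P c (z.1 +i* z.2)) /\ 0 < c.
  near (0 : R)^'+ => c; exists c; split; first by near: c.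
  by near: c; exact: nbhs_right_gt.
exists c => // -[x y] zr.
have hx := le_trans (Re_le_normc (x +i* y)) zr.
have hy := le_trans (Im_le_normc (x +i* y)) zr.
by apply: (Kc (x, y) _).2; split; rewrite /= in_itv/= -ler_norml.
Unshelve. all: by end_near.
Qed.

Section Uniform.
Variable p : nat.
Implicit Types (x y : l2 R p) (A B : op R p).

Lemma below_mono A B lambda (c c' : R) : c' <= c -> below A B lambda c -> below A B lambda c'.
Proof.
by move=> cc' [h1 h2]; split => x; [apply: le_trans (h1 x)|apply: le_trans (h2 x)];
  rewrite ler_wpM2r// l2norm_ge0.
Qed.

(** The distance condition is made part of [P], so that [P] holds vacuously near spectral points and
    compactness applies to a full disc; beyond radius [M + 1] the constant 1 works. For an empty
    spectrum the bound holds at every [z], which is what [Spec_nonempty] refutes. *)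
Lemma below_uniform A B (e : R) : bounded_op A -> adjoint A B -> 0 < e ->
  exists2 c, 0 < c & forall z : C, (forall s, Spec A s -> e <= normc (z - s)) ->
    below A B z c.
Proof.
move=> bA AB e0; have [M M0 AM] := bounded_opP bA.
pose P (c : R) (z : C) := (forall s, Spec A s -> e <= normc (z - s)) -> below A B z c.
have [c c0 Pc] : exists2 c, 0 < c & forall z, normc z <= M + 1 -> P c z.
  apply: disc_uniform => [c c' z /andP[_ cc'] Pc h|z].
    exact: below_mono cc' (Pc h).
  have [zS|zS] := pselect (Spec A z).
    exists e, 1; split => // w wz /(_ _ zS); by rewrite leNgt wz.
  have [c c0 zc] := resolvent_below bA AB zS.
  exists (c / 2), (c / 2); split; rewrite ?divr_gt0// => w /ltW wz _.
  exact: below_near zc wz.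
exists (Num.min c 1); first by rewrite lt_min c0 ltr01.
move=> z h; have [zM|/ltW zM] := lerP (normc z) (M + 1).
  by apply: below_mono (Pc z zM h); rewrite ge_min lexx.
by apply: below_mono (below_far AM AB zM); rewrite ge_min lexx orbT.
Qed.

End Uniform.
End SpectrumTopology.

Section NonemptySpectrum.
Context {R : realType}.
Local Notation C := R[i].
Variable p : nat.
Implicit Types (x y u a b : l2 R p) (A B V : op R p).

(** Averaging over [h = t, -t, it, -it] cancels all mixed terms and leaves
    [|u|^2 + t^2 |a|^2 + t^4 |b|^2], whose last term is dropped. The two points [t] and [-t] alone
    would leave the mixed term of [u] and [b]. *)
Lemma four_point_sum u a b (t m : R) : 0 <= t -> 0 <= m ->
  (forall h : C, normc h = t -> l2norm (u + h *: a + (h * h) *: b) <= m) ->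
  dot u u + t ^+ 2 * dot a a <= m ^+ 2.
Proof.
move=> t0 m0 hm.
have sq (h : C) : normc h = t ->
    dot (u + h *: a + (h * h) *: b) (u + h *: a + (h * h) *: b) <= m ^+ 2.
  by move=> /hm h1; rewrite -l2norm_sqr ler_sqr ?nnegrE ?l2norm_ge0.
pose a' := (0 +i* 1 : C) *: a.
have a'a' : dot a' a' = dot a a.
  rewrite /a' dotZl scalerA (_ : _ * _ = 1 :> C) ?scale1r//.
  by apply: complex_eq => /=; ring.
have e1 : normc (t%:C : C) = t by rewrite normc_real ger0_norm.
have e2 : normc ((- t)%:C : C) = t by rewrite normc_real normrN ger0_norm.
have e3 : normc (0 +i* t : C) = t by rewrite /= expr0n add0r sqrtr_sqr ger0_norm.
have e4 : normc (0 +i* (- t) : C) = t.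
  by rewrite /= expr0n add0r sqrtr_sqr normrN ger0_norm.
have s1 : (t%:C * t%:C = (t ^+ 2)%:C :> C) by apply: complex_eq => /=; ring.
have s2 : ((- t)%:C * (- t)%:C = (t ^+ 2)%:C :> C) by apply: complex_eq => /=; ring.
have s3 : ((0 +i* t) * (0 +i* t) = (- t ^+ 2)%:C :> C) by apply: complex_eq => /=; ring.
have s4 : ((0 +i* - t) * (0 +i* - t) = (- t ^+ 2)%:C :> C) by apply: complex_eq => /=; ring.
have a3 : (0 +i* t : C) *: a = t%:C *: a'.
  by rewrite scalerA; congr (_ *: _); apply: complex_eq => /=; ring.
have a4 : (0 +i* (- t) : C) *: a = (- t)%:C *: a'.
  by rewrite scalerA; congr (_ *: _); apply: complex_eq => /=; ring.
have := sq _ e1; have := sq _ e2; have := sq _ e3; have := sq _ e4.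
rewrite s1 s2 s3 s4 a3 a4 {sq s1 s2 s3 s4 a3 a4 e1 e2 e3 e4 hm}.
rewrite !(dotDl, dotDr) !(dotRl, dotRr) a'a' (dotC a u) (dotC b u) (dotC b a) (dotC a' u) (dotC b a').
have := mulr_ge0 (sqr_ge0 (t ^+ 2)) (dotxx_ge0 b).
move: (dot u u) (dot a a) (dot b b) (dot u a) (dot u b) (dot a b) (dot u a') (dot a' b) (m ^+ 2).
move=> d1 d2 d3 d4 d5 d6 d7 d8 m2 {t0 m0 m a' a'a'}; lra.
Qed.

Lemma resolvent_identity A V V' (z h : C) :
  (forall x, V (A x - z *: x) = x) ->
  (forall x, A (V' x) - (z + h) *: V' x = x) ->
  forall x, V' x = V x + h *: V (V' x).
Proof.
move=> VA AV x; have <- : V (x + h *: V' x) = V x + h *: V (V' x) by rewrite linearD linearZ.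
rewrite -[LHS]VA; congr (V _).
by rewrite -[in X in _ = X + _](AV x) scalerDl opprD addrA subrK.
Qed.

Lemma small_step (D L s : R) : 0 < D -> 0 < L -> 0 < s ->
  exists t, [/\ 0 < t, t <= 1, t <= s & t * L < D].
Proof.
move=> D0 L0 s0; pose t := Num.min 1 (Num.min s (D / L / 2)).
have t0 : 0 < t by rewrite !lt_min ltr01 s0 !divr_gt0.
have tE : [/\ t <= 1, t <= s & t <= D / L / 2] by rewrite /t !ge_min !lexx !orbT.
have [t1 ts tD] := tE; exists t; split => //.
rewrite -ltr_pdivlMr//; apply: le_lt_trans tD _.
by rewrite ltr_pdivrMr// ltr_pMr ?divr_gt0// ltr1n.
Qed.

(** The arithmetic of [Spec_nonempty], with [nu] and [na] the norms of [u = V z x] and [a = V z u].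
    The second-order gain [t ^+ 2 * na ^+ 2] competes with errors of order [t ^+ 3], while [na] is
    bounded away from 0 independently of [t]; a small [t] then contradicts the conclusion. *)
Lemma max_principle_ineq (s K M t nu na : R) : 0 < s -> 0 < K -> 0 < M ->
  0 < t -> t <= 1 -> t <= s ^+ 2 / 2 -> 0 <= nu -> 0 <= na -> nu <= K -> s <= K ->
  s ^+ 2 - t ^+ 3 < nu ^+ 2 ->
  nu ^+ 2 <= (2 * M * nu + 1) * na ->
  nu ^+ 2 + t ^+ 2 * na ^+ 2 <= (s + t ^+ 3 * K ^+ 4) ^+ 2 ->
  (s ^+ 2 / 2 / (2 * M * K + 1)) ^+ 2 <= t * (1 + 2 * K ^+ 5 + K ^+ 8).
Proof.
move=> s0 K0 M0 t0 t1 ts nu0 na0 nuK sK h1 h2 h3.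
have t3t : t ^+ 3 <= t.
  by rewrite exprS ler_piMr ?(ltW t0)// exprn_ile1 ?(ltW t0).
have MK : 0 < 2 * M * K + 1 by rewrite ltr_wpDl// !mulr_ge0// ltW.
have na1 : s ^+ 2 / 2 / (2 * M * K + 1) <= na.
  rewrite ler_pdivrMr//; have : (2 * M * nu + 1) * na <= (2 * M * K + 1) * na.
    by rewrite ler_wpM2r// lerD2r ler_wpM2l// mulr_ge0// ltW.
  by move: h1 h2; lra.
have : (s ^+ 2 / 2 / (2 * M * K + 1)) ^+ 2 <= na ^+ 2.
  by rewrite ler_sqr ?nnegrE// !mulr_ge0 ?sqr_ge0 ?invr_ge0// ltW.
move=> /le_trans; apply.
have t20 : 0 < t ^+ 2 by rewrite exprn_gt0.
rewrite -(ler_pM2l t20).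
have sK4 : s * K ^+ 4 <= K ^+ 5 by rewrite [K ^+ 5]exprS ler_wpM2r// exprn_ge0// ltW.
have e1 : t ^+ 3 * (s * K ^+ 4) <= t ^+ 3 * K ^+ 5.
  by rewrite ler_wpM2l// exprn_ge0// ltW.
have e2 : t ^+ 3 * (t ^+ 3 * K ^+ 8) <= t ^+ 3 * K ^+ 8.
  rewrite ler_wpM2l ?exprn_ge0 ?(ltW t0)// ler_piMl ?exprn_ge0 ?(ltW K0)//.
  by rewrite (le_trans t3t).
have E1 : (s + t ^+ 3 * K ^+ 4) ^+ 2 =
   s ^+ 2 + 2 * (t ^+ 3 * (s * K ^+ 4)) + t ^+ 3 * (t ^+ 3 * K ^+ 8) by ring.
have E2 : t ^+ 2 * (t * (1 + 2 * K ^+ 5 + K ^+ 8)) =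
  t ^+ 3 + 2 * (t ^+ 3 * K ^+ 5) + t ^+ 3 * K ^+ 8 by ring.
by rewrite E2; rewrite E1 in h3; move: h1 h3 e1 e2; lra.
Qed.

(* If every [A - z] were invertible, the bounded function
   [z |-> `|(A - z)^-1 x|] could not come arbitrarily close to its supremum:
   near a point z its mean square over [z + h i^k], k < 4, exceeds its square
   at z by a multiple of [h^2]. *)
Lemma Spec_nonempty A : (0 < p)%N -> bounded_op A -> exists z, Spec A z.
Proof.
move=> p0 bA; apply: contrapT => nS.
have {}nS z : ~ Spec A z by move=> Az; apply: nS; exists z.
have [B AB] := adjoint_exists bA.
have [M M0 AM] := bounded_opP bA.
have [c c0 cb] : exists2 c, 0 < c & forall z, below A B z c.
  have [c c0 h] := below_uniform bA AB (ltr01 : 0 < 1 :> R).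
  by exists c => // z; apply: h => s /nS.
pose K := c^-1; have K0 : 0 < K by rewrite invr_gt0.
pose V z := projT1 (cid (below_resolvent bA AB c0 (cb z))).
have VP z : [/\ opbound (V z) K, forall x, V z (A x - z *: x) = x &
    forall x, A (V z x) - z *: V z x = x] by rewrite /V; case: cid.
have VK z : opbound (V z) K by have [] := VP z.
have VA z x : V z (A x - z *: x) = x by have [_ ->] := VP z.
have AV z x : A (V z x) - z *: V z x = x by have [_ _ ->] := VP z.
pose x : l2 R p := l2_delta 0 (delta_mx (Ordinal p0) 0).
have x1 : l2norm x = 1.
  rewrite l2norm_delta /enorm /sqnorm (bigD1 (Ordinal p0))//= mxE !eqxx normc1 expr1n.
  rewrite big1 ?addr0 ?sqrtr1// => r rp.
  by rewrite mxE (negPf rp) normc0 expr0n.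
pose S := [set l2norm (V z x) | z in [set: C]].
have SK : ubound S K by move=> _ [z _ <-]; rewrite (le_trans (VK z x))// x1 mulr1.
have S0 : S !=set0 by exists (l2norm (V 0 x)), 0.
pose s := sup S.
have sV z : l2norm (V z x) <= s by apply: ub_le_sup; [exists K|exists z].
have sK : s <= K by apply: ge_sup.
have s0 : 0 < s.
  apply: lt_le_trans (sV 0); rewrite l2norm_gt0; apply/eqP => V0.
  have := AV 0 x; rewrite V0 linear0 scaler0 subr0 => /esym x0.
  by move: x1; rewrite x0 l2norm0 => /esym/eqP; rewrite oner_eq0.
pose D := (s ^+ 2 / 2 / (2 * M * K + 1)) ^+ 2.
pose L := 1 + 2 * K ^+ 5 + K ^+ 8.
have D0 : 0 < D.
  rewrite exprn_gt0// !divr_gt0 ?exprn_gt0// ltr_wpDl// !mulr_ge0//; exact: ltW.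
have L0 : 0 < L by rewrite !addr_gt0// ?mulr_gt0 ?exprn_gt0.
have s20 : 0 < s ^+ 2 / 2 by rewrite divr_gt0 ?exprn_gt0.
have [t [t0 t1 ts tL]] := small_step D0 L0 s20.
(* The defect from the supremum is of order [t ^+ 3], below the gain of order [t ^+ 2]. *)
have [z zs] : exists z, s ^+ 2 - t ^+ 3 < l2norm (V z x) ^+ 2.
  apply: contrapT => hz.
  have t30 : 0 < t ^+ 3 by rewrite exprn_gt0.
  pose m := Num.sqrt (s ^+ 2 - t ^+ 3).
  have : s <= m.
    apply: ge_sup => // _ [z _ <-].
    rewrite -[l2norm _]ger0_norm ?l2norm_ge0// -sqrtr_sqr ler_wsqrtr// leNgt.
    by apply/negP => h; apply: hz; exists z.
  rewrite leNgt -[s in _ < s]ger0_norm ?ltW// -sqrtr_sqr ltr_sqrt ?exprn_gt0//.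
  by rewrite gtrBl t30.
pose u := V z x; pose a := V z u; pose b := V z a.
(* The resolvent at [z + h] is expanded to second order; the remainder contains three factors [h]
   and has norm at most [t ^+ 3 * K ^+ 4]. *)
have hm (h : C) : normc h = t -> l2norm (u + h *: a + (h * h) *: b) <= s + t ^+ 3 * K ^+ 4.
  move=> ht; pose v := V (z + h) x.
  have vE y : V (z + h) y = V z y + h *: V z (V (z + h) y).
    exact: (resolvent_identity (VA z) (AV (z + h))).
  have v3 : v = u + h *: a + (h * h) *: b + (h * h * h) *: V z (V z (V z v)).
    have e1 : v = u + h *: V z v by exact: vE.
    have e2 : V z v = a + h *: V z (V z v) by rewrite {1}e1 linearD linearZ.
    have e3 : V z (V z v) = b + h *: V z (V z (V z v)) by rewrite {1}e2 linearD linearZ.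
    rewrite [LHS]e1 [X in u + _ *: X]e2 [X in a + _ *: X]e3.
    by rewrite !scalerDr !scalerA !addrA.
  have -> : u + h *: a + (h * h) *: b = v - (h * h * h) *: V z (V z (V z v)).
    by apply/eqP; rewrite eq_sym subr_eq -v3.
  apply: le_trans (l2normB _ _) _; apply: lerD; first exact: sV.
  rewrite l2normZ !normcM ht.
  have -> : t * t * t = t ^+ 3 by ring.
  rewrite ler_pM2l ?exprn_gt0//.
  rewrite exprS (le_trans (VK _ _))// (ler_pM2l K0).
  rewrite exprS (le_trans (VK _ _))// (ler_pM2l K0).
  rewrite expr2 (le_trans (VK _ _))// (ler_pM2l K0).
  exact: le_trans (sV _) sK.
have m0 : 0 <= s + t ^+ 3 * K ^+ 4.
  by rewrite addr_ge0 ?mulr_ge0 ?exprn_ge0//; apply: ltW.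
have h3 := four_point_sum (ltW t0) m0 hm.
rewrite -!l2norm_sqr in h3.
(* The bound must not depend on [z], which ranges over an unbounded set; [z *: u = A u - x] controls
   [normc z * l2norm u]. *)
have h2 : l2norm u ^+ 2 <= (2 * M * l2norm u + 1) * l2norm a.
  have h4 : l2norm u <= M * l2norm a + normc z * l2norm a.
    have -> : l2norm u = l2norm (A a - z *: a) by rewrite AV.
    by rewrite (le_trans (l2normB _ _))// l2normZ lerD.
  have h5 : normc z * l2norm u <= M * l2norm u + 1.
    rewrite -l2normZ -x1 -(AV z x) -/u.
    rewrite (le_trans (l2norm_lipschitz _ (A u)))// lerD//.
    by rewrite l2normBC.
  rewrite expr2 (le_trans (ler_wpM2l (l2norm_ge0 u) h4))//.
  have := ler_wpM2r (l2norm_ge0 a) h5.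
  move: (l2norm u) (l2norm a) (normc z) => nu na nz.
  by rewrite !mulrDl !mulrDr; clear; lra.
have := max_principle_ineq s0 K0 M0 t0 t1 ts (l2norm_ge0 u) (l2norm_ge0 a)
  (le_trans (sV z) sK) sK zs h2 h3.
by rewrite leNgt tL.
Qed.

End NonemptySpectrum.

(** * Windows of tridiagonal operators *)

Section Tridiagonal.
Context {R : realType}.
Local Notation C := R[i].

Lemma sqnorm_mxcol (m n : nat) (F : 'I_m -> 'cV[C]_n) :
  sqnorm (\mxcol_i F i) = \sum_i sqnorm (F i).
Proof.
rewrite /sqnorm [RHS]sig_big_dep/= (reindex _ tagnat.sig_bij_on)/=.
by apply: eq_bigr => s _; rewrite !mxE.
Qed.

Lemma enorm0 n : enorm (0 : 'cV[C]_n) = 0.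
Proof. by rewrite /enorm sqnorm0 sqrtr0. Qed.

Lemma enormD n (v w : 'cV[C]_n) : enorm (v + w) <= enorm v + enorm w.
Proof.
rewrite -!(l2norm_delta 0) l2_deltaD; exact: l2normD.
Qed.

Lemma enormN n (v : 'cV[C]_n) : enorm (- v) = enorm v.
Proof. by rewrite -scaleN1r -!(l2norm_delta 0) l2_deltaZ scaleN1r l2normN. Qed.

Lemma enormB n (v w : 'cV[C]_n) : enorm (v - w) <= enorm v + enorm w.
Proof. by rewrite (le_trans (enormD _ _))// enormN. Qed.

Lemma enormZ n (a : C) (v : 'cV[C]_n) : enorm (a *: v) = normc a * enorm v.
Proof. by rewrite -!(l2norm_delta 0) l2_deltaZ l2normZ. Qed.

Lemma pdot_norm n (v w : 'cV[C]_n) : `|pdot v w| <= enorm v * enorm w.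
Proof.
have dw (u : 'cV[C]_n) : pdot u w = dot (l2_delta 0 u) (l2_delta 0 w).
  by rewrite dot_delta /=.
rewrite -(l2norm_delta 0 v) -(l2norm_delta 0 w) dw ler_norml cauchy_schwarz andbT lerNl -dotNl.
by rewrite (le_trans (cauchy_schwarz _ _))// l2normN.
Qed.

Lemma mxnorm_le m n (D : 'M[C]_(m, n)) (a : R) v : (mxnorm D <= a%:E)%E ->
  enorm (D *m v) <= a * enorm v.
Proof.
move=> Da; have [v0|v0] := eqVneq (enorm v) 0.
  have -> : v = 0 by apply: sqnorm_eq0; rewrite -enorm_sqr v0 expr0n.
  by rewrite mulmx0 !enorm0 mulr0.
have nv : 0 < enorm v by rewrite lt_def v0 enorm_ge0.
have eZ k (c : R) (w : 'cV[C]_k) : 0 <= c -> enorm (c%:C *: w) = c * enorm w.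
  by move=> c0; rewrite enormZ normc_real ger0_norm.
have c0 : 0 <= (enorm v)^-1 by rewrite invr_ge0 enorm_ge0.
have : enorm (D *m ((enorm v)^-1%:C *: v)) <= a.
  rewrite -lee_fin; apply: le_trans Da; apply: ereal_sup_ubound.
  exists ((enorm v)^-1%:C *: v) => //=.
  by rewrite eZ// mulVf.
by rewrite -scalemxAr eZ// mulrC ler_pdivrMr.
Qed.

Lemma mxnorm_ge0 m n (D : 'M[C]_(m, n)) : (0 <= mxnorm D)%E.
Proof.
apply: ereal_sup_ubound; exists 0; first by rewrite /= enorm0.
by rewrite mulmx0 enorm0.
Qed.

Lemma pdotBl n (v v' w : 'cV[C]_n) : pdot (v - v') w = pdot v w - pdot v' w.
Proof.
apply/eqP; rewrite eq_sym subr_eq -pdotDl subrK; exact: eqxx.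
Qed.

Lemma mx_ofE p (B : op R p) (i j : int) (v : 'cV[C]_p) :
  B (l2_delta j v) i = mx_of B i j *m v.
Proof.
rewrite {1}(col_sum_delta v) l2_delta_sum linear_sum l2_sumE.
apply/matrixP => r c; rewrite ord1 summxE mxE; apply: eq_bigr => s _.
by rewrite l2_deltaZ linearZ l2ZE !mxE mulrC.
Qed.

Section Windows.
Variable p : nat.
Implicit Types (B : op R p) (x y : l2 R p).

Lemma banded_out B w i j v : banded B w -> (w < `|i - j|)%N ->
  B (l2_delta j v) i = 0.
Proof. by move=> Bw ij; rewrite mx_ofE Bw// mul0mx. Qed.

(** The matrix describes [B] on finitely supported vectors only; both sides are bounded in [x], so
    the identity extends by density. The constant [4 * M] counts the four terms. *)
Lemma tridiagonal_apply B x (i : int) : tridiagonal B ->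
  B x i = mx_of B i (i - 1) *m x (i - 1) + mx_of B i i *m x i +
          mx_of B i (i + 1) *m x (i + 1).
Proof.
move=> [/bounded_opP[M M0 BM] Btri].
apply: pdot_inj => w; apply/eqP; rewrite -subr_eq0; apply/eqP; move: x.
have MB j (v : 'cV[C]_p) : enorm (mx_of B i j *m v) <= M * enorm v.
  by rewrite -mx_ofE (le_trans (enorm_le_l2norm _ _))// (le_trans (BM _))// l2norm_delta.
apply: (@delta_dense _ _ _ (4 * M * enorm w)).
- move=> x y; rewrite linearD !l2DE !mulmxDr !pdotDl.
  by do 8! [move: (pdot _ _) => ?]; clear; ring.
- move=> x; rewrite -pdotBl (le_trans (pdot_norm _ _))// mulrAC ler_wpM2r ?enorm_ge0//.
  have MBx j : enorm (mx_of B i j *m x j) <= M * l2norm x.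
    by rewrite (le_trans (MB _ _))// ler_wpM2l ?enorm_le_l2norm// ltW.
  apply: le_trans (enormB _ _) _.
  have h1 : enorm (B x i) <= M * l2norm x.
    by rewrite (le_trans (enorm_le_l2norm _ _)).
  have h2 := enormD (mx_of B i (i - 1) *m x (i - 1) + mx_of B i i *m x i) (mx_of B i (i + 1) *m x (i + 1)).
  have h3 := enormD (mx_of B i (i - 1) *m x (i - 1)) (mx_of B i i *m x i).
  have h4 := lerD h1 (le_trans h2 (lerD (le_trans h3 (lerD (MBx _) (MBx _))) (MBx _))).
  apply: le_trans h4 _.
  by rewrite le_eqVlt; apply/orP; left; apply/eqP; ring.
- move=> j v; rewrite -pdotBl [X in pdot X](_ : _ = 0) ?pdot0l//.
  rewrite mx_ofE /=.
  have [<-|n1] := eqVneq (i - 1) j.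
    rewrite !ifN ?mulmx0 ?addr0 ?subrr//; lia.
  have [<-|n2] := eqVneq i j.
    by rewrite ifN ?mulmx0 ?addr0 ?add0r ?subrr//; lia.
  have [<-|n3] := eqVneq (i + 1) j.
    by rewrite !mulmx0 !add0r subrr.
  rewrite !mulmx0 !addr0 subr0 Btri ?mul0mx//.
  by move: n1 n2 n3; lia.
Qed.

Definition pad n (k : int) (v : 'I_n -> 'cV[C]_p) : l2 R p :=
  \sum_(j < n) l2_delta (k + 1 + j%:Z) (v j).

Lemma padE n k (v : 'I_n -> 'cV[C]_p) (j : 'I_n) : pad k v (k + 1 + j%:Z) = v j.
Proof.
rewrite /pad l2_sumE (bigD1 j)//= eqxx big1 ?addr0// => s sj.
by rewrite ifN//; move: sj; rewrite -val_eqE/=; lia.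
Qed.

Lemma pad_out n k (v : 'I_n -> 'cV[C]_p) (i : int) :
  (forall j : 'I_n, i != k + 1 + j%:Z) -> pad k v i = 0.
Proof. by move=> ik; rewrite /pad l2_sumE big1// => j _ /=; rewrite ifN. Qed.

Lemma asum_range (f : int -> R) (k : int) (m : nat) :
  (forall i, ~~ (k <= i < k + m%:Z) -> f i = 0) ->
  asum f = \sum_(j < m) f (k + j%:Z).
Proof.
move=> f0; rewrite (@asum_fin _ f [seq k + (j : nat)%:Z | j <- iota 0 m]).
- by rewrite big_map -(big_mkord predT (fun j => f (k + j%:Z))) /index_iota subn0.
- by rewrite map_inj_uniq ?iota_uniq// => a b; lia.
move=> i ir; apply: f0; apply/negP => /andP[h1 h2]; move/negP: ir; apply.
apply/mapP; exists `|i - k|%N; last by lia.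
by rewrite mem_iota; lia.
Qed.

Lemma l2norm_pad n k (v : 'I_n -> 'cV[C]_p) :
  l2norm (pad k v) ^+ 2 = \sum_j sqnorm (v j).
Proof.
rewrite l2norm_sqr dotxxE (@asum_range _ (k + 1) n).
  by apply: eq_bigr => j _; rewrite padE.
move=> i ik; rewrite pad_out ?sqnorm0// => j; apply/eqP => ij; move/negP: ik; apply.
by rewrite ij; have := ltn_ord j; lia.
Qed.

Lemma l2norm_tri_pad B lambda n k (v : 'I_n -> 'cV[C]_p) : tridiagonal B ->
  l2norm (B (pad k v) - lambda *: pad k v) ^+ 2 =
  \sum_(i < n.+2) sqnorm ((B (pad k v) - lambda *: pad k v) (k + i%:Z)).
Proof.
move=> [_ Btri]; rewrite l2norm_sqr dotxxE (@asum_range _ k n.+2)// => i ik.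
rewrite l2BE l2ZE /pad linear_sum l2_sumE big1; last first.
  move=> j _; apply: banded_out Btri _; have := ltn_ord j; move: ik; lia.
rewrite sub0r -/(pad k v) pad_out ?scaler0 ?oppr0 ?sqnorm0// => j.
by apply/eqP => ij; move/negP: ik; apply; have := ltn_ord j; lia.
Qed.

Lemma subcol_pad B lambda n k (v : 'I_n -> 'cV[C]_p) :
  (subcol (mx_of B) n k - lambda *: Iplus p n) *m (\mxcol_j v j) =
  \mxcol_(i < n.+2) (B (pad k v) - lambda *: pad k v) (k + i%:Z).
Proof.
rewrite mulmxBl -scalemxAl /subcol /Iplus.
have mulc (F : 'I_n.+2 -> 'I_n -> 'M[C]_p) :
    \mxblock_(i < n.+2, j < n) F i j *m (\mxcol_j v j) =
    \mxcol_i (\sum_j F i j *m v j).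
  rewrite mxblockEv mxcol_mul; apply: eq_mxcol => i.
  by rewrite mul_mxrow_mxcol.
have e (i : 'I_n.+2) : (B (pad k v) - lambda *: pad k v) (k + i%:Z) =
    \sum_(j < n) mx_of B (k + i%:Z) (k + 1 + j%:Z) *m v j -
    lambda *: \sum_(j < n) (if i == j.+1 :> nat then 1%:M else 0) *m v j.
  rewrite l2BE l2ZE; congr (_ - _ *: _).
    by rewrite /pad linear_sum l2_sumE; apply: eq_bigr => j _; rewrite mx_ofE.
  rewrite /pad l2_sumE; apply: eq_bigr => j _ /=.
  have -> : (k + i%:Z == k + 1 + j%:Z) = (i == j.+1 :> nat) by lia.
  by case: ifP; rewrite ?mul1mx ?mul0mx.
have mxZ (F G : 'I_n.+2 -> 'cV[C]_p) :
    \mxcol_i F i - lambda *: \mxcol_i G i = \mxcol_i (F i - lambda *: G i).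
  by apply/matrixP => r c; rewrite !mxE.
by rewrite !mulc mxZ; apply: eq_mxcol => i; rewrite e.
Qed.

(** A tridiagonal operator moves a vector supported on the columns [k + 1, ..., k + n] at most one
    position outwards. The two extra rows of the window catch this, so that windows cause no
    truncation error. *)
Lemma subcol_tri_pad B lambda n k (v : 'I_n -> 'cV[C]_p) : tridiagonal B ->
  enorm ((subcol (mx_of B) n k - lambda *: Iplus p n) *m (\mxcol_j v j)) =
  l2norm (B (pad k v) - lambda *: pad k v).
Proof.
move=> Btri; rewrite subcol_pad /enorm sqnorm_mxcol -l2norm_tri_pad//.
by rewrite sqrtr_sqr ger0_norm ?l2norm_ge0.
Qed.

Lemma enorm_mxcol_pad n k (v : 'I_n -> 'cV[C]_p) :
  enorm (\mxcol_j v j) = l2norm (pad k v).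
Proof.
by rewrite /enorm sqnorm_mxcol -(l2norm_pad k) sqrtr_sqr ger0_norm ?l2norm_ge0.
Qed.

End Windows.
Lemma nu_le m n (D : 'M[C]_(m, n)) u (mu : R) : enorm u != 0 ->
  enorm (D *m u) <= mu * enorm u -> (nu D <= mu%:E)%E.
Proof.
move=> u0 Du; have nu0 : 0 < enorm u by rewrite lt_def u0 enorm_ge0.
have c0 : 0 <= (enorm u)^-1 by rewrite invr_ge0 enorm_ge0.
have eZ k (w : 'cV[C]_k) : enorm ((enorm u)^-1%:C *: w) = (enorm u)^-1 * enorm w.
  by rewrite enormZ normc_real ger0_norm.
apply: (@le_trans _ _ (enorm (D *m ((enorm u)^-1%:C *: u)))%:E).
  apply: ereal_inf_lbound; exists ((enorm u)^-1%:C *: u) => //=.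
  by rewrite eZ mulVf.
by rewrite lee_fin -scalemxAr eZ mulrC ler_pdivrMr.
Qed.

Lemma nu_approx m n (D : 'M[C]_(m, n)) (mu e : R) : (nu D <= mu%:E)%E -> 0 < e ->
  exists2 u, enorm u = 1 & enorm (D *m u) < mu + e.
Proof.
move=> Dmu e0; have : (nu D < (mu + e)%:E)%E.
  by apply: le_lt_trans Dmu _; rewrite lte_fin ltrDl.
by move=> /ereal_inf_lt[_ [u u1 <-]]; rewrite lte_fin => ue; exists u.
Qed.

End Tridiagonal.

(** * Weights and their Rayleigh quotient *)

Section Weights.
Context {R : realType}.

(* $w_j = j (N - j) (N^2 + j (N - j))$, an approximation of the optimal weights
   $\sin(\pi j / N)$ that is good enough for 22/7 in place of $\pi$. *)
Definition weight (N j : R) : R := j ^+ 4 - 2 * j ^+ 3 * N + j * N ^+ 3.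

(** The limit [k] and [N] are kept apart so that induction on [k] applies. Only [k = N] is used,
    where the right-hand side collapses to [N * (31 * N ^+ 8 - 10 * N ^+ 2 - 21)]. *)
Lemma sum_weight_sqr (N : R) (k : nat) (m := k%:R : R) :
  630 * (\sum_(j < k) weight N j%:R ^+ 2) =
    70 * m ^+ 9 - 315 * m ^+ 8 * N - 315 * m ^+ 8 + 360 * m ^+ 7 * N ^+ 2 +
    1260 * m ^+ 7 * N + 420 * m ^+ 7 + 210 * m ^+ 6 * N ^+ 3 - 1260 * m ^+ 6
    * N ^+ 2 - 1470 * m ^+ 6 * N - 504 * m ^+ 5 * N ^+ 4 - 630 * m ^+ 5 * N
    ^+ 3 + 1260 * m ^+ 5 * N ^+ 2 - 294 * m ^+ 5 + 1260 * m ^+ 4 * N ^+ 4 +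
    525 * m ^+ 4 * N ^+ 3 + 735 * m ^+ 4 * N + 210 * m ^+ 3 * N ^+ 6 - 840 *
    m ^+ 3 * N ^+ 4 - 420 * m ^+ 3 * N ^+ 2 + 140 * m ^+ 3 - 315 * m ^+ 2 *
    N ^+ 6 - 105 * m ^+ 2 * N ^+ 3 - 210 * m ^+ 2 * N + 105 * m * N ^+ 6 +
    84 * m * N ^+ 4 + 60 * m * N ^+ 2 - 21 * m.
Proof.
rewrite {}/m; elim: k => [|k IH]; first by rewrite big_ord0; ring.
rewrite big_ord_recr /= mulrDr IH /weight -[k.+1%:R]natr1; move: (k%:R : R) => m; ring.
Qed.

Lemma sum_weight_diff_sqr (N : R) (k : nat) (m := k%:R : R) :
  105 * (\sum_(j < k) (weight N j.+1%:R - weight N j%:R) ^+ 2) =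
    240 * m ^+ 7 - 840 * m ^+ 6 * N + 756 * m ^+ 5 * N ^+ 2 - 252 * m ^+ 5 +
    210 * m ^+ 4 * N ^+ 3 + 630 * m ^+ 4 * N - 420 * m ^+ 3 * N ^+ 4 - 420 *
    m ^+ 3 * N ^+ 2 + 140 * m ^+ 3 - 210 * m ^+ 2 * N + 105 * m * N ^+ 6 +
    84 * m * N ^+ 2 - 23 * m.
Proof.
rewrite {}/m; elim: k => [|k IH]; first by rewrite big_ord0; ring.
rewrite big_ord_recr /= mulrDr IH /weight -[k.+1%:R]natr1; move: (k%:R : R) => m; ring.
Qed.

(** Asymptotically the quotient times [N ^+ 2] is [306 / 31], just below [(22 / 7) ^+ 2] and just
    above the square of pi. The margin shows in the leading coefficient
    [10 = 484 * 31 - 6 * 49 * 51]. *)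
Lemma weight_ratio (n : nat) (N := n.+1%:R : R) :
  \sum_(j < n.+1) (weight N j.+1%:R - weight N j%:R) ^+ 2 <=
  (22 / (7 * N)) ^+ 2 * \sum_(j < n.+1) weight N j%:R ^+ 2.
Proof.
have hS := sum_weight_sqr N n.+1; have hD := sum_weight_diff_sqr N n.+1.
move: hS hD; rewrite -/N.
have N1 : 1 <= N by rewrite /N ler1n.
move: (\sum_(j < n.+1) weight N j%:R ^+ 2) (\sum_(j < n.+1) (_ - _) ^+ 2) => S D.
move: N N1 => N N1 hS hD.
have {}hS : 630 * S = N * (31 * (N ^+ 2) ^+ 4 - 10 * N ^+ 2 - 21) by rewrite hS; ring.
have {}hD : 105 * D = N * (51 * (N ^+ 2) ^+ 3 - 42 * (N ^+ 2) ^+ 2 + 14 * N ^+ 2 - 23).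
  by rewrite hD; ring.
have N0 : 0 < N by apply: lt_le_trans N1.
rewrite exprMn exprVn exprMn mulrAC ler_pdivlMr; last by rewrite mulr_gt0 ?exprn_gt0.
(* Expanded at [N ^+ 2 = 1], the polynomial to be shown nonnegative has nonnegative coefficients
   only. *)
have [t t0 Nt] : exists2 t, 0 <= t & N ^+ 2 = 1 + t.
  by exists (N ^+ 2 - 1); [rewrite subr_ge0 exprn_ege1|rewrite addrC subrK].
rewrite Nt in hS hD *.
have hu : 0 <= N * (10 * t ^+ 4 + 76 * 163 * t ^+ 3 + 12 * 2749 * t ^+ 2 + 138 * 223 * t).
  apply: mulr_ge0; first exact: ltW.
  have := exprn_ge0 4 t0; have := exprn_ge0 3 t0; have := exprn_ge0 2 t0.
  move: (t ^+ 4) (t ^+ 3) (t ^+ 2) => a b c; clear -t0; lra.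
have hE : N * (10 * t ^+ 4 + 76 * 163 * t ^+ 3 + 12 * 2749 * t ^+ 2 + 138 * 223 * t) =
    484 * (630 * S) - 6 * 49 * (1 + t) * (105 * D) by rewrite hS hD; ring.
have {hu}hE : 0 <= 630 * (484 * S - 49 * (D * (1 + t))).
  by rewrite (le_trans hu)// hE le_eqVlt; apply/orP; left; apply/eqP; ring.
have p630 : 0 < 630 :> R by lra.
have {}hE : 0 <= 484 * S - 49 * (D * (1 + t)) by rewrite -(pmulr_rge0 _ p630).
rewrite -subr_ge0 (le_trans hE)// le_eqVlt; apply/orP; left; apply/eqP.
move: S D t {hS hD Nt t0 hE} => S D t; clear; ring.
Qed.

Lemma weight1_neq0 (n : nat) : (0 < n)%N -> weight (n.+1%:R : R) 1 != 0.
Proof.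
move=> n0; have n1 : 1 <= n%:R :> R by rewrite ler1n.
have -> : weight (n.+1%:R : R) 1 = n%:R * (n%:R ^+ 2 + 3 * n%:R + 1).
  by rewrite /weight -[n.+1%:R]natr1; ring.
by rewrite gt_eqF// mulr_gt0 ?ltr0n// !addr_gt0// ?mulr_gt0 ?exprn_gt0 ?ltr0n.
Qed.

End Weights.

(** * Localization of approximate eigenvectors *)

Section WindowLemma.
Context {R : realType}.
Local Notation C := R[i].

(* Weighted Cauchy-Schwarz, used with [p1], [p2], [p3] slightly larger than the three
   expected norms, in place of the triangle inequality in l2. *)
Lemma sqr_three_le (A B D p1 p2 p3 : R) : 0 < p1 -> 0 < p2 -> 0 < p3 ->
  (A + B + D) ^+ 2 <= (p1 + p2 + p3) * (A ^+ 2 / p1 + B ^+ 2 / p2 + D ^+ 2 / p3).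
Proof.
move=> p10 p20 p30.
have [a ->] : exists a, A = p1 * a by exists (A / p1); rewrite mulrC divfK ?gt_eqF.
have [b ->] : exists b, B = p2 * b by exists (B / p2); rewrite mulrC divfK ?gt_eqF.
have [d ->] : exists d, D = p3 * d by exists (D / p3); rewrite mulrC divfK ?gt_eqF.
have e (q x : R) : 0 < q -> (q * x) ^+ 2 / q = q * x ^+ 2.
  by move=> q0; field; rewrite gt_eqF.
rewrite !e// -subr_ge0.
have -> : (p1 + p2 + p3) * (p1 * a ^+ 2 + p2 * b ^+ 2 + p3 * d ^+ 2) -
  (p1 * a + p2 * b + p3 * d) ^+ 2 = p1 * p2 * (a - b) ^+ 2 +
  p1 * p3 * (a - d) ^+ 2 + p2 * p3 * (b - d) ^+ 2 by ring.
by rewrite !addr_ge0// mulr_ge0 ?sqr_ge0// mulr_ge0// ltW.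
Qed.

Lemma sqnorm_three_le p (u v w : 'cV[C]_p) (p1 p2 p3 : R) :
  0 < p1 -> 0 < p2 -> 0 < p3 ->
  sqnorm (u + v + w) <=
    (p1 + p2 + p3) * (sqnorm u / p1 + sqnorm v / p2 + sqnorm w / p3).
Proof.
move=> p10 p20 p30; rewrite -!enorm_sqr.
apply: le_trans (sqr_three_le _ _ _ p10 p20 p30).
rewrite ler_sqr ?nnegrE ?addr_ge0 ?enorm_ge0//.
by rewrite (le_trans (enormD _ _))// lerD2r enormD.
Qed.

Lemma asum_lin3 (q1 q2 q3 : R) (f1 f2 f3 : int -> R) : abs_summable f1 -> abs_summable f2 -> abs_summable f3 ->
  asum (fun k => q1 * f1 k + q2 * f2 k + q3 * f3 k) =
  q1 * asum f1 + q2 * asum f2 + q3 * asum f3.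
Proof.
move=> s1 s2 s3; have z1 := smZ q1 s1; have z2 := smZ q2 s2; have z3 := smZ q3 s3.
by rewrite (asumD (smD z1 z2) z3) (asumD z1 z2) (asumZ q1 s1) (asumZ q2 s2) (asumZ q3 s3).
Qed.

(** Extension by 0 gives a meaning to the neighbour differences at both ends of a window. *)
Definition zweight (n : nat) (z : int) : R :=
  if (0 <= z <= n.+1%:Z) then weight n.+1%:R z%:~R else 0.

Lemma zweight_nat n (j : nat) : (j <= n.+1)%N -> zweight n j%:Z = weight n.+1%:R j%:R.
Proof. by move=> jn; rewrite /zweight ifT//; lia. Qed.

Lemma zweight0 n : zweight n 0 = 0.
Proof. by rewrite (zweight_nat (leq0n n.+1)) /weight; ring. Qed.

Lemma zweight_last n : zweight n n.+1%:Z = 0.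
Proof. by rewrite zweight_nat// /weight; ring. Qed.

Lemma zweight_out n z : ~~ (0 < z < n.+1%:Z) -> zweight n z = 0.
Proof.
move=> zn; have [->|z0] := eqVneq z 0; first exact: zweight0.
have [->|z1] := eqVneq z n.+1%:Z; first exact: zweight_last.
by rewrite /zweight ifN//; move: zn z0 z1; lia.
Qed.

Lemma sum_zweight_sqr n :
  \sum_(i < n.+2) zweight n i%:Z ^+ 2 = \sum_(j < n.+1) weight n.+1%:R j%:R ^+ 2 :> R.
Proof.
rewrite big_ord_recr /= zweight_last expr0n addr0.
by apply: eq_bigr => j _; rewrite zweight_nat// ltnW.
Qed.

Lemma sum_zweight_left n :
  \sum_(i < n.+2) (zweight n (i%:Z - 1) - zweight n i%:Z) ^+ 2 =
  \sum_(j < n.+1) (weight n.+1%:R j.+1%:R - weight n.+1%:R j%:R) ^+ 2 :> R.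
Proof.
rewrite big_ord_recl /= zweight0 zweight_out// subr0 expr0n add0r.
apply: eq_bigr => j _; rewrite /= -[LHS]sqrrN opprB.
have -> : (lift ord0 j)%:Z - 1 = j%:Z by rewrite /= /bump; lia.
by rewrite !zweight_nat//=; rewrite ?(ltn_ord j) // ltnW.
Qed.

Lemma sum_zweight_right n :
  \sum_(i < n.+2) (zweight n (i%:Z + 1) - zweight n i%:Z) ^+ 2 =
  \sum_(j < n.+1) (weight n.+1%:R j.+1%:R - weight n.+1%:R j%:R) ^+ 2 :> R.
Proof.
rewrite big_ord_recr /= zweight_last zweight_out ?subr0 ?expr0n ?addr0; last by lia.
apply: eq_bigr => j _.
have -> : j%:Z + 1 = j.+1%:Z by lia.
by rewrite !zweight_nat ?(ltn_ord j)// ltnW.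
Qed.

Variable p : nat.
Implicit Types (B : op R p) (x y : l2 R p).

(** The weights with indices [1, ..., n] sit on the columns [k + 1, ..., k + n]; the vanishing
    weights with indices [0] and [n + 1] fall on the two extra rows. *)
Lemma pad_zweight n k x (i : int) :
  pad k (fun j : 'I_n => (zweight n (j.+1)%:Z)%:C *: x (k + 1 + j%:Z)) i =
  (zweight n (i - k))%:C *: x i.
Proof.
have [/andP[h1 h2]|out] := boolP (0 < i - k < n.+1%:Z).
  have jn : (`|i - k|.-1 < n)%N by lia.
  have iE : i = k + 1 + (Ordinal jn : nat)%:Z by rewrite /=; lia.
  rewrite {1}iE padE -iE; congr ((zweight n _)%:C *: _); rewrite /=; lia.
rewrite zweight_out// scale0r pad_out// => j; apply/eqP => ij.
by move/negP: out; apply; have := ltn_ord j; lia.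
Qed.

(** The contradiction is between totals over all [k]: shift invariance turns each term into a full
    l2 norm, multiplied by the sum of the squared weights or weight differences. *)
Lemma window_estimate B lambda x n (a c theta e : R) : tridiagonal B -> (0 < n)%N ->
  (forall i (v : 'cV[C]_p), enorm (mx_of B i (i - 1) *m v) <= a * enorm v) ->
  (forall i (v : 'cV[C]_p), enorm (mx_of B i (i + 1) *m v) <= c * enorm v) ->
  0 <= a -> 0 <= c -> 0 <= theta -> 0 < e ->
  x != 0 -> l2norm (B x - lambda *: x) <= theta * l2norm x ->
  exists k (v : 'I_n -> 'cV[C]_p), pad k v != 0 /\
    l2norm (B (pad k v) - lambda *: pad k v) <=
    (theta + (a + c) * (22 / (7 * n.+1%:R)) + 3 * e) * l2norm (pad k v).
Proof.
move=> Btri n0 Ba Bc a0 c0 th0 e0 x0 xth.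
set rho := 22 / (7 * n.+1%:R).
have rho0 : 0 <= rho by rewrite /rho divr_ge0// mulr_ge0.
(* These are the shares of the residual and of the two off-diagonal commutator terms; [e] keeps them
   positive when [theta], [a] or [c] vanishes. *)
pose p1 := theta + e; pose p2 := a * rho + e; pose p3 := c * rho + e.
have p10 : 0 < p1 by rewrite ltr_wpDl.
have p20 : 0 < p2 by rewrite ltr_wpDl// mulr_ge0.
have p30 : 0 < p3 by rewrite ltr_wpDl// mulr_ge0.
pose P := p1 + p2 + p3; have P0 : 0 < P := addr_gt0 (addr_gt0 p10 p20) p30.
have -> : theta + (a + c) * rho + 3 * e = P by rewrite /P /p1 /p2 /p3; ring.
pose W (i : 'I_n.+2) : R := zweight n i%:Z.
pose dl (i : 'I_n.+2) : R := zweight n (i%:Z - 1) - zweight n i%:Z.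
pose dr (i : 'I_n.+2) : R := zweight n (i%:Z + 1) - zweight n i%:Z.
pose s := \sum_i W i ^+ 2.
have s0 : 0 < s.
  have n2 : (1 < n.+2)%N by [].
  rewrite /s (bigD1 (Ordinal n2))//= ltr_wpDr ?sumr_ge0//.
    by move=> i _; exact: sqr_ge0.
  by rewrite exprn_even_gt0//= /W zweight_nat//; exact: weight1_neq0.
have dls : \sum_i dl i ^+ 2 <= rho ^+ 2 * s.
  by rewrite /dl /s /W sum_zweight_left sum_zweight_sqr; exact: weight_ratio.
have drs : \sum_i dr i ^+ 2 <= rho ^+ 2 * s.
  by rewrite /dr /s /W sum_zweight_right sum_zweight_sqr; exact: weight_ratio.
pose d := B x - lambda *: x.
pose X := dot x x; have X0 : 0 < X by rewrite /X -l2norm_sqr exprn_gt0// l2norm_gt0.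
have dX : dot d d <= theta ^+ 2 * X.
  by rewrite /X -!l2norm_sqr -exprMn ler_sqr ?nnegrE ?mulr_ge0 ?l2norm_ge0.
pose v k := fun j : 'I_n => (zweight n (j.+1)%:Z)%:C *: x (k + 1 + j%:Z).
pose y k := pad k (v k).
have yE k i : y k i = (zweight n (i - k))%:C *: x i by exact: pad_zweight.
have yk k (i : 'I_n.+2) : y k (k + i%:Z) = (W i)%:C *: x (k + i%:Z).
  by rewrite yE /W [k + _]addrC addrK.
pose G (k : int) := \sum_(i < n.+2) P * (W i ^+ 2 * sqnorm (d (k + i%:Z)) / p1 +
   dl i ^+ 2 * (a ^+ 2 * sqnorm (x (k + (i%:Z - 1)))) / p2 +
   dr i ^+ 2 * (c ^+ 2 * sqnorm (x (k + (i%:Z + 1)))) / p3).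
have sqa i (u : 'cV[C]_p) : sqnorm (mx_of B i (i - 1) *m u) <= a ^+ 2 * sqnorm u.
  by rewrite -!enorm_sqr -exprMn ler_sqr ?nnegrE ?mulr_ge0 ?enorm_ge0.
have sqc i (u : 'cV[C]_p) : sqnorm (mx_of B i (i + 1) *m u) <= c ^+ 2 * sqnorm u.
  by rewrite -!enorm_sqr -exprMn ler_sqr ?nnegrE ?mulr_ge0 ?enorm_ge0.
have sqR (r : R) (u : 'cV[C]_p) : sqnorm (r%:C *: u) = r ^+ 2 * sqnorm u.
  by rewrite sqnormZ normc_real real_normK ?num_real.
have EG k : l2norm (B (y k) - lambda *: y k) ^+ 2 <= G k.
  rewrite l2norm_tri_pad//; apply: ler_sum => i _.
  set m := k + i%:Z.
  (* The diagonal part commutes with the weights. Replacing the weights at [m - 1] and [m + 1] by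
     the one at [m] leaves the differences [dl] and [dr]. *)
  have -> : (B (y k) - lambda *: y k) m = (W i)%:C *: d m +
      (dl i)%:C *: (mx_of B m (m - 1) *m x (m - 1)) +
      (dr i)%:C *: (mx_of B m (m + 1) *m x (m + 1)).
    rewrite /d !l2BE !l2ZE !tridiagonal_apply// yk -/m !yE.
    have -> : m - 1 - k = i%:Z - 1 by rewrite /m addrAC [k + _]addrC addrK.
    have -> : m + 1 - k = i%:Z + 1 by rewrite /m addrAC [k + _]addrC addrK.
    rewrite -!scalemxAr /dl /dr -/(W i) !rmorphB /=.
    move: (_ *m x (m - 1)) (_ *m x m) (_ *m x (m + 1)) => u1 u2 u3.
    move: (W i)%:C (zweight n (i%:Z - 1))%:C (zweight n (i%:Z + 1))%:C => q q1 q2.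
    by apply/matrixP => r j; rewrite !mxE; ring.
  apply: le_trans (sqnorm_three_le _ _ _ p10 p20 p30) _; rewrite ler_pM2l//.
  rewrite !sqR !lerD// ler_pM2r ?invr_gt0// ler_wpM2l ?sqr_ge0//.
    have -> : k + (i%:Z - 1) = m - 1 by rewrite /m addrA.
    exact: sqa.
  have -> : k + (i%:Z + 1) = m + 1 by rewrite /m addrA.
  exact: sqc.
have shift (z : l2 R p) (j : int) : abs_summable (fun k => sqnorm (z (k + j))) /\
    asum (fun k => sqnorm (z (k + j))) = dot z z.
  split; first exact: (sm_shift _ (sm_sqnorm z)).
  by rewrite (asum_shift j (sm_sqnorm z)) dotxxE.
pose g (i : 'I_n.+2) (k : int) := P * (W i ^+ 2 * sqnorm (d (k + i%:Z)) / p1 +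
   dl i ^+ 2 * (a ^+ 2 * sqnorm (x (k + (i%:Z - 1)))) / p2 +
   dr i ^+ 2 * (c ^+ 2 * sqnorm (x (k + (i%:Z + 1)))) / p3).
have gE i : g i = fun k => P * (W i ^+ 2 / p1) * sqnorm (d (k + i%:Z)) +
    P * (dl i ^+ 2 * a ^+ 2 / p2) * sqnorm (x (k + (i%:Z - 1))) +
    P * (dr i ^+ 2 * c ^+ 2 / p3) * sqnorm (x (k + (i%:Z + 1))).
  by apply/funext => k; rewrite /g; ring.
have sg i : abs_summable (g i).
  by rewrite gE; apply: smD; [apply: smD|]; apply: smZ; exact: (shift _ _).1.
have ag i : asum (g i) = P * (W i ^+ 2 / p1) * dot d d +
    P * (dl i ^+ 2 * a ^+ 2 / p2) * X + P * (dr i ^+ 2 * c ^+ 2 / p3) * X.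
  by rewrite gE asum_lin3 ?(shift _ _).2//; exact: (shift _ _).1.
have aG : asum G = P * (s * dot d d / p1 + (\sum_i dl i ^+ 2) * (a ^+ 2 * X) / p2 +
    (\sum_i dr i ^+ 2) * (c ^+ 2 * X) / p3).
  rewrite /G (asum_sum _ sg) /s !mulr_suml -!big_split /= mulr_sumr.
  by apply: eq_bigr => i _; rewrite ag; ring.
have aGlt : asum G < P ^+ 2 * (s * X).
  have -> : P ^+ 2 * (s * X) = P * (P * (s * X)) by rewrite expr2 -mulrA.
  rewrite aG (ltr_pM2l P0).
  have sX : 0 < s * X by rewrite mulr_gt0.
  (* Strictness comes from this term alone, as [theta < p1] and [0 < s * X]. *)
  have b1 : s * dot d d / p1 < p1 * (s * X).
    rewrite ltr_pdivrMr//; apply: (@le_lt_trans _ _ (theta ^+ 2 * (s * X))).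
      by rewrite mulrCA ler_pM2l.
    have -> : p1 * (s * X) * p1 = p1 ^+ 2 * (s * X) by ring.
    rewrite ltr_pM2r// ltr_sqr ?nnegrE// ?(ltW p10)//.
    by rewrite /p1 ltrDl.
  have bb (D q b : R) : 0 < q -> 0 <= b -> b * rho <= q -> D <= rho ^+ 2 * s ->
      D * (b ^+ 2 * X) / q <= q * (s * X).
    move=> q0 b0 bq Ds; rewrite ler_pdivrMr//.
    apply: (@le_trans _ _ (rho ^+ 2 * s * (b ^+ 2 * X))).
      by rewrite ler_wpM2r// mulr_ge0 ?sqr_ge0// ltW.
    have -> : rho ^+ 2 * s * (b ^+ 2 * X) = (b * rho) ^+ 2 * (s * X) by ring.
    have -> : q * (s * X) * q = q ^+ 2 * (s * X) by ring.
    by rewrite ler_pM2r// ler_sqr ?nnegrE ?mulr_ge0// ltW.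
  have b2 := bb _ p2 a p20 a0 _ dls; have b3 := bb _ p3 c p30 c0 _ drs.
  rewrite /P (mulrDl (p1 + p2) p3) (mulrDl p1 p2); apply: ltr_leD; first apply: ltr_leD => //.
    by apply: b2; rewrite /p2 lerDl ltW.
  by apply: b3; rewrite /p3 lerDl ltW.
pose h (i : 'I_n.+2) (k : int) := W i ^+ 2 * sqnorm (x (k + i%:Z)).
have yh k : l2norm (y k) ^+ 2 = \sum_(i < n.+2) h i k.
  rewrite l2norm_sqr dotxxE (@asum_range _ _ k n.+2).
    by apply: eq_bigr => i _; rewrite yk sqR.
  move=> i ik; rewrite yE zweight_out ?scale0r ?sqnorm0//.
  apply: contra ik; clear; lia.
have sh i : abs_summable (h i) by apply: smZ; exact: (shift _ _).1.
have ah : asum (fun k => l2norm (y k) ^+ 2) = s * X.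
  have -> : (fun k => l2norm (y k) ^+ 2) = (fun k => \sum_(i < n.+2) h i k).
    by apply/funext => k; rewrite yh.
  rewrite (asum_sum _ sh) /s mulr_suml; apply: eq_bigr => i _.
  by rewrite /h asumZ ?(shift _ _).2//; exact: (shift _ _).1.
apply: contrapT => hno.
have Gy k : P ^+ 2 * l2norm (y k) ^+ 2 <= G k.
  have G0 : 0 <= G k by rewrite (le_trans _ (EG k))// sqr_ge0.
  (* A vanishing [y k] is excluded as a witness, but satisfies the inequality trivially. *)
  have [yk0|yk0] := eqVneq (y k) 0; first by rewrite yk0 l2norm0 expr0n mulr0.
  apply: le_trans (EG k); rewrite -exprMn.
  have Py : 0 <= P * l2norm (y k) by rewrite mulr_ge0 ?l2norm_ge0// ltW.
  rewrite ler_sqr ?nnegrE ?l2norm_ge0// leNgt; apply/negP => /ltW hk.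
  by apply: hno; exists k, (v k).
have : P ^+ 2 * (s * X) <= asum G.
  rewrite -ah -asumZ.
    apply: le_asum => //; last exact: sm_sum.
    apply: smZ; have := sm_sum (index_enum _) sh.
    by congr abs_summable; apply/funext => k; rewrite yh.
  have := sm_sum (index_enum _) sh.
  by congr abs_summable; apply/funext => k; rewrite yh.
by rewrite leNgt aGlt.
Qed.

End WindowLemma.

(** * Transposition and grouping *)

Section Transposition.
Context {R : realType}.
Local Notation C := R[i].
Local Notation Re := (@complex.Re R).
Local Notation Im := (@complex.Im R).

Definition vconj n (v : 'cV[C]_n) : 'cV[C]_n := \col_r (conjc (v r 0)).

Lemma sqnorm_vconj n (v : 'cV[C]_n) : sqnorm (vconj v) = sqnorm v.
Proof. by apply: eq_bigr => r _; rewrite mxE normc_conjc. Qed.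

Lemma vconjK n (v : 'cV[C]_n) : vconj (vconj v) = v.
Proof. by apply/matrixP => r c; rewrite !mxE ord1 conjc_conjc. Qed.

Lemma enorm_tr m n (N : 'M[C]_(m, n)) (a : R) : 0 <= a ->
  (forall v, enorm (N *m v) <= a * enorm v) ->
  forall v, enorm (N^T *m v) <= a * enorm v.
Proof.
move=> a0 Na v.
(* $N^T v$ is the conjugate of $u := N^* \bar v$ *)
pose u := vconj (N^T *m v).
have uE : enorm u = enorm (N^T *m v) by rewrite /enorm sqnorm_vconj.
have dotE : sqnorm u = pdot (N *m u) (vconj v).
  rewrite sqnormE /pdot.
  have h (w : 'cV[C]_n) (z : 'cV[C]_m) :
      pdot w (vconj (N^T *m z)) = pdot (N *m w) (vconj z).
    have rh k (p q : 'cV[C]_k) : pdot p (vconj q) = Re (\sum_r p r 0 * q r 0).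
      rewrite (big_morph Re cReD (erefl : Re 0 = 0)); apply: eq_bigr => r _.
      by rewrite !mxE cReM; case: (q r 0) => a' b' /=; ring.
    rewrite !rh; congr Re.
    under eq_bigr do rewrite mxE mulr_sumr.
    under [RHS]eq_bigr do rewrite mxE mulr_suml.
    rewrite exchange_big; apply: eq_bigr => i _; apply: eq_bigr => j _.
    by rewrite mxE; ring.
  exact: h.
rewrite -uE; have [u0|u0] := eqVneq (enorm u) 0.
  by rewrite u0 mulr_ge0 ?enorm_ge0.
have nu : 0 < enorm u by rewrite lt_def u0 enorm_ge0.
rewrite -(ler_pM2l nu) -expr2 enorm_sqr dotE.
rewrite (le_trans (ler_norm _))// (le_trans (pdot_norm _ _))//.
have -> : enorm (vconj v) = enorm v by rewrite /enorm sqnorm_vconj.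
by rewrite mulrCA mulrA ler_wpM2r ?enorm_ge0// [leRHS]mulrC mulrC.
Qed.

Section Conj.
Variable p : nat.
Implicit Types (x y : l2 R p) (S B : op R p).

Lemma cj_subproof x : (fun i => vconj (x i)) \in @sqsummable R p.
Proof.
apply: sm_l2; have := sm_sqnorm x; congr abs_summable; apply/funext => i.
by rewrite sqnorm_vconj.
Qed.

Definition cj x : l2 R p := L2 (cj_subproof x).

Lemma cjK : involutive cj.
Proof. by move=> x; apply: l2_ext => i; rewrite /= vconjK. Qed.

Lemma l2norm_cj x : l2norm (cj x) = l2norm x.
Proof.
by rewrite !l2normE !dotxxE; congr (Num.sqrt (asum _)); apply/funext => i; rewrite sqnorm_vconj.
Qed.

Lemma cjZD (a : C) x y : cj (a *: x + y) = (conjc a) *: cj x + cj y.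
Proof.
apply: l2_ext => i; apply/matrixP => r c; rewrite !mxE.
by case: a => ? ?; case: (x i _ _) => ? ?; case: (y i _ _) => ? ?; apply: complex_eq => /=; ring.
Qed.

Lemma conjop_linear S : linear (fun x => cj (S (cj x))).
Proof. by move=> a x y; rewrite cjZD linearP cjZD conjc_conjc. Qed.

(** For [S] adjoint to [B] this is the operator behind the matrix [bitr (mx_of B)]: the two
    conjugations undo the one contained in the adjoint. *)
Definition conjop S : op R p := linop (conjop_linear S).

Lemma l2norm_conjop_sub S lambda x :
  l2norm (conjop S (cj x) - lambda *: cj x) = l2norm (S x - (conjc lambda) *: x).
Proof.
have -> : conjop S (cj x) = cj (S x) by rewrite /= cjK.
rewrite -[LHS]l2norm_cj; congr l2norm.
rewrite -scaleNr addrC cjZD !cjK addrC -scaleNr; congr (_ + _ *: _).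
by case: (lambda) => ? ?; apply: complex_eq => /=; ring.
Qed.

Lemma conjop_bound S M : opbound S M -> opbound (conjop S) M.
Proof. by move=> SM x; rewrite /= l2norm_cj (le_trans (SM _))// l2norm_cj. Qed.

Lemma conjc_bool (b : bool) : conjc (b%:R : C) = b%:R.
Proof. by case: b; apply: complex_eq => //=; exact: oppr0. Qed.

Lemma mx_of_conjop B S : adjoint B S -> mx_of (conjop S) = bitr (mx_of B).
Proof.
move=> BS; apply/funext => i; apply/funext => j; apply/matrixP => r c.
rewrite /bitr /mx_of !mxE /=.
have -> : cj (l2_delta j (delta_mx c 0)) = l2_delta j (delta_mx c 0).
  apply: l2_ext => k /=; case: eqP => _; apply/matrixP => s t; rewrite !mxE ?ord1.
    exact: (conjc_bool ((s == c) && true)).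
  exact: (conjc_bool false).
set z := S _; set w := B _.
(* The real part is tested with 1 and the imaginary part with [i]; the sign in [e2] is the
   conjugation that [cj] removes. *)
have e1 : Re (z i r 0) = Re (w j c 0).
  have := BS (l2_delta i (1 *: delta_mx r 0)) (l2_delta j (1 *: delta_mx c 0)).
  rewrite dot_delta [in RHS]dotC dot_delta !scale1r -/z -/w.
  rewrite -[delta_mx c 0]scale1r -[delta_mx r 0]scale1r !(pdotC _ (1 *: _)) !pdot_deltal /=.
  by rewrite !mul1r !mul0r !addr0.
have e2 : Im (z i r 0) = - Im (w j c 0).
  have := BS (l2_delta i ((0 +i* 1) *: delta_mx r 0)) (l2_delta j (1 *: delta_mx c 0)).
  rewrite dot_delta [in RHS]dotC dot_delta l2_deltaZ linearZ l2ZE !scale1r -/z -/w pdotZl.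
  rewrite [X in _ = X](pdotC _ _) -[delta_mx c 0]scale1r pdot_deltal.
  rewrite (pdotC (w j)) scalerA pdot_deltal /=.
  by move: (Im (z i r 0)) (Re (z i r 0)) (Im (w j c 0)) (Re (w j c 0)) => ? ? ? ?; clear; lra.
apply: complex_eq; first by rewrite -e1; case: (z i r 0).
by rewrite -[RHS]opprK -e2; case: (z i r 0).
Qed.

End Conj.
End Transposition.

Section GroupingIsometry.
Context {R : realType}.
Local Notation C := R[i].

(** The sum is split by residue classes: [F r] lives on the positions [m] with [m - 1] congruent to
    [r] modulo [p], which [group_inj] parametrizes by the block index. *)
Lemma sqsum_ungroup p (y : l2 R p) : sqsum (ungroup y) = sqsum y.
Proof.
pose F (r : 'I_p) (m : int) : R :=
  if `|((m - 1) %% p%:Z)%Z|%N == r then normc (y ((m - 1) %/ p%:Z)%Z r 0) ^+ 2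
  else 0.
have F0 r m : 0 <= F r m by rewrite /F; case: ifP => // _; exact: sqr_ge0.
have FE m : sqnorm (ungroup y m) = \sum_(r < p) F r m.
  rewrite /sqnorm big_ord1 mxE /F.
  case: insubP => [s _ sE|ps].
    rewrite (bigD1 s)//= sE eqxx big1 ?addr0// => r rs.
    by case: eqP => // rE; move: rs; rewrite -val_eqE /= sE rE eqxx.
  rewrite normc0 expr0n big1// => r _; case: eqP => // rE.
  by move: ps; rewrite rE ltn_ord.
rewrite /sqsum; under eq_esum do rewrite FE -sumEFin.
rewrite esum_sum; last by move=> i r _ _; rewrite lee_fin.
transitivity (\sum_(r < p) \esum_(i in [set: int]) (normc (y i r 0) ^+ 2)%:E)%E.
  apply: eq_bigr => r _.
  have -> : (\esum_(m in [set: int]) (F r m)%:E =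
      \esum_(m in (fun i : int => (p%:Z * i + r%:Z + 1)%R) @` [set: int])
        (F r m)%:E)%E.
    rewrite esum_mkcond [RHS]esum_mkcond; apply: eq_esum => m _.
    rewrite in_setT; case: ifPn => // /negP mr; rewrite /F.
    case: eqP => // rE; exfalso; apply: mr; rewrite inE.
    exists ((m - 1) %/ p%:Z)%Z => //.
    have p0 : p%:Z != 0.
      by have := leq_ltn_trans (leq0n r) (ltn_ord r); rewrite lt0n.
    by rewrite -rE gez0_abs ?modz_ge0// mulrC -divz_eq subrK.
  rewrite esum_image; last by move=> x z _ _; exact: group_inj.
  by apply: eq_esum => i _; rewrite /F !group_index eqxx.
rewrite -esum_sum; last by move=> i r _ _; rewrite lee_fin sqr_ge0.
by apply: eq_esum => i _; rewrite sumEFin.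
Qed.

Lemma l2norm_ungroup p (y : l2 R p) : l2norm (ungroup y) = l2norm y.
Proof. by rewrite /l2norm sqsum_ungroup. Qed.

Lemma l2norm_group p (x : l2 R 1) : (0 < p)%N -> l2norm (group p x) = l2norm x.
Proof. by move=> p0; rewrite -[in RHS](groupK p0 x) l2norm_ungroup. Qed.

Lemma dot_polar p (x y : l2 R p) :
  dot x y = (l2norm (x + y) ^+ 2 - l2norm (x - y) ^+ 2) / 4.
Proof.
rewrite !l2norm_sqr dotBl !dotBr dotDl !dotDr (dotC y x).
by move: (dot x y) (dot x x) (dot y y) => ? ? ?; clear; field.
Qed.

Lemma dot_ungroup p (x y : l2 R p) : dot (ungroup x) (ungroup y) = dot x y.
Proof. by rewrite !dot_polar -linearB -linearD !l2norm_ungroup. Qed.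

Lemma adjoint_group p (F S : op R 1) : (0 < p)%N -> adjoint F S ->
  adjoint ((@group R p \o F \o @ungroup R p) : op R p)
    ((@group R p \o S \o @ungroup R p) : op R p).
Proof.
move=> p0 FS x y /=.
by rewrite -!(dot_ungroup (group _ _)) -(dot_ungroup x) !(groupK p0) FS.
Qed.

(* This also holds if no bounded operator has the matrix [fejer_mx], as [op_of] is
   then 0. *)
Lemma fejer_bounded_banded (A : op R 1) n :
  bounded_op (fejer A n) /\ banded (fejer A n) n.
Proof.
rewrite /fejer /op_of; case: pselect => [h|_].
  case: cid => T /= [bT TE]; split => // i j ij.
  by rewrite TE /fejer_mx leqNgt ij.
split.
  by apply: (@opbound_bounded _ _ _ 0) => x /=; rewrite l2norm0 mul0r.
move=> i j _; apply/matrixP => r c; by rewrite !mxE /= ?mxE.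
Qed.

Lemma ungroup_delta p (j : int) (v : 'cV[C]_p) : (0 < p)%N ->
  ungroup (l2_delta j v) =
  \sum_(s < p) l2_delta (p%:Z * j + s%:Z + 1) (const_mx (v s 0) : 'cV[C]_1).
Proof.
move=> p0; apply: (can_inj (groupK p0)); rewrite (ungroupK p0).
apply: l2_ext => i; apply/matrixP => r c; rewrite ord1 mxE l2_sumE summxE /=.
rewrite (bigD1 r)//= big1 ?addr0 => [|s sr].
  have -> : (p%:Z * i + r%:Z + 1 == p%:Z * j + r%:Z + 1) = (i == j).
    by apply/eqP/eqP => [/group_inj|->].
  by case: eqP; rewrite !mxE.
case: eqP => [e|_]; last by rewrite mxE.
have := (group_index s j).2; rewrite -e (group_index r i).2 => -[rs].
by move: sr; rewrite -val_eqE /= rs eqxx.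
Qed.

Lemma D1E (A : op R 1) n (y : l2 R n) :
  D1 A n y = group n (fejer A n (ungroup y)).
Proof. by []. Qed.

(** Entries in blocks at distance at least 2 are at distance at least [2 n - (n - 1) = n + 1] from
    each other, beyond the band-width [n] of [fejer A n]. *)
Lemma D1_tridiagonal (A : op R 1) n : (0 < n)%N -> tridiagonal (D1 A n).
Proof.
move=> n0; have [bF Fn] := fejer_bounded_banded A n; split.
  have [M M0 FM] := bounded_opP bF.
  apply: (@opbound_bounded _ _ _ M) => y.
  by rewrite D1E l2norm_group// (le_trans (FM _))// l2norm_ungroup.
move=> i j ij; apply/matrixP => r c; rewrite [RHS]mxE [LHS]mxE D1E [LHS]mxE ungroup_delta//.
rewrite linear_sum l2_sumE summxE big1// => s _.
rewrite (banded_out _ Fn) ?mxE//.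
have := ltn_ord r; have := ltn_ord s; move: (nat_of_ord r) (nat_of_ord s) => a b.
move: ij n0; clear.
move=> h n0 bn an; have [ij|ij] : (j + 2 <= i \/ i + 2 <= j) by lia.
  have : n%:Z * (j + 2) <= n%:Z * i by rewrite ler_wpM2l.
  by rewrite mulrDr; lia.
have : n%:Z * (i + 2) <= n%:Z * j by rewrite ler_wpM2l.
by rewrite mulrDr; lia.
Qed.

Section BlockBounds.
Variables (p : nat) (B : op R p) (a b c : R).
Hypothesis Btri : tridiagonal B.
Hypotheses (a0 : 0 <= a) (b0 : 0 <= b) (c0 : 0 <= c).
Hypothesis Ba : forall i (v : 'cV[C]_p), enorm (mx_of B i (i - 1) *m v) <= a * enorm v.
Hypothesis Bb : forall i (v : 'cV[C]_p), enorm (mx_of B i i *m v) <= b * enorm v.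
Hypothesis Bc : forall i (v : 'cV[C]_p), enorm (mx_of B i (i + 1) *m v) <= c * enorm v.

(** The weights of [sqnorm_three_le] are the block bounds themselves, made positive by [e]; after
    summation this gives the constant of the triangle inequality. It provides the radius of the
    grid. *)
Lemma tridiagonal_norm : opbound B (a + b + c).
Proof.
move=> x; apply: le_small => e0 e00.
suff H e : 0 < e -> l2norm (B x) <= (a + b + c + 3 * e) * l2norm x.
  have k0 : 0 < 3 * (l2norm x + 1) by rewrite mulr_gt0// ltr_wpDl// l2norm_ge0.
  have := H _ (divr_gt0 e00 k0) => /le_trans; apply.
  rewrite mulrDl lerD2l; move: (l2norm x) (l2norm_ge0 x) k0 => u u0 _.
  have u1 : 0 < u + 1 by rewrite ltr_wpDl.
  have -> : 3 * (e0 / (3 * (u + 1))) * u = e0 * u / (u + 1).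
    by field; rewrite gt_eqF.
  by rewrite ler_pdivrMr// ler_pM2l// lerDl.
move=> e1; have p1 : 0 < a + e by rewrite ltr_wpDl.
have p2 : 0 < b + e by rewrite ltr_wpDl.
have p3 : 0 < c + e by rewrite ltr_wpDl.
have -> : a + b + c + 3 * e = (a + e) + (b + e) + (c + e) by ring.
move: (a + e) (b + e) (c + e) p1 p2 p3 (lerDl a e) (lerDl b e) (lerDl c e).
rewrite (ltW e1) => q1 q2 q3 q10 q20 q30 aq bq cq.
set P := q1 + q2 + q3; have P0 : 0 < P := addr_gt0 (addr_gt0 q10 q20) q30.
have sq (d q : R) (N : 'M[C]_p) (v : 'cV[C]_p) : 0 <= d -> d <= q -> 0 < q ->
    (forall v : 'cV[C]_p, enorm (N *m v) <= d * enorm v) ->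
    sqnorm (N *m v) / q <= q * sqnorm v.
  move=> d0 dq q0 Nd; rewrite ler_pdivrMr// mulrAC -expr2 -!enorm_sqr -exprMn.
  rewrite ler_sqr ?nnegrE ?mulr_ge0 ?enorm_ge0 ?(ltW q0)//.
  by rewrite (le_trans (Nd v))// ler_wpM2r ?enorm_ge0.
have Px : 0 <= P * l2norm x by rewrite mulr_ge0 ?l2norm_ge0// ltW.
rewrite -ler_sqr ?nnegrE ?l2norm_ge0// exprMn !l2norm_sqr !dotxxE.
have sx := sm_sqnorm x.
have s1 := sm_shift (-1) sx; have s3 := sm_shift 1 sx.
have -> : P ^+ 2 * asum (fun i => sqnorm (x i)) = asum (fun i =>
    (P * q1) * sqnorm (x (i - 1)) + (P * q2) * sqnorm (x i) + (P * q3) * sqnorm (x (i + 1))).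
  rewrite (asum_lin3 _ _ _ s1 sx s3) (asum_shift (-1) sx) (asum_shift 1 sx).
  by rewrite -!mulrDl -!mulrDr expr2.
apply: le_asum; [exact: sm_sqnorm|by apply: smD; [apply: smD|]; exact: smZ|].
move=> i; rewrite tridiagonal_apply//.
apply: le_trans (sqnorm_three_le _ _ _ q10 q20 q30) _; rewrite -/P.
rewrite -!(mulrA P) -!(mulrDr P) (ler_pM2l P0).
apply: lerD; [apply: lerD|].
- exact: (sq a q1 _ _ a0 aq q10 (Ba i)).
- exact: (sq b q2 _ _ b0 bq q20 (Bb i)).
- exact: (sq c q3 _ _ c0 cq q30 (Bc i)).
Qed.

End BlockBounds.
End GroupingIsometry.

(** * The inclusion and the convergence *)

Section Inclusion.
Context {R : realType}.
Local Notation C := R[i].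

(** Nonzero coordinates shrink strictly, so that a point on the boundary circle is rounded into the
    open disc. *)
Lemma round_toward0 (n : nat) (x : R) : (0 < n)%N -> exists a : int,
  [/\ `|x - a%:~R / n%:R| <= n%:R^-1, `|a%:~R / n%:R| <= `|x| &
      x != 0 -> `|a%:~R / n%:R : R| < `|x| ].
Proof.
move=> n0; have n0' : 0 < n%:R :> R by rewrite ltr0n.
have pos (y : R) : 0 < y -> exists a : int,
    [/\ `|y - a%:~R / n%:R| <= n%:R^-1 & `|a%:~R / n%:R : R| < y].
  move=> y0; pose a := Num.ceil (y * n%:R) - 1; exists a.
  have /andP[c1 c2] := ceil_itv (y * n%:R).
  have a0 : 0 <= a by rewrite subr_ge0 -[1]add0r lezD1 ceil_gt0 mulr_gt0.
  have a0R : 0 <= a%:~R :> R by rewrite ler0z.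
  have lt : a%:~R / n%:R < y by rewrite ltr_pdivrMr.
  split; last by rewrite ger0_norm// divr_ge0// ltW.
  rewrite ger0_norm; last by rewrite subr_ge0 ltW.
  rewrite lerBlDr -[X in X + _]mul1r -mulrDl ler_pdivlMr//.
  by rewrite (le_trans c2)// /a rmorphB /= addrC subrK.
have [->|x0] := eqVneq x 0.
  exists 0; rewrite mul0r subr0 normr0 invr_ge0 ler0n; split => //.
have [xp|xn|/eqP] := ltgtP 0 x; last by rewrite eq_sym (negPf x0).
  have [a [h1 h2]] := pos x xp; exists a; rewrite (ger0_norm (ltW xp)); split => //.
  exact: ltW.
have [a [h1 h2]] := pos (- x) ltac:(by rewrite oppr_gt0).
exists (- a); rewrite (ltr0_norm xn) rmorphN mulNr normrN opprK; split => //.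
  by rewrite -normrN opprD.
exact: ltW.
Qed.

(** Two coordinate errors of [1 / n] give [sqrt 2 / n], estimated by the rational [3 / (2 n)]. For
    [lambda = 0] nothing shrinks, but 0 lies in the grid for every [r], even [r = 0]. *)
Lemma grid_round (n : nat) (lambda : C) (r : R) : (0 < n)%N -> normc lambda <= r ->
  exists2 mu, Grid n r mu & normc (lambda - mu) <= 3 / (2 * n%:R).
Proof.
move=> n0 lr; have n0' : 0 < n%:R :> R by rewrite ltr0n.
case: lambda lr => x y lr.
have [a [a1 a2 a3]] := round_toward0 x n0.
have [b [b1 b2 b3]] := round_toward0 y n0.
exists ((a%:~R / n%:R) +i* (b%:~R / n%:R)); last first.
  rewrite -[_ - _]/((x - a%:~R / n%:R) +i* (y - b%:~R / n%:R)) /=.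
  move: (x - _) (y - _) a1 b1 => u v hu hv.
  have sq (w : R) : `|w| <= n%:R^-1 -> w ^+ 2 <= n%:R^-1 ^+ 2.
    by move=> hw; rewrite -[w ^+ 2]real_normK ?num_real// ler_sqr ?nnegrE// invr_ge0 ltW.
  have -> : 3 / (2 * n%:R) = Num.sqrt ((3 / 2 * n%:R^-1) ^+ 2) :> R.
    rewrite sqrtr_sqr ger0_norm; first by rewrite invfM mulrA.
    by rewrite mulr_ge0// ?divr_ge0// invr_ge0 ltW.
  apply: ler_wsqrtr; have := sq _ hu; have := sq _ hv; rewrite exprMn.
  have := sqr_ge0 (n%:R^-1 : R).
  by move: (n%:R^-1 ^+ 2) (u ^+ 2) (v ^+ 2) => N U V; clear; lra.
split; first by exists a, b.
move: a1 a2 a3 b1 b2 b3; set a' := a%:~R / n%:R; set b' := b%:~R / n%:R.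
move=> _ a2 a3 _ b2 b3.
have sq (w z : R) : `|w| <= `|z| -> w ^+ 2 <= z ^+ 2.
  by move=> h; rewrite -[w ^+ 2]real_normK ?num_real// -[z ^+ 2]real_normK ?num_real// ler_sqr ?nnegrE.
have sqlt (w z : R) : `|w| < `|z| -> w ^+ 2 < z ^+ 2.
  by move=> h; rewrite -[w ^+ 2]real_normK ?num_real// -[z ^+ 2]real_normK ?num_real// ltr_sqr ?nnegrE.
have [l0|l0] := eqVneq (x +i* y) 0.
  move: l0 a2 b2 => -[-> ->]; rewrite normr0 !normr_le0 => /eqP -> /eqP ->.
  have n01 : normc (0 : C) < 1 by rewrite normc0.
  by exists 0; [exact: n01|rewrite mulr0].
have lt : normc (a' +i* b') < r.
  apply: lt_le_trans lr; rewrite /= ltr_sqrt.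
    have [x0|x0] := eqVneq x 0.
      have y0 : y != 0 by apply: contra l0 => /eqP ->; rewrite x0.
      by rewrite ler_ltD ?sq// sqlt// b3.
    by rewrite ltr_leD ?sq// sqlt// a3.
  rewrite lt_def addr_ge0 ?sqr_ge0// andbT; apply: contra l0.
  by rewrite paddr_eq0 ?sqr_ge0// !sqrf_eq0 => /andP[/eqP -> /eqP ->].
have r0 : 0 < r by apply: le_lt_trans lt; exact: normc_ge0.
have rC0 : r%:C != 0 :> C by rewrite (inj_eq (@complexI _) r 0) gt_eqF.
have q1 : normc ((r%:C)^-1 * (a' +i* b')) < 1.
  by rewrite normcM normcV normc_real (gtr0_norm r0) mulrC ltr_pdivrMr// mul1r.
exists ((r%:C)^-1 * (a' +i* b')); first exact: q1.
by rewrite mulrA mulfV// mul1r.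
Qed.

Lemma bigmine_leP (I : eqType) (s : seq I) (f : I -> \bar R) (e : R) :
  (\big[mine/+oo]_(k <- s) f k <= e%:E)%E <-> exists2 k, k \in s & (f k <= e%:E)%E.
Proof.
elim: s => [|k s IH].
  by rewrite big_nil leye_eq; split => // -[].
rewrite big_cons ge_min; split.
  case/orP => [h|/IH[j js h]]; first by exists k; rewrite ?mem_head.
  by exists j; rewrite ?inE ?js ?orbT.
move=> [j]; rewrite inE => /predU1P[->|js] h; first by rewrite h.
by apply/orP; right; apply/IH; exists j.
Qed.

Lemma Gamma_epsP p (B : op R p) n K (e : R) z : Gamma_eps B n K e z <->
  exists2 k, k \in K & (nu (subcol (mx_of B) n k - z *: Iplus p n) <= e%:E)%E \/
    (nu (subcol (bitr (mx_of B)) n k - z *: Iplus p n) <= e%:E)%E.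
Proof.
rewrite /Gamma_eps /=; apply: (iff_trans (bigmine_leP _ _ _)).
by split => -[k kK h]; exists k => //; move: h; rewrite ge_min => /orP.
Qed.

Lemma Spec_approx p (A S : op R p) lambda (d : R) : bounded_op A -> adjoint A S ->
  Spec A lambda -> 0 < d ->
  (exists2 x, x != 0 & l2norm (A x - lambda *: x) <= d * l2norm x) \/
  (exists2 x, x != 0 & l2norm (S x - (conjc lambda) *: x) <= d * l2norm x).
Proof.
move=> bA AS sA d0; apply: contrapT => /not_orP[h1 h2].
apply: (below_notSpec (lambda := lambda) bA AS d0 _ sA).
have H (f : l2 R p -> l2 R p) : f 0 = 0 ->
    ~ (exists2 x, x != 0 & l2norm (f x) <= d * l2norm x) -> bounded_below f d.
  move=> f0 hf x; have [->|x0] := eqVneq x 0; first by rewrite f0 l2norm0 mulr0.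
  by rewrite leNgt; apply/negP => /ltW h; apply: hf; exists x.
have e1 : A 0 - lambda *: 0 = 0 by rewrite linear0 scaler0 subr0.
have e2 : S 0 - conjc lambda *: 0 = 0 by rewrite linear0 scaler0 subr0.
by split; [exact: (H _ e1 h1)|exact: (H _ e2 h2)].
Qed.

End Inclusion.

(** * Spectral inclusion for a fixed n *)

Section SpectralInclusion.
Context {R : realType}.
Local Notation C := R[i].

Definition block_bounds p (M : @bimx R p) (a b c : R) :=
  [/\ 0 <= a, 0 <= b & 0 <= c] /\
  [/\ forall i (v : 'cV[C]_p), enorm (M i (i - 1) *m v) <= a * enorm v,
      forall i (v : 'cV[C]_p), enorm (M i i *m v) <= b * enorm v &
      forall i (v : 'cV[C]_p), enorm (M i (i + 1) *m v) <= c * enorm v].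

Lemma block_bounds_bitr p (M : @bimx R p) a b c :
  block_bounds M a b c -> block_bounds (bitr M) c b a.
Proof.
move=> [[a0 b0 c0] [Ma Mb Mc]]; split => //; rewrite /bitr; split => i.
- by apply: enorm_tr => // v; have := Mc (i - 1) v; rewrite subrK.
- exact: enorm_tr.
- by apply: enorm_tr => // v; have := Ma (i + 1) v; rewrite addrK.
Qed.

Lemma block_bounds_sup p (M : @bimx R p) (a b c : R) :
  (ereal_sup (range (fun j : int => mxnorm (M (j + 1)%R j))) <= a%:E)%E ->
  (ereal_sup (range (fun j : int => mxnorm (M j j))) <= b%:E)%E ->
  (ereal_sup (range (fun j : int => mxnorm (M (j - 1)%R j))) <= c%:E)%E ->
  block_bounds M a b c.
Proof.
move=> ha hb hc.
have {}ha j : (mxnorm (M (j + 1)%R j) <= a%:E)%E.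
  by apply: le_trans ha; apply: ereal_sup_ubound; exists j.
have {}hb j : (mxnorm (M j j) <= b%:E)%E.
  by apply: le_trans hb; apply: ereal_sup_ubound; exists j.
have {}hc j : (mxnorm (M (j - 1)%R j) <= c%:E)%E.
  by apply: le_trans hc; apply: ereal_sup_ubound; exists j.
have pos (N : 'M[C]_p) (d : R) : (mxnorm N <= d%:E)%E -> 0 <= d.
  by move=> /(le_trans (mxnorm_ge0 _)).
split; first by split; [exact: pos (ha 0)|exact: pos (hb 0)|exact: pos (hc 0)].
split => i v; apply: mxnorm_le.
- by have := ha (i - 1); rewrite subrK.
- exact: hb.
- by have := hc (i + 1); rewrite addrK.
Qed.

Lemma nu_cover p (B : op R p) lambda y n (K : {fset int}) (a b c theta e : R) :
  tridiagonal B -> (0 < n)%N -> block_bounds (mx_of B) a b c ->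
  0 <= theta -> 0 < e -> y != 0 ->
  l2norm (B y - lambda *: y) <= theta * l2norm y ->
  (forall k : int, exists2 j, j \in K &
    (mxnorm (subcol (mx_of B) n k - subcol (mx_of B) n j)%R <= (n%:R^-1)%:E)%E) ->
  exists2 j, j \in K & (nu (subcol (mx_of B) n j - lambda *: Iplus p n)%R <=
    (theta + (a + c) * (22 / (7 * n.+1%:R)) + 3 * e + n%:R^-1)%:E)%E.
Proof.
move=> Btri n0 [[a0 b0 c0] [Ba Bb Bc]] th0 e0 y0 hy hK.
have [k [v [v0 hv]]] := window_estimate Btri n0 Ba Bc a0 c0 th0 e0 y0 hy.
have [j jK hj] := hK k; exists j => //.
set mu := theta + _ + _ in hv *.
pose u := \mxcol_j v j.
have uE : enorm u = l2norm (pad k v) by exact: enorm_mxcol_pad.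
apply: (@nu_le _ _ _ _ u); first by rewrite uE gt_eqF// l2norm_gt0.
have -> : subcol (mx_of B) n j - lambda *: Iplus p n =
    (subcol (mx_of B) n k - lambda *: Iplus p n) -
    (subcol (mx_of B) n k - subcol (mx_of B) n j).
  by rewrite opprB [RHS]addrC addrA subrK.
rewrite mulmxBl (le_trans (enormB _ _))// mulrDl lerD//.
  by rewrite subcol_tri_pad// uE.
exact: mxnorm_le hj.
Qed.

(** A window vector extended by 0 has the same residual, so this direction loses nothing; [d] makes
    up for an infimum without a known minimizer. *)
Lemma nu_pad p (B : op R p) z n k (e d : R) : tridiagonal B ->
  (nu (subcol (mx_of B) n k - z *: Iplus p n) <= e%:E)%E -> 0 < d ->
  exists2 y, l2norm y = 1 & l2norm (B y - z *: y) < e + d.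
Proof.
move=> Btri hnu d0; have [u u1] := nu_approx hnu d0.
rewrite -(submxcolK u) subcol_tri_pad// => hu.
exists (pad k (fun j => submxcol u j)) => //.
by rewrite -(enorm_mxcol_pad k) submxcolK.
Qed.

Definition grouped p (F : op R 1) : op R p := @group R p \o F \o @ungroup R p.

Lemma l2norm_grouped p (F : op R 1) (z : C) y : (0 < p)%N ->
  l2norm (grouped p F y - z *: y) = l2norm (F (ungroup y) - z *: ungroup y).
Proof.
move=> p0; have e : group p (F (ungroup y) - z *: ungroup y) = grouped p F y - z *: y.
  rewrite -[in RHS](ungroupK p0 y) -[grouped _ _ _]/(group p (F (ungroup _))).
  by rewrite (groupK p0) linearB linearZ.
by rewrite -e l2norm_group.
Qed.

(** The window lemmas speak of operators, so the transposed matrix needs one behind it. Taking it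
    from an adjoint of [fejer A n] lets the bound [eta] on [A - fejer A n] carry over to
    adjoints. *)
Lemma D1_transpose (A : op R 1) n : (0 < n)%N -> exists FS : op R 1,
  [/\ adjoint (fejer A n) FS, tridiagonal (conjop (grouped n FS)) &
      mx_of (conjop (grouped n FS)) = bitr (mx_of (D1 A n))].
Proof.
move=> n0; have [bF _] := fejer_bounded_banded A n.
have [FS aF] := adjoint_exists bF; exists FS.
have aD : adjoint (D1 A n) (grouped n FS) by exact: adjoint_group.
have mE := mx_of_conjop aD.
have [bD tD] := D1_tridiagonal A n0; split => //; split.
  have [M M0 DM] := bounded_opP bD.
  exact: opbound_bounded (conjop_bound (adjoint_bound aD DM)).
by move=> i j ij; rewrite mE /bitr tD ?trmx0//; move: ij; lia.
Qed.

Lemma perturb_bound (A F S FS : op R 1) (eta : R) : adjoint A S -> adjoint F FS ->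
  (opnorm (A \- F)%R <= eta%:E)%E ->
  opbound (fun x => A x - F x) eta /\ opbound (fun x => S x - FS x) eta.
Proof.
move=> AS FFS /(@opnorm_le _ _ (A \- F)) h; split; first exact: h.
apply: (@adjoint_bound _ _ (A \- F) (S \- FS)) => //.
by move=> x y; rewrite /= dotBl dotBr AS FFS.
Qed.

Lemma l2norm_perturb p (f g : l2 R p -> l2 R p) z eta x :
  opbound (fun x => f x - g x) eta ->
  l2norm (g x - z *: x) <= l2norm (f x - z *: x) + eta * l2norm x.
Proof.
move=> h; have -> : g x - z *: x = (f x - z *: x) - (f x - g x).
  by rewrite opprB [RHS]addrC addrA subrK.
by rewrite (le_trans (l2normB _ _))// lerD2l.
Qed.

Lemma opnorm_ge0 p (f : l2 R p -> l2 R p) : f 0 = 0 -> (0 <= opnorm f)%E.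
Proof.
move=> f0; apply: ereal_sup_ubound; exists 0; first by rewrite /= l2norm0.
by rewrite f0 l2norm0.
Qed.

Section OneStep.
Variables (A S : op R 1) (n : nat) (K : {fset int}) (abc : R * R * R) (eta : R).
Hypotheses (n0 : (0 < n)%N) (bA : bounded_op A) (AS : adjoint A S).
Hypothesis heta : (opnorm (A \- fejer A n)%R <= eta%:E)%E.

Lemma eta_ge0 : 0 <= eta.
Proof.
rewrite -lee_fin; apply: le_trans heta; apply: opnorm_ge0.
have e : A 0 - fejer A n 0 = 0 by rewrite (linear0 A) (linear0 (fejer A n)) subrr.
exact: e.
Qed.

(** Phrased as a bound on [c], this is ready to contradict the uniform constant of [below_uniform].
    Whether the small lower norm belongs to the matrix or to its transpose decides which half of
    [below] is tested. *)
Lemma Gamma_eps_below z (e c : R) : Gamma_eps (D1 A n) n K e z ->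
  below A S z c -> c <= e + eta.
Proof.
move=> /Gamma_epsP[k _ hk] [Ac Sc]; apply: le_small => d d0.
have [FS [aF tF mF]] := D1_transpose A n0.
have [pA pS] := perturb_bound AS aF heta.
have flip p (f g : l2 R p -> l2 R p) M : opbound (fun x => f x - g x) M ->
    opbound (fun x => g x - f x) M.
  by move=> h x; rewrite l2normBC.
case: hk => hk.
  have [y y1 hy] := nu_pad (D1_tridiagonal A n0) hk d0.
  rewrite (l2norm_grouped _ _ _ n0) in hy.
  have := Ac (ungroup y); rewrite l2norm_ungroup y1 mulr1 => /le_trans; apply.
  apply: le_trans (l2norm_perturb _ _ (flip _ _ _ _ pA)) _.
  by rewrite l2norm_ungroup y1 mulr1 addrAC lerD2r ltW.
rewrite -mF in hk.
have [y y1 hy] := nu_pad tF hk d0.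
rewrite -(cjK y) l2norm_conjop_sub (l2norm_grouped _ _ _ n0) in hy.
have yE : l2norm (ungroup (cj y)) = 1 by rewrite l2norm_ungroup l2norm_cj.
have := Sc (ungroup (cj y)); rewrite yE mulr1 => /le_trans; apply.
apply: le_trans (l2norm_perturb _ _ (flip _ _ _ _ pS)) _.
by rewrite yE mulr1 addrAC lerD2r ltW.
Qed.

Hypothesis hK : forall k : int, exists2 j, j \in K &
  ((mxnorm (subcol (mx_of (D1 A n)) n k - subcol (mx_of (D1 A n)) n j)%R
      <= (n%:R^-1)%:E)%E /\
   (mxnorm (subcol (bitr (mx_of (D1 A n))) n k - subcol (bitr (mx_of (D1 A n))) n j)%R
      <= (n%:R^-1)%:E)%E).
Hypothesis hB : block_bounds (mx_of (D1 A n)) abc.1.1 abc.1.2 abc.2.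

Lemma Spec_approx_grouped lambda (d : R) : Spec A lambda -> 0 < d ->
  exists (B : op R n) y, [/\ tridiagonal B, y != 0,
    mx_of B = mx_of (D1 A n) \/ mx_of B = bitr (mx_of (D1 A n)) &
    l2norm (B y - lambda *: y) <= (d + eta) * l2norm y].
Proof.
move=> sA d0; have [FS [aF tF mF]] := D1_transpose A n0.
have [pA pS] := perturb_bound AS aF heta.
have g0 (x : l2 R 1) : x != 0 -> group n x != 0.
  by move=> x0; rewrite -l2norm_gt0 l2norm_group// l2norm_gt0.
case: (Spec_approx bA AS sA d0) => -[x x0 hx].
  exists (D1 A n), (group n x); split; [exact: D1_tridiagonal|exact: g0|by left|].
  rewrite (l2norm_grouped _ _ _ n0) groupK// l2norm_group// mulrDl.
  by rewrite (le_trans (l2norm_perturb _ _ pA))// lerD2r.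
exists (conjop (grouped n FS)), (cj (group n x)); split => //; first 1 last.
- by right.
- rewrite l2norm_conjop_sub (l2norm_grouped _ _ _ n0) groupK// l2norm_cj l2norm_group//.
  by rewrite mulrDl (le_trans (l2norm_perturb _ _ pS))// lerD2r.
- by rewrite -l2norm_gt0 l2norm_cj l2norm_gt0 g0.
Qed.

(** Block bounds are given for [D1 A n] only, hence the passage through an approximate eigenvector
    of it or of its transpose. The limit [d -> 0] yields the closed disc, while [Grid] uses the open
    one. *)
Lemma Spec_radius lambda : Spec A lambda ->
  normc lambda <= abc.1.1 + abc.1.2 + abc.2 + eta.
Proof.
move=> sA; apply: le_small => d d0.
have [B [y [Btri y0 mB hy]]] := Spec_approx_grouped sA d0.
have BM : opbound B (abc.1.1 + abc.1.2 + abc.2).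
  case: mB => mB.
    have [[a0 b0 c0] [Ba Bb Bc]] := hB; rewrite -mB in Ba Bb Bc.
    exact: (tridiagonal_norm Btri a0 b0 c0 Ba Bb Bc).
  have [[a0 b0 c0] [Ba Bb Bc]] := block_bounds_bitr hB; rewrite -mB in Ba Bb Bc.
  have := tridiagonal_norm Btri a0 b0 c0 Ba Bb Bc.
  by congr opbound; rewrite addrC addrA addrAC addrC addrA addrAC.
have ny : 0 < l2norm y by rewrite l2norm_gt0.
rewrite -(ler_pM2r ny) -l2normZ.
rewrite (le_trans (l2norm_lipschitz _ (B y)))// l2normBC.
rewrite (le_trans (lerD (BM y) hy))// -mulrDl ler_pM2r//.
by rewrite [d + eta]addrC addrA.
Qed.

Lemma Spec_sub_Gamma_hat :
  Spec A `<=` fatten (Gamma_fin (D1 A n) K abc eta) (2 / n%:R).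
Proof.
move=> lambda sA; have n0' : 0 < n%:R :> R by rewrite ltr0n.
have [mu gmu lmu] := grid_round n0 (Spec_radius sA).
(* This slack enters four times, once in the approximate eigenvector and three times in [nu_cover].
   Its total [1 / (2 n)], together with [3 / (2 n)] for the grid point and [1 / n] for the window in
   [K], makes up [3 / n]. *)
have e0 : 0 < (8 * n%:R)^-1 :> R by rewrite invr_gt0 mulr_gt0.
have [B [y [Btri y0 mB hy]]] := Spec_approx_grouped sA e0.
have hy' : l2norm (B y - mu *: y) <=
    ((8 * n%:R)^-1 + eta + 3 / (2 * n%:R)) * l2norm y.
  have -> : B y - mu *: y = (B y - lambda *: y) + (lambda - mu) *: y.
    by rewrite scalerBl addrA subrK.
  rewrite (le_trans (l2normD _ _))// mulrDl lerD// l2normZ ler_wpM2r//.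
  exact: l2norm_ge0.
have th0 : 0 <= (8 * n%:R)^-1 + eta + 3 / (2 * n%:R).
  by rewrite !addr_ge0 ?eta_ge0 ?divr_ge0 ?mulr_ge0 ?invr_ge0 ?mulr_ge0 ?(ltW n0').
have split3 (X : R) : (8 * n%:R)^-1 + eta + 3 / (2 * n%:R) + X +
    3 * (8 * n%:R)^-1 + n%:R^-1 = X + 3 / n%:R + eta.
  by field; rewrite gt_eqF.
exists mu; last first.
  exists ((2 / n%:R)%:C^-1 * (lambda - mu)); last first.
    rewrite mulrA mulfV ?mul1r 1?addrC ?subrK//.
    by rewrite (inj_eq (@complexI _) _ 0) gt_eqF// divr_gt0.
  have : normc ((2 / n%:R)%:C^-1 * (lambda - mu)) <= 1.
    rewrite normcM normcV normc_real gtr0_norm ?divr_gt0// mulrC ler_pdivrMr ?divr_gt0//.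
    rewrite mul1r (le_trans lmu)// invfM mulrA ler_pM2r ?invr_gt0//.
    by rewrite ler_pdivrMr// -natrM ler_nat.
  by [].
split => //; apply/Gamma_epsP.
case: mB => mB.
  have hB' := hB; rewrite -mB in hB'.
  have hK' (k : int) : exists2 j, j \in K &
      (mxnorm (subcol (mx_of B) n k - subcol (mx_of B) n j)%R <= (n%:R^-1)%:E)%E.
    by rewrite mB; have [j jK [h _]] := hK k; exists j.
  have [j jK hj] := nu_cover Btri n0 hB' th0 e0 y0 hy' hK'.
  exists j => //; left; rewrite -mB; rewrite split3 in hj.
  by move: hj; rewrite /eps_star.
have hB' := block_bounds_bitr hB; rewrite -mB in hB'.
have hK' (k : int) : exists2 j, j \in K &
    (mxnorm (subcol (mx_of B) n k - subcol (mx_of B) n j)%R <= (n%:R^-1)%:E)%E.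
  by rewrite mB; have [j jK [_ h]] := hK k; exists j.
have [j jK hj] := nu_cover Btri n0 hB' th0 e0 y0 hy' hK'.
exists j => //; right; rewrite -mB; rewrite split3 in hj.
by move: hj; rewrite /eps_star [abc.2 + _]addrC.
Qed.

End OneStep.
End SpectralInclusion.

(** * Convergence in the Hausdorff distance *)

Section Convergence.
Context {R : realType}.
Local Notation C := R[i].

(** The point [t0] serves the lower bound 0: the supremum over an empty set would be minus
    infinity. *)
Lemma hausdorff_le (S T : set C) (t0 : C) (e : R) : T t0 ->
  (forall s, S s -> exists2 t, T t & normc (s - t) <= e) ->
  (forall t, T t -> exists2 s, S s & normc (t - s) <= e) ->
  (0 <= hausdorff S T <= e%:E)%E.
Proof.
move=> Tt0 ST TS.
have dge (z : C) (U : set C) : (0 <= dist z U)%E.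
  by apply: le_ereal_inf_tmp => _ [u _ <-]; rewrite lee_fin normc_ge0.
have dle (z u : C) (U : set C) : U u -> normc (z - u) <= e -> (dist z U <= e%:E)%E.
  by move=> Uu zu; apply: ge_ereal_inf; exists (normc (z - u))%:E; [exists u|rewrite lee_fin].
apply/andP; split.
  rewrite le_max; apply/orP; right; apply: le_trans (dge t0 S) _.
  by apply: ereal_sup_ubound; exists t0.
rewrite ge_max; apply/andP; split; apply: ge_ereal_sup => _ [s Ss <-].
  by have [t Tt st] := ST s Ss; exact: dle Tt st.
by have [t Tt st] := TS s Ss; exact: dle Tt st.
Qed.

Lemma ereal_cvg0 (H : nat -> \bar R) :
  (forall e : R, 0 < e -> \forall n \near \oo, (0 <= H n <= e%:E)%E) ->
  H n @[n --> \oo] --> 0%E.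
Proof.
move=> He; apply/fine_cvgP; split.
  have := He _ ltr01; apply: filterS => n /andP[h0 h1].
  by rewrite ge0_fin_numE// (le_lt_trans h1)// ltry.
apply/cvgrPdist_le => e e0; have := He _ e0; apply: filterS => n /andP[h0 h1].
rewrite sub0r normrN ger0_norm ?fine_ge0//= -lee_fin fineK//.
by rewrite ge0_fin_numE// (le_lt_trans h1)// ltry.
Qed.

(** The lower bound [c] outside the [e / 2]-neighbourhood of the spectrum is fixed before [n]; once
    [E n < c], no point of [Gamma n] lies there. The other [e / 2] is left for the fattening. *)
Lemma hausdorff_cvg p (A S : op R p) (Gamma : nat -> set C) (E : nat -> R) :
  (0 < p)%N -> bounded_op A -> adjoint A S ->
  (forall n, (0 < n)%N -> Spec A `<=` fatten (Gamma n) (2 / n%:R)) ->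
  (forall n z c, (0 < n)%N -> Gamma n z -> below A S z c -> c <= E n) ->
  (forall c, 0 < c -> \forall n \near \oo, E n < c) ->
  hausdorff (Gamma n) (Spec A) @[n --> \oo] --> 0%E /\
  hausdorff (fatten (Gamma n) (2 / n%:R)) (Spec A) @[n --> \oo] --> 0%E.
Proof.
move=> p0 bA AS inc lowb Ec.
have [t0 St0] := Spec_nonempty p0 bA.
have key (e : R) : 0 < e -> \forall n \near \oo,
    [/\ (0 < n)%N, 2 / n%:R <= e / 2 &
      forall z, Gamma n z -> exists2 s, Spec A s & normc (z - s) <= e / 2].
  move=> e0; have e20 : 0 < e / 2 by rewrite divr_gt0.
  have [c c0 hc] := below_uniform bA AS e20.
  near=> n.
  have n0 : (0 < n)%N by near: n; exact: nbhs_infty_gt.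
  split => //.
    rewrite ler_pdivrMr ?ltr0n// mulrC -ler_pdivrMr// ltW//; near: n.
    exact: nbhs_infty_gtr.
  move=> z Gz; apply: contrapT => hz.
  have zc : below A S z c.
    apply: hc => s ss; rewrite leNgt; apply/negP => /ltW zs.
    by apply: hz; exists s.
  have := lowb n z c n0 Gz zc; rewrite leNgt => /negP; apply.
  by near: n; exact: Ec.
have fatP (G : set C) (d : R) z : 0 <= d -> fatten G d z -> exists2 s, G s & normc (z - s) <= d.
  move=> d0 [s Gs [w w1 <-]]; exists s => //.
  rewrite addrC addKr normcM normc_real ger0_norm//.
  by rewrite -[leRHS]mulr1 ler_wpM2l.
have fatI (G : set C) (d : R) z : G z -> fatten G d z.
  move=> Gz; exists z => //; exists 0; last by rewrite mulr0 addr0.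
  by have : normc (0 : C) <= 1 by rewrite normc0.
split; apply: ereal_cvg0 => e e0; have := key e e0; apply: filterS => n [n0 ne Gs].
  have d0 : 0 <= 2 / n%:R :> R by rewrite divr_ge0.
  apply: (hausdorff_le St0) => [s /Gs[t St h]|t /(inc n n0)/(fatP _ _ _ d0)[s G h]].
    by exists t; rewrite // (le_trans h)// ler_pdivrMr// ler_pMr// ler1n.
  by exists s; rewrite // (le_trans h)// (le_trans ne)// ler_pdivrMr// ler_pMr// ler1n.
have d0 : 0 <= 2 / n%:R :> R by rewrite divr_ge0.
apply: (hausdorff_le St0) => [s /(fatP _ _ _ d0)[g /Gs[t St h] h2]|t /(inc n n0) h].
  exists t => //; have -> : s - t = (s - g) + (g - t) by rewrite addrA subrK.
  by rewrite (le_trans (le_normcD _ _))// [leRHS]splitr lerD// (le_trans h2).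
by exists t => //; rewrite subrr normc0 ltW.
Unshelve. all: by end_near.
Qed.

End Convergence.

(** * Arithmetic programs *)

Section Decisions.
Local Notation eval := Defs.eval.
Context {R : realType} {V : Type} (rho : V -> R).
Implicit Types (c : prog V) (d : prog V -> prog V -> prog V) (e : expr V).

(* A test in continuation-passing style: [d c1 c2] goes on as c1 if P holds and
   as c2 otherwise. *)
Definition decides d (P : Prop) := forall c1 c2 s,
  (P -> runs rho c1 s) -> (~ P -> runs rho c2 s) -> runs rho (d c1 c2) s.

Lemma decides_iff d P Q : (P <-> Q) -> decides d P -> decides d Q.
Proof. by move=> [PQ QP] dP c1 c2 s h1 h2; apply: dP => [/PQ//|nP]; apply: h2 => /QP. Qed.

Lemma decides_le e1 e2 :
  decides (fun c1 c2 => IfLe e1 e2 c1 c2) (eval rho e1 <= eval rho e2).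
Proof.
move=> c1 c2 s h1 h2; apply: runs_IfLe.
by case: ifPn => [/h1//|/negP/h2].
Qed.

Lemma decides_and d1 d2 P1 P2 : decides d1 P1 -> (P1 -> decides d2 P2) ->
  decides (fun c1 c2 => d1 (d2 c1 c2) c2) (P1 /\ P2).
Proof.
move=> h1 h2 c1 c2 s r1 r2; apply: h1 => p1; last by apply: r2 => -[].
by apply: (h2 p1) => p2; [exact: r1|apply: r2 => -[]].
Qed.

Lemma decides_not d P : decides d P -> decides (fun c1 c2 => d c2 c1) (~ P).
Proof. by move=> h c1 c2 s r1 r2; apply: h => p; [apply: r2|exact: r1]. Qed.

Definition decide_ex (I : Type) (l : seq I) (d : I -> prog V -> prog V -> prog V) :=
  fun c1 c2 => foldr (fun i c => d i c1 c) c2 l.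

Lemma decides_ex (I : eqType) (l : seq I) (d : I -> prog V -> prog V -> prog V)
    (P : I -> Prop) : (forall i, decides (d i) (P i)) ->
  decides (decide_ex l d) (exists2 i, i \in l & P i).
Proof.
move=> dP; elim: l => [|i l IH] c1 c2 s r1 r2; first by apply: r2 => -[].
apply: dP => pi; first by apply: r1; exists i; rewrite ?mem_head.
apply: IH => [[j jl pj]|nl]; first by apply: r1; exists j; rewrite // inE jl orbT.
apply: r2 => -[j]; rewrite inE => /predU1P[->//|jl pj]; apply: nl; by exists j.
Qed.

(** Accepted points travel in an accumulator because a program can output only at a leaf. *)
Fixpoint collect (I : Type) (l : seq I) (d : I -> prog V -> prog V -> prog V)
    (out : I -> expr V * expr V) (acc : seq (expr V * expr V)) : prog V :=
  if l is i :: l' then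
    d i (collect l' d out (out i :: acc)) (collect l' d out acc)
  else Return acc.

Definition ceval (e : expr V * expr V) : R[i] := Complex (eval rho e.1) (eval rho e.2).

Lemma collect_runs (I : eqType) (l : seq I) (d : I -> prog V -> prog V -> prog V)
    (out : I -> expr V * expr V) (P : I -> Prop) : (forall i, decides (d i) (P i)) ->
  forall acc, exists s, runs rho (collect l d out acc) s /\ forall z, z \in s <->
    z \in map ceval acc \/ exists i, [/\ i \in l, P i & z = ceval (out i)].
Proof.
move=> dP; elim: l => [|i l IH] acc.
  exists (map ceval acc); split; first exact: (@runs_Return _ _ rho acc).
  by move=> z; split => [|[//|[i []//]]]; left.
have [pi|npi] := pselect (P i).
  have [s [rs sP]] := IH (out i :: acc); exists s; split.
    by apply: dP => // /(_ pi).
  move=> z; split => [/sP[]|].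
  - rewrite /= inE => /predU1P[->|]; last by left.
    by right; exists i; rewrite mem_head.
  - by move=> [j [jl pj ->]]; right; exists j; rewrite inE jl orbT.
  case=> [za|[j []]]; first by apply/sP; left; rewrite /= inE za orbT.
  rewrite inE => /predU1P[-> _ ->|jl pj ->].
    by apply/sP; left; rewrite /= mem_head.
  by apply/sP; right; exists j.
have [s [rs sP]] := IH acc; exists s; split; first exact: dP.
move=> z; split => [/sP[]|].
- by left.
- by move=> [j [jl pj ->]]; right; exists j; rewrite inE jl orbT.
case=> [za|[j []]]; first by apply/sP; left.
rewrite inE => /predU1P[-> /npi//|jl pj ->].
by apply/sP; right; exists j.
Qed.

Lemma prog_unfold c : c = match c with
  | Return s => Return s | IfLe e1 e2 c1 c2 => IfLe e1 e2 c1 c2 end.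
Proof. by case: c. Qed.

(** Programs have no rounding operation, so an integer above a real datum is found by comparing with
    0, 1, 2, ... in turn. The Archimedean property ends every run, though the tree is infinite. *)
CoFixpoint search (bound : expr V) (main : nat -> prog V) (N : nat) : prog V :=
  IfLe bound (Const V N%:R) (main N) (search bound main N.+1).

Lemma search_runs bound main (P : seq R[i] -> Prop) :
  (forall N, eval rho bound <= N%:R ->
    exists s, runs rho (main N) s /\ P s) ->
  exists s, runs rho (search bound main 0) s /\ P s.
Proof.
move=> mP; suff H m N : eval rho bound <= (N + m)%:R ->
    exists s, runs rho (search bound main N) s /\ P s.
  apply: (H (Num.bound `|eval rho bound|)); rewrite add0n ltW//.
  by rewrite (le_lt_trans (ler_norm _))// archi_boundP// normr_ge0.
elim: m N => [|m IH] N h; rewrite (prog_unfold (search _ _ _)) /=.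
  rewrite addn0 in h; have [s [rs Ps]] := mP N h; exists s; split => //.
  by apply: runs_IfLe; rewrite /= ratr_nat h.
have [h'|h'] := boolP (eval rho bound <= N%:R).
  have [s [rs Ps]] := mP N h'; exists s; split => //.
  by apply: runs_IfLe; rewrite /= ratr_nat h'.
rewrite -addSnnS in h; have [s [rs Ps]] := IH _ h; exists s; split => //.
by apply: runs_IfLe; rewrite /= ratr_nat (negPf h').
Qed.

(* The positive definiteness of a symmetric matrix is tested by successive Schur
   complements. *)
Fixpoint decide_posdef (T : Type) (G : T -> T -> expr V) (l : seq T)
    (c1 c2 : prog V) : prog V :=
  if l is t :: l' then
    IfLe (G t t) (Const V 0) c2
      (decide_posdef (fun i j => Defs.Sub (G i j) (Div (Mul (G i t) (G t j)) (G t t)))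
        l' c1 c2)
  else c1.

Definition qform (T : Type) (g : T -> T -> R) (l : seq T) (x : T -> R) : R :=
  \sum_(i <- l) \sum_(j <- l) g i j * x i * x j.

(** The uniform constant [c] suits a lower norm defined as an infimum: vectors that come close to
    the infimum already contradict it, without compactness of the sphere. *)
Definition posdef (T : Type) (g : T -> T -> R) (l : seq T) :=
  exists2 c : R, 0 < c & forall x, c * (\sum_(i <- l) x i ^+ 2) <= qform g l x.

Lemma sum_sqr_ge0 (T : Type) (l : seq T) (x : T -> R) : 0 <= \sum_(i <- l) x i ^+ 2.
Proof. by apply: sumr_ge0 => i _; exact: sqr_ge0. Qed.

Lemma sqr_sum_le (T : Type) (l : seq T) (a x : T -> R) :
  (\sum_(j <- l) a j * x j) ^+ 2 <=
  (\sum_(j <- l) a j ^+ 2) * (\sum_(j <- l) x j ^+ 2).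
Proof.
elim: l => [|t l IH]; first by rewrite !big_nil expr0n mulr0.
rewrite !big_cons; move: IH (sum_sqr_ge0 l a) (sum_sqr_ge0 l x).
move: (\sum_(j <- l) a j * x j) (\sum_(j <- l) a j ^+ 2) (\sum_(j <- l) x j ^+ 2).
move: (a t) (x t) => p q u A X uAX A0 X0.
(* This is the inequality of arithmetic and geometric means, as [u ^+ 2 <= A * X]; it is proved
   after multiplication by [X] to avoid square roots. *)
suff h : 2 * (p * q * u) <= p ^+ 2 * X + A * q ^+ 2.
  have -> : (p * q + u) ^+ 2 = p ^+ 2 * q ^+ 2 + 2 * (p * q * u) + u ^+ 2 by ring.
  have -> : (p ^+ 2 + A) * (q ^+ 2 + X) =
    p ^+ 2 * q ^+ 2 + (p ^+ 2 * X + A * q ^+ 2) + A * X by ring.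
  by rewrite !lerD.
have [X00|X00] := eqVneq X 0.
  have u0 : u = 0.
    by apply/eqP; rewrite -sqrf_eq0 eq_le sqr_ge0 andbT (le_trans uAX)// X00 mulr0.
  by rewrite u0 !mulr0 addr_ge0// mulr_ge0 ?sqr_ge0// X00.
have Xp : 0 < X by rewrite lt_def X00.
rewrite -(ler_pM2l Xp) -subr_ge0.
have -> : X * (p ^+ 2 * X + A * q ^+ 2) - X * (2 * (p * q * u)) =
  (p * X - q * u) ^+ 2 + q ^+ 2 * (A * X - u ^+ 2) by ring.
by rewrite addr_ge0 ?sqr_ge0// mulr_ge0 ?sqr_ge0// subr_ge0.
Qed.

Lemma qform_schur (T : Type) (g : T -> T -> R) (t : T) (l : seq T) (x : T -> R) :
  (forall i j, g i j = g j i) -> g t t != 0 ->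
  qform g (t :: l) x =
  g t t * (x t + (\sum_(j <- l) g t j * x j) / g t t) ^+ 2 +
  qform (fun i j => g i j - g i t * g t j / g t t) l x.
Proof.
move=> gs gt0; rewrite /qform big_cons big_cons.
pose L := \sum_(j <- l) g t j * x j.
have e1 : \sum_(j <- l) g t j * x t * x j = x t * L.
  by rewrite mulr_sumr; apply: eq_bigr => j _; ring.
have e2 : \sum_(i <- l) \sum_(j <- t :: l) g i j * x i * x j =
    x t * L + \sum_(i <- l) \sum_(j <- l) g i j * x i * x j.
  rewrite mulr_sumr -big_split /=; apply: eq_bigr => i _.
  by rewrite big_cons (gs i t); congr (_ + _); ring.
have e3 : \sum_(i <- l) \sum_(j <- l) (g i j - g i t * g t j / g t t) * x i * x j =
    \sum_(i <- l) \sum_(j <- l) g i j * x i * x j - L ^+ 2 / g t t.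
  rewrite expr2 {1}/L mulr_suml mulr_suml -sumrB; apply: eq_bigr => i _.
  rewrite /L mulr_sumr mulr_suml -sumrB; apply: eq_bigr => j _.
  by rewrite (gs i t); ring.
rewrite e1 e2 e3 -/L; move: (\sum_(i <- l) _) => W.
by field.
Qed.

(** The witness of failure is carried along because the induction needs it: a witness for the Schur
    complement extends to the whole form by the value at [t] that annihilates the completed square.
    So definiteness of the whole form passes to the complement. *)
Lemma decides_posdef (T : eqType) (l : seq T) (G : T -> T -> expr V) : uniq l ->
  (forall i j, eval rho (G i j) = eval rho (G j i)) ->
  decides (decide_posdef G l) (posdef (fun i j => eval rho (G i j)) l) /\
  (~ posdef (fun i j => eval rho (G i j)) l ->
    exists2 x, exists2 i, i \in l & x i != 0 &
      qform (fun i j => eval rho (G i j)) l x <= 0).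
Proof.
elim: l G => [|t l IH] G /=.
  move=> _ Gs; have p : posdef (fun i j => eval rho (G i j)) [::].
    by exists 1 => // x; rewrite /qform !big_nil mulr0.
  by split => [c1 c2 s h1 _|//]; exact: h1.
move=> /andP[tl ul] Gs; set g := fun i j => eval rho (G i j).
have [g0|g0] := boolP (g t t <= 0).
  pose x i : R := (i == t)%:R.
  have qx : qform g (t :: l) x = g t t.
    have z : \sum_(j <- l) g t j * x t * x j = 0.
      rewrite big_seq big1// => j jl; rewrite /x [j == t](_ : _ = false) ?mulr0//.
      by apply: contraNF tl => /eqP <-.
    rewrite /qform big_cons big_cons z addr0 [X in _ + X]big_seq big1 ?addr0.
      by rewrite /x eqxx !mulr1.
    move=> i il; rewrite big1// => j _; rewrite /x [i == t](_ : _ = false) ?mulr0 ?mul0r//.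
    by apply: contraNF tl => /eqP <-.
  have ex : exists2 x, exists2 i, i \in t :: l & x i != 0 & qform g (t :: l) x <= 0.
    exists x; last by rewrite qx.
    by exists t; rewrite ?mem_head// /x eqxx oner_neq0.
  split => // c1 c2 s _ h2; apply: runs_IfLe; rewrite /= rmorph0 -/(g t t) g0.
  apply: h2 => -[c c0 /(_ x)]; rewrite qx => h.
  have : 0 < c * \sum_(i <- t :: l) x i ^+ 2.
    rewrite mulr_gt0// big_cons ltr_wpDr ?sum_sqr_ge0//.
    by rewrite /x eqxx expr1n.
  by rewrite ltNge (le_trans h).
pose G' i j := Defs.Sub (G i j) (Div (Mul (G i t) (G t j)) (G t t)).
pose g' i j := eval rho (G' i j).
have gs i j : g i j = g j i by exact: Gs.
have G's i j : eval rho (G' i j) = eval rho (G' j i).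
  by rewrite /= -!/(g _ _) (gs i j) (gs i t) (gs t j) [g t i * _]mulrC.
have gt0 : 0 < g t t by rewrite ltNge.
have gt1 : g t t != 0 by rewrite gt_eqF.
have qE x : qform g (t :: l) x =
    g t t * (x t + (\sum_(j <- l) g t j * x j) / g t t) ^+ 2 + qform g' l x.
  by rewrite (qform_schur _ _ gs gt1).
have [d' n'] := IH G' ul G's.
have iffp : posdef g' l <-> posdef g (t :: l).
  split; last first.
    move=> [c c0 h]; apply: contrapT => /n'[x [i il xi]] qx.
    pose y j := if j == t then - (\sum_(j <- l) g t j * x j) / g t t else x j.
    have yl (F : T -> R -> R) : \sum_(j <- l) F j (y j) = \sum_(j <- l) F j (x j).
      rewrite big_seq [RHS]big_seq; apply: eq_bigr => j jl; rewrite /y.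
      by rewrite [j == t](_ : _ = false)//; apply: contraNF tl => /eqP <-.
    have qy : qform g (t :: l) y = qform g' l x.
      rewrite qE (yl (fun j z => g t j * z)) {1}/y eqxx mulNr addNr expr0n mulr0 add0r.
      rewrite /qform (yl (fun i z => \sum_(j <- l) g' i j * z * y j)).
      by apply: eq_bigr => k _; rewrite (yl (fun j z => g' k j * x k * z)).
    have := h y; rewrite qy leNgt => /negP; apply.
    apply: le_lt_trans qx _; rewrite mulr_gt0// big_cons ltr_wpDl ?sqr_ge0//.
    rewrite (yl (fun _ z => z ^+ 2)) (bigD1_seq i)//= ltr_wpDr//.
      by apply: sumr_ge0 => ? _; exact: sqr_ge0.
    by rewrite lt_def sqr_ge0 andbT sqrf_eq0.
  move=> [c c0 h].
  pose K := \sum_(j <- l) (g t j / g t t) ^+ 2.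
  have K0 : 0 <= K by exact: sum_sqr_ge0.
  (* With [L] the linear form added to [x t], one has [x t ^+ 2 <= 2 * (x t + L) ^+ 2 + 2 * L ^+ 2]
     and [L ^+ 2 <= K * X]. The two arguments of the minimum pay for the square and for the rest. *)
  pose b := Num.min (g t t / 2) (c / (2 * K + 1)).
  have K1 : 0 < 2 * K + 1 by rewrite ltr_wpDl// mulr_ge0.
  have b0 : 0 < b by rewrite lt_min !divr_gt0.
  exists b => // x; rewrite qE big_cons.
  have hx := h x; rewrite -/g' in hx; apply: le_trans (lerD (lexx _) hx).
  have Le := sqr_sum_le l (fun j => g t j / g t t) x.
  have LE : (\sum_(j <- l) g t j * x j) / g t t = \sum_(j <- l) g t j / g t t * x j.
    by rewrite mulr_suml; apply: eq_bigr => j _; rewrite mulrAC.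
  rewrite LE; move: Le (sum_sqr_ge0 l x); rewrite -/K.
  move: (\sum_(j <- l) g t j / g t t * x j) (\sum_(j <- l) x j ^+ 2) (x t) => L X xt Le X0.
  have b1 : 2 * b <= g t t.
    by rewrite -ler_pdivlMl// mulrC /b ge_min lexx.
  have b2 : b * (2 * K + 1) <= c by rewrite -ler_pdivlMr// /b ge_min lexx orbT.
  have h1 : 2 * b * (xt + L) ^+ 2 <= g t t * (xt + L) ^+ 2 by rewrite ler_wpM2r ?sqr_ge0.
  have h2 : b * (2 * K + 1) * X <= c * X by rewrite ler_wpM2r.
  have h3 : b * L ^+ 2 <= b * (K * X) by rewrite ler_wpM2l// ltW.
  have h4 : b * xt ^+ 2 <= 2 * b * (xt + L) ^+ 2 + 2 * (b * L ^+ 2).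
    rewrite -subr_ge0 [X in 0 <= X](_ : _ = b * (xt + 2 * L) ^+ 2); last by ring.
    by rewrite mulr_ge0 ?sqr_ge0// ltW.
  apply: (@le_trans _ _ (2 * b * (xt + L) ^+ 2 + b * (2 * K + 1) * X)).
    have -> : b * (2 * K + 1) * X = 2 * (b * (K * X)) + b * X by ring.
    rewrite mulrDr addrA lerD2r (le_trans h4)// lerD2l.
    by rewrite ler_pM2l.
  exact: lerD.
split.
  move=> c1 c2 s h1 h2; apply: runs_IfLe; rewrite /= rmorph0 -/(g t t) (negPf g0).
  by apply: (decides_iff iffp d').
move=> np; have [x [i il xi] qx] := n' (fun p => np (iffp.1 p)).
pose y j := if j == t then - (\sum_(j <- l) g t j * x j) / g t t else x j.
have yl (F : T -> R -> R) : \sum_(j <- l) F j (y j) = \sum_(j <- l) F j (x j).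
  rewrite big_seq [RHS]big_seq; apply: eq_bigr => j jl; rewrite /y.
  by rewrite [j == t](_ : _ = false)//; apply: contraNF tl => /eqP <-.
exists y.
  exists i; first by rewrite inE il orbT.
  by rewrite /y [i == t](_ : _ = false)//; apply: contraNF tl => /eqP <-.
rewrite qE (yl (fun j z => g t j * z)) {1}/y eqxx mulNr addNr expr0n mulr0 add0r.
rewrite /qform (yl (fun i z => \sum_(j <- l) g' i j * z * y j)).
by under eq_bigr => k _ do rewrite (yl (fun j z => g' k j * x k * z)).
Qed.

End Decisions.

(** * Deciding bounds on the lower norm *)

Section NuProgram.
Local Notation eval := Defs.eval.
Context {R : realType} {V : Type} (rho : V -> R) (m n : nat).
Local Notation C := R[i].
Variables (D : 'M[C]_(m, n)) (De : 'I_m -> 'I_n -> expr V * expr V) (eps : expr V).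
Hypothesis DeE : forall r s, ceval rho (De r s) = D r s.

Definition sum_expr (l : seq (expr V)) : expr V := foldr (@Add V) (Const V 0) l.

Lemma eval_sum (l : seq (expr V)) : eval rho (sum_expr l) = \sum_(e <- l) eval rho e.
Proof.
elim: l => [|e l IH]; first by rewrite big_nil /= rmorph0.
by rewrite big_cons /= IH.
Qed.

(* The real matrix of D, acting on pairs (real part, imaginary part); the boolean
   marks imaginary parts. *)
Definition real_entry (i : bool * 'I_m) (j : bool * 'I_n) : expr V :=
  let d := De i.2 j.2 in
  if i.1 == j.1 then d.1 else if i.1 then d.2 else Defs.Sub (Const V 0) d.2.

Definition gram (i j : bool * 'I_n) : expr V :=
  Defs.Sub (sum_expr [seq Mul (real_entry k i) (real_entry k j)
                     | k <- enum {: bool * 'I_m}])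
      (if i == j then Mul eps eps else Const V 0).

(** The sign of [eps] is tested first because [gram] depends on its square only. The continuations
    are swapped since definiteness means that the lower norm exceeds [eps]. *)
Definition decide_nu (c1 c2 : prog V) : prog V :=
  IfLe (Const V 0) eps (decide_posdef gram (enum {: bool * 'I_n}) c2 c1) c2.

Definition real_vec (x : bool * 'I_n -> R) : 'cV[C]_n :=
  \col_s (x (false, s) +i* x (true, s)).

Lemma big_bool_pair (k : nat) (f : bool * 'I_k -> R) :
  \sum_(i <- enum {: bool * 'I_k}) f i = \sum_s (f (false, s) + f (true, s)).
Proof.
rewrite big_enum /= (eq_bigr (fun i => f (i.1, i.2))); last by move=> [].
rewrite -(pair_bigA _ (fun b s => f (b, s))) /= big_bool /= -big_split /=.
by apply: eq_bigr => s _; rewrite addrC.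
Qed.

Lemma sqnorm_real_vec x :
  sqnorm (real_vec x) = \sum_(i <- enum {: bool * 'I_n}) x i ^+ 2.
Proof.
by rewrite big_bool_pair; apply: eq_bigr => s _; rewrite mxE normc_sqr.
Qed.

Lemma sqnorm_mul_real_vec x :
  sqnorm (D *m real_vec x) = \sum_(i <- enum {: bool * 'I_m})
    (\sum_(j <- enum {: bool * 'I_n}) eval rho (real_entry i j) * x j) ^+ 2.
Proof.
rewrite big_bool_pair; apply: eq_bigr => r _; rewrite normc_sqr; congr (_ ^+ 2 + _ ^+ 2).
  rewrite big_bool_pair mxE (big_morph (@complex.Re R) (@cReD R) (erefl : complex.Re (0 : C) = 0)).
  apply: eq_bigr => s _; rewrite mxE cReM -DeE /real_entry /= rmorph0; ring.
rewrite big_bool_pair mxE (big_morph (@complex.Im R) (@cImD R) (erefl : complex.Im (0 : C) = 0)).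
by apply: eq_bigr => s _; rewrite mxE cImM -DeE /real_entry /= addrC.
Qed.

Lemma qform_gram x :
  qform (fun i j => eval rho (gram i j)) (enum {: bool * 'I_n}) x =
  sqnorm (D *m real_vec x) - eval rho eps ^+ 2 * sqnorm (real_vec x).
Proof.
rewrite sqnorm_mul_real_vec sqnorm_real_vec /qform.
set l := enum {: bool * 'I_n}; set l' := enum _.
pose F i j := eval rho (real_entry i j).
have e i j : eval rho (gram i j) * x i * x j =
    \sum_(k <- l') (F k i * x i) * (F k j * x j) -
    (if i == j then eval rho eps ^+ 2 * (x i * x j) else 0).
  rewrite [eval _ _]/= eval_sum big_map mulrBl mulrBl; congr (_ - _).
    by rewrite -mulrA mulr_suml; apply: eq_bigr => k _ /=; rewrite /F; ring.
  by case: eqP => _ /=; rewrite ?expr2 ?rmorph0 ?mul0r// !mulrA.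
under eq_bigr => i _ do (under eq_bigr => j _ do rewrite e).
under eq_bigr => i _ do rewrite sumrB.
rewrite sumrB; congr (_ - _).
  under eq_bigr => i _ do rewrite exchange_big /=.
  rewrite exchange_big /=; apply: eq_bigr => k _; rewrite expr2 mulr_suml.
  by apply: eq_bigr => i _; rewrite mulr_sumr.
rewrite mulr_sumr big_seq [RHS]big_seq; apply: eq_bigr => i il.
rewrite (bigD1_seq i)//= ?enum_uniq// eqxx big1 ?addr0 ?expr2//.
by move=> j /negPf; rewrite eq_sym => ->.
Qed.

Lemma nu_ge0 : (0 <= nu D)%E.
Proof. by apply: le_ereal_inf_tmp => _ [u _ <-]; rewrite lee_fin enorm_ge0. Qed.

Lemma posdef_gram : 0 <= eval rho eps ->
  (~ posdef (fun i j => eval rho (gram i j)) (enum {: bool * 'I_n})) <->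
  (nu D <= (eval rho eps)%:E)%E.
Proof.
move=> e0; have gs i j : eval rho (gram i j) = eval rho (gram j i).
  rewrite /= !eval_sum !big_map; congr (_ - _).
    by apply: eq_bigr => k _ /=; rewrite mulrC.
  by rewrite eq_sym; case: eqP => // ->.
have [_ np] := decides_posdef (enum_uniq {: bool * 'I_n}) gs.
split.
  move=> /np[x [i il xi]]; rewrite qform_gram subr_le0 => h.
  have u0 : 0 < sqnorm (real_vec x).
    rewrite sqnorm_real_vec (bigD1_seq i)//= ?enum_uniq// ltr_wpDr//.
      by apply: sumr_ge0 => ? _; exact: sqr_ge0.
    by rewrite lt_def sqr_ge0 andbT sqrf_eq0.
  apply: (@nu_le _ _ _ _ (real_vec x)); first by rewrite gt_eqF// sqrtr_gt0.
  rewrite -ler_sqr ?nnegrE ?mulr_ge0 ?enorm_ge0// exprMn !enorm_sqr//.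
(* The choice of [d] gives [(eps + d) ^+ 2 <= eps ^+ 2 + d * (2 * eps + 1) <= eps ^+ 2 + c], so a
   unit vector within [d] of [eps] violates definiteness with constant [c]. *)
move=> hnu [c c0 hc]; pose d := Num.min 1 (c / (2 * eval rho eps + 1)).
have k0 : 0 < 2 * eval rho eps + 1 by rewrite ltr_wpDl// mulr_ge0.
have d0 : 0 < d by rewrite lt_min ltr01 divr_gt0.
have [u u1 hu] := nu_approx hnu d0.
pose x (i : bool * 'I_n) : R := if i.1 then complex.Im (u i.2 0) else complex.Re (u i.2 0).
have ux : u = real_vec x.
  by apply/matrixP => r k; rewrite ord1 mxE /x /=; case: (u r 0).
have := hc x; rewrite qform_gram -sqnorm_real_vec -ux -!enorm_sqr u1 expr1n !mulr1.
rewrite leNgt => /negP; apply; rewrite ltrBlDl.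
apply: (@lt_le_trans _ _ ((eval rho eps + d) ^+ 2)).
  by rewrite ltr_sqr ?nnegrE ?enorm_ge0// addr_ge0// ltW.
have -> : (eval rho eps + d) ^+ 2 = eval rho eps ^+ 2 + d * (2 * eval rho eps + d) by ring.
rewrite lerD2l; apply: (@le_trans _ _ (d * (2 * eval rho eps + 1))).
  by rewrite ler_wpM2l ?(ltW d0)// lerD2l /d ge_min lexx.
by rewrite -ler_pdivlMr// /d ge_min lexx orbT.
Qed.

Lemma decides_nu : decides rho decide_nu (nu D <= (eval rho eps)%:E)%E.
Proof.
have gs i j : eval rho (gram i j) = eval rho (gram j i).
  rewrite /= !eval_sum !big_map; congr (_ - _).
    by apply: eq_bigr => k _ /=; rewrite mulrC.
  by rewrite eq_sym; case: eqP => // ->.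
have [dp _] := decides_posdef (enum_uniq {: bool * 'I_n}) gs.
have h := decides_and (@decides_le _ _ rho (Const V 0) eps) (fun _ => decides_not dp).
apply: decides_iff h; rewrite /= rmorph0; split => [[e0 /(posdef_gram e0)]//|hnu].
have e0 : 0 <= eval rho eps by rewrite -lee_fin (le_trans nu_ge0).
by split => //; apply/(posdef_gram e0).
Qed.

End NuProgram.

(** * The program for the grid points *)

Section GammaProgram.
Local Notation eval := Defs.eval.
Variable R : realType.
Local Notation C := R[i].
Variables (n : nat) (K : {fset int}).
Local Notation V := (datum n K).

Definition radius_expr : expr V :=
  Add (Add (Add (Datum (Dalpha n K)) (Datum (Dbeta n K))) (Datum (Dgamma n K)))
    (Datum (Deta n K)).

Definition eps_expr : expr V :=
  Add (Add (Mul (Add (Datum (Dalpha n K)) (Datum (Dgamma n K)))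
                (Const V (22 / (7 * n.+1%:R))%R)) (Const V (3 / n%:R)%R))
    (Datum (Deta n K)).

Definition point_expr (a : int * int) : expr V * expr V :=
  (Const V (a.1%:~R / n%:R), Const V (a.2%:~R / n%:R)).

(** The entries of [Iplus] are 0 or 1 and depend on [n] alone, so they enter as rational constants,
    fixed when the program is built. *)
Definition entry_expr (a : int * int) (k : K * bool) i j : expr V * expr V :=
  let e : rat := (@Iplus R n n i j == 1)%:R in
  (Defs.Sub (Datum (Dentry k.2 k.1 i j false)) (Const V (a.1%:~R / n%:R * e)),
   Defs.Sub (Datum (Dentry k.2 k.1 i j true)) (Const V (a.2%:~R / n%:R * e))).

(** The point 0 lies in [Grid n r] for every [r], whereas the strict comparison of squares would
    reject it for [r = 0]. *)
Definition decide_disc (a : int * int) (c1 c2 : prog V) : prog V :=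
  if a == (0, 0) then c1 else
  IfLe (Mul radius_expr radius_expr)
    (Add (Mul (point_expr a).1 (point_expr a).1)
         (Mul (point_expr a).2 (point_expr a).2)) c2 c1.

Definition decide_point (a : int * int) (c1 c2 : prog V) : prog V :=
  decide_disc a
    (decide_ex (enum {: K * bool}) (fun k => decide_nu (entry_expr a k) eps_expr)
      c1 c2) c2.

Definition int_range (N : nat) : seq int :=
  [seq (i%:Z - N%:Z)%R | i <- iota 0 (N + N).+1].

(** A grid point [(a + i b) / n] of modulus at most the radius has [|a|] and [|b|] at most [n] times
    the radius. Any larger [N] is harmless, as [decide_disc] discards the surplus. *)
Definition Gamma_prog : prog V :=
  search (Mul (Const V n%:R) radius_expr)
    (fun N => collect [seq (a, b) | a <- int_range N, b <- int_range N]
       decide_point point_expr [::]) 0.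

Variables (An : op R n) (abc : R * R * R) (eta : R).
Local Notation rho := (datum_val An abc eta).
Let radius := abc.1.1 + abc.1.2 + abc.2 + eta.
Let eps := eps_star n abc + 3 / n%:R + eta.
Hypotheses (n0 : (0 < n)%N) (radius0 : 0 <= radius).

Lemma mem_int_range N (a : int) : (`|a| <= N)%N -> a \in int_range N.
Proof.
move=> aN; apply/mapP; exists (absz (a + N%:Z)); last by lia.
by rewrite mem_iota; lia.
Qed.

Lemma eval_eps : eval rho eps_expr = eps.
Proof.
rewrite /= /eps /eps_star; congr (_ * _ + _ + _).
  by rewrite fmorph_div rmorphM /= !ratr_nat.
by rewrite fmorph_div /= !ratr_nat.
Qed.

Lemma eval_point a : ceval rho (point_expr a) = (a.1%:~R / n%:R) +i* (a.2%:~R / n%:R).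
Proof. by rewrite /ceval /= !fmorph_div /= !ratr_nat !ratr_int. Qed.

Lemma IplusE i j : @Iplus R n n i j = (@Iplus R n n i j == 1)%:R.
Proof.
rewrite /Iplus mxE; case: ifP => _; rewrite mxE; last by rewrite eq_sym oner_eq0.
by case: (_ == _); rewrite ?eqxx// eq_sym oner_eq0.
Qed.

Lemma eval_entry a (k : K * bool) i j : ceval rho (entry_expr a k i j) =
  (subcol (if k.2 then bitr (mx_of An) else mx_of An) n (val k.1) -
   ceval rho (point_expr a) *: Iplus n n) i j.
Proof.
rewrite eval_point [RHS]mxE [X in _ + X]mxE [X in _ - X]mxE IplusE /ceval /entry_expr.
case: k => k b /=; move: (Iplus n n i j == 1) => e.
rewrite !rmorphM /= !fmorphV /= !ratr_nat !ratr_int.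
set M := if b then _ else _.
case: (subcol _ n _ i j) => u v; case: e => /=; apply: complex_eq => /=; ring.
Qed.

Lemma decides_disc a :
  decides rho (decide_disc a) (Grid n radius (ceval rho (point_expr a))).
Proof.
rewrite /decide_disc; case: eqP => [->|a0] c1 c2 s h1 h2.
  apply: h1; rewrite eval_point; split; first by exists 0, 0.
  have n01 : normc (0 : C) < 1 by rewrite normc0.
  by exists 0; [exact: n01|rewrite mulr0; apply: complex_eq => /=; rewrite mul0r].
have n0' : n%:R != 0 :> R by rewrite pnatr_eq0 -lt0n.
set z := ceval _ _ in h1 h2.
have z0 : z != 0.
  apply/negP => /eqP; rewrite /z eval_point => -[/eqP h3 /eqP h4]; apply: a0.
  move: h3 h4; rewrite !mulf_eq0 !invr_eq0 (negPf n0') !orbF !intr_eq0.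
  by case: (a) => a1 a2 /= /eqP -> /eqP ->.
have zE : normc z ^+ 2 = eval rho (Add (Mul (point_expr a).1 (point_expr a).1)
         (Mul (point_expr a).2 (point_expr a).2)).
  by rewrite normc_sqr /= !expr2.
have rE : radius ^+ 2 = eval rho (Mul radius_expr radius_expr) by rewrite expr2.
have gridz : Grid n radius z <-> ~~ (radius ^+ 2 <= normc z ^+ 2).
  rewrite -ltNge ltr_sqr ?nnegrE ?normc_ge0//; split.
    move=> [_ [w w1 wz]]; rewrite -wz normcM normc_real ger0_norm//.
    rewrite -[ltRHS]mulr1 ltr_pM2l// lt_def radius0 andbT.
    by apply: contra z0 => /eqP r0; rewrite -wz r0 mul0r.
  move=> zr; split; first by exists a.1, a.2; rewrite /z eval_point.
  have r0 : 0 < radius by apply: le_lt_trans zr; exact: normc_ge0.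
  have rC0 : radius%:C != 0 :> C by rewrite (inj_eq (@complexI _) radius 0) gt_eqF.
  have q1 : normc ((radius%:C)^-1 * z) < 1.
    by rewrite normcM normcV normc_real gtr0_norm// mulrC ltr_pdivrMr// mul1r.
  by exists ((radius%:C)^-1 * z); [exact: q1|rewrite mulrA mulfV// mul1r].
apply: runs_IfLe; rewrite -zE -rE; case: ifPn => h.
  by apply: h2 => /gridz; rewrite h.
by apply: h1; apply/gridz.
Qed.

Lemma decides_point a : decides rho (decide_point a)
  (Gamma_fin An K abc eta (ceval rho (point_expr a))).
Proof.
set z := ceval _ _.
pose P (k : K * bool) := (nu (subcol (if k.2 then bitr (mx_of An) else mx_of An) n
   (val k.1) - z *: Iplus n n)%R <= eps%:E)%E.
have dP k : decides rho (decide_nu (entry_expr a k) eps_expr) (P k).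
  rewrite /P -eval_eps; apply: decides_nu => r s; exact: eval_entry.
have h := decides_and (@decides_disc a)
  (fun _ => @decides_ex _ _ rho _ (enum {: K * bool}) _ _ dP).
apply: decides_iff h; rewrite /Gamma_fin; split => [[gz [k _ kP]]|[]].
  split => //; apply/Gamma_epsP; exists (val k.1); first exact: valP.
  by move: kP; rewrite /P; case: (k.2); [right|left].
move=> /Gamma_epsP[k kK hk] gz; split => //.
by case: hk => hk; [exists ([` kK]%fset, false)|exists ([` kK]%fset, true)];
  rewrite ?mem_enum.
Qed.

Lemma Gamma_runs : exists s, runs rho Gamma_prog s /\
  Gamma_fin An K abc eta = [set` s].
Proof.
apply: search_runs => N; rewrite /= ratr_nat -/radius => hN.
have [s [rs sP]] := @collect_runs _ _ rho _
  [seq (a, b) | a <- int_range N, b <- int_range N] _ point_expr _ decides_point [::].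
exists s; split => //; apply/seteqP; split => z /=; last first.
  by move=> /sP[//|[a [_ aP ->]]].
move=> Gz; apply/sP; right.
have [_ [[a [b zE]] zr]] := Gz.
have n0' : 0 < n%:R :> R by rewrite ltr0n.
have zle : normc z <= radius.
  case: zr => w w1 <-; rewrite normcM normc_real ger0_norm//.
  by rewrite -[leRHS]mulr1 ler_wpM2l// ltW.
have le (c : int) : `|c%:~R / n%:R : R| <= radius -> (`|c| <= N)%N.
  rewrite normrM [X in _ * X]ger0_norm ?invr_ge0// ler_pdivrMr// mulrC.
  by move=> /le_trans/(_ hN); rewrite -intr_norm [N%:R]pmulrn ler_int; lia.
have zp : z = ceval rho (point_expr (a, b)) by rewrite eval_point.
exists (a, b); split => //; last by rewrite -zp.
apply/allpairsP; exists (a, b); split => //=; apply: mem_int_range; apply: le.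
  by rewrite (le_trans _ zle)// zE; exact: (Re_le_normc (Complex _ _)).
by rewrite (le_trans _ zle)// zE; exact: (Im_le_normc (Complex _ _)).
Qed.

End GammaProgram.

Theorem theorem7p1 (R : realType) :
  exists alg : forall (n : nat) (K : {fset int}), prog (datum n K),
  forall (mA : forall p, op R p -> nat -> {fset int})
         (mB : forall p, op R p -> R * R * R)
         (eta : op R 1 -> nat -> R),
    input_A mA -> input_B mB -> input_D2 eta ->
  forall A : op R 1, band_dominated A ->
  let K n := mA n (D1 A n) n in
  let abc n := mB n (D1 A n) in
  let Gamma n := Gamma_fin (D1 A n) (K n) (abc n) (eta A n) in
  let Gamma_hat n := fatten (Gamma n) (2 / n%:R) in
  [/\ forall n, (0 < n)%N -> exists s : seq R[i],
        runs (datum_val (D1 A n) (abc n) (eta A n)) (alg n (K n)) s /\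
        Gamma n = [set` s],
      (* As input_B does not bound its values from above uniformly in p, this
         hypothesis cannot be dropped. *)
      eps_star n (abc n) @[n --> \oo] --> 0 ->
        hausdorff (Gamma n) (Spec A) @[n --> \oo] --> 0%E /\
        hausdorff (Gamma_hat n) (Spec A) @[n --> \oo] --> 0%E &
      forall n, (0 < n)%N -> Spec A `<=` Gamma_hat n].
Proof.
exists (fun n K => Gamma_prog R n K) => mA mB eta hA hB hD A bdA K abc Gamma Gamma_hat.
have [bA _] := bdA; have [S AS] := adjoint_exists bA.
have [heta eta0] := hD A bdA.
have bounds n : (0 < n)%N ->
    block_bounds (mx_of (D1 A n)) (abc n).1.1 (abc n).1.2 (abc n).2.
  move=> n0; have [h1 h2 h3] := hB n (D1 A n) n0 (D1_tridiagonal A n0).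
  exact: block_bounds_sup.
have cover n (n0 : (0 < n)%N) := hA n (D1 A n) n n0 (D1_tridiagonal A n0) n0.
have inc n : (0 < n)%N -> Spec A `<=` Gamma_hat n.
  by move=> n0; exact: (Spec_sub_Gamma_hat n0 bA AS (heta n n0) (cover n n0) (bounds n n0)).
split => // [n n0|eps0].
  apply: Gamma_runs => //; have [[a0 b0 c0] _] := bounds n n0.
  by rewrite !addr_ge0// (eta_ge0 (heta n n0)).
(* [eta A n] occurs twice: once in the threshold that defines [Gamma n], once for returning from
   [fejer A n] to [A]. *)
apply: (@hausdorff_cvg _ _ A S Gamma
  (fun n => eps_star n (abc n) + 3 / n%:R + eta A n + eta A n)) => //.
  by move=> n z c n0 [Gz _]; exact: (Gamma_eps_below n0 AS (heta n n0) Gz).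
move=> c c0; have c4 : 0 < c / 4 by rewrite divr_gt0.
have small (f : nat -> R) : f n @[n --> \oo] --> 0 -> \forall n \near \oo, f n < c / 4.
  move=> /cvgrPdist_lt/(_ _ c4); apply: filterS => n.
  by rewrite sub0r normrN; apply: le_lt_trans; exact: ler_norm.
have h1 := small _ eps0; have h2 := small _ eta0.
near=> n.
have e1 : eps_star n (abc n) < c / 4 by near: n.
have e2 : eta A n < c / 4 by near: n.
have e3 : 3 / n%:R < c / 4.
  have n3 : 3 / (c / 4) < n%:R by near: n; exact: nbhs_infty_gtr.
  have n0 : 0 < n%:R :> R by apply: lt_trans n3; rewrite divr_gt0.
  by rewrite ltr_pdivrMr// mulrC -ltr_pdivrMr.
have -> : c = c / 4 + c / 4 + c / 4 + c / 4 by field.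
by rewrite !ltrD.
Unshelve. all: by end_near.
Qed.
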